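(* Let $E$ be a Banach space. The following are equivalent: (1) $E$ has the approximation property; (2) $\mathcal{F}(E\oplus C_1)$ is right flat; (3) $\mathcal{F}(E\oplus C_1)$ is right universally flat.
   Context: Banach spaces are over a fixed scalar field ($\mathbb{R}$ or $\mathbb{C}$), and algebras are associative algebras over that field, not necessarily unital. For a Banach space $X$, $\mathcal{F}(X)$ denotes the norm closure, in the algebra $\mathcal{B}(X)$ of all bounded operators on $X$, of the ideal of finite rank operators. The space $C_1$: for isomorphic Banach spaces $X,Y$ put $d(X,Y)=\inf\{\|T\|\,\|T^{-1}\| : T \text{ an isomorphism from } X \text{ to } Y\}$. Let $\{G_i\}_{i=1}^\infty$ be a sequence of finite dimensional Banach spaces such that (i) for each finite dimensional space $H$ and each $\epsilon>0$ there is an $i$ with $d(H,G_i)<1+\epsilon$; (ii) for each $i$ there are infinitely many $j\neq i$ such that $G_j$ is isometric to $G_i$. Then $C_1=(\bigoplus_{i=1}^\infty G_i)_1$, the $\ell_1$ direct sum. Up to isomorphism it is independent of the choice of $\{G_i\}$. Flatness: a right module $X$ over an algebra $A$ is flat if for every exact sequence $0\to M'\to M\to M''\to 0$ of left $A$-modules the sequence $0\to X\otimes_A M'\to X\otimes_A M\to X\otimes_A M''\to 0$ is exact. An algebra $A$ is right flat if it is flat as a right module over itself. An algebra $A$ is right universally flat if, whenever $A$ is embedded as a right ideal in an algebra $B$, $A$ is a flat right $B$-module. *)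

(* Defs.v *)
From HB Require Import structures.
From mathcomp Require Import all_boot all_order all_algebra.
From mathcomp Require Import complex.
From mathcomp Require Import all_classical all_reals all_analysis.

Set Implicit Arguments.
Unset Strict Implicit.
Unset Printing Implicit Defensive.

Import Order.TTheory GRing.Theory Num.Theory.
Import numFieldNormedType.Exports.

Local Open Scope classical_set_scope.
Local Open Scope ring_scope.
Local Open Scope quotient_scope.

Variant scalar_kind := RealScalars | ComplexScalars.

Definition scalars (R : realType) (k : scalar_kind) : numFieldType :=
  match k with RealScalars => R | ComplexScalars => R[i] end.

(* A bounded set of nonnegative scalars has a least upper bound: over the
   complex numbers, the order of mathcomp only compares numbers with the same
   imaginary part, so all upper bounds of such a set are real. *)
Lemma nonneg_supremums (R : realType) (k : scalar_kind)
    (A : set (scalars R k)) :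
  A !=set0 -> (forall x, A x -> 0 <= x) -> ubound A !=set0 ->
  supremums A !=set0.
Proof.
case: k A => /= A A0 Age [M uM].
  have hA : has_sup A by split=> //; exists M.
  by exists (sup A); split; [exact: sup_upper_bound
                            |move=> y uy; exact: ge_sup].
have AE x : A x -> x = (complex.Re x)%:C%C.
  move=> /Age; case: x => a b /=.
  by rewrite lecE /= => /andP[/eqP -> _].
pose B : set R := [set complex.Re x | x in A].
have hB : has_sup B.
  split; first by case: A0 => x Ax; exists (complex.Re x); exists x.
  exists (complex.Re M) => _ [x Ax <-].
  by move: (uM _ Ax); rewrite lecE => /andP[].
exists (sup B)%:C%C; split.
  move=> x Ax; rewrite (AE _ Ax) lecR.
  by apply: sup_upper_bound => //; exists x.
move=> y uy; case: A0 => x0 Ax0.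
have := uy _ Ax0; rewrite {1}(AE _ Ax0) lecE /= => /andP[/eqP yr _].
rewrite lecE /= yr eqxx /=; apply: ge_sup; first by case: hB.
by move=> _ [x Ax <-]; move: (uy _ Ax); rewrite lecE => /andP[].
Qed.

Lemma cvgn_monotone (R : realType) (k : scalar_kind)
    (u : nat -> scalars R k) (M : scalars R k) :
  {homo u : m n / (m <= n)%N >-> m <= n} -> (forall n, 0 <= u n) ->
  (forall n, u n <= M) ->
  [/\ cvgn u, forall n, u n <= limn u & limn u <= M].
Proof.
move=> um u0 uM.
have [|||l [ul lu]] := @nonneg_supremums R k (range u).
- by exists (u 0%N), 0%N.
- by move=> _ [n _ <-].
- by exists M => _ [n _ <-].
have l0 : 0 <= l by apply: le_trans (u0 0%N) (ul _ _); exists 0%N.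
suff cl : u n @[n --> \oo] --> l.
  have -> : limn u = l by exact/cvg_lim.
  split; first exact: cl.
    by move=> n; apply: ul; exists n.
  by apply: lu => _ [n _ <-].
apply/cvgrPdist_lt => e e0.
have [N uN] : exists n, l - e < u n.
  apply: contrapT => /forallNP h.
  suff : l <= l - e by rewrite lerBrDl gerDr => /(lt_le_trans e0); rewrite ltxx.
  apply: lu => _ [n _ <-]; have /negP := h n.
  by rewrite real_ltNge ?negbK ?rpredB ?ger0_real// ltW.
near=> n.
have nN : (N <= n)%N by near: n; exact: nbhs_infty_ge.
rewrite ger0_norm ?subr_ge0; last by apply: ul; exists n.
by rewrite ltrBlDr -ltrBlDl; apply: lt_le_trans uN (um _ _ nN).
Unshelve. all: by end_near. Qed.

Section Operators.
Variable K : numFieldType.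

(* [supremum 0 A] is the least upper bound of [A], and [0] if [A] is empty. *)
Definition opnorm (V W : normedModType K) (T : V -> W) : K :=
  supremum 0 [set `|T x| | x in [set x : V | `|x| <= 1]].

Definition bounded_operator (V W : normedModType K) (T : V -> W) : Prop :=
  linear T /\ continuous T.

Definition finite_dimensional (V : lmodType K) (S : set V) : Prop :=
  exists n (e : 'I_n -> V),
    forall v, S v -> exists c : 'I_n -> K, v = \sum_(i < n) c i *: e i.

Definition finite_rank (V W : normedModType K) (T : V -> W) : Prop :=
  bounded_operator T /\ finite_dimensional (range T).

Definition approximation_property (V : normedModType K) : Prop :=
  forall A : set V, compact A -> forall e : K, 0 < e ->
    exists T : V -> V, finite_rank T /\ forall x, A x -> `|T x - x| < e.

Definition mutually_inverse (V W : normedModType K) (T : V -> W) (S : W -> V) :=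
  [/\ bounded_operator T, bounded_operator S, cancel T S & cancel S T].

Definition isomorphic (V W : normedModType K) : Prop :=
  exists (T : V -> W) (S : W -> V), mutually_inverse T S.

(* Meaningful for isomorphic spaces only: the infimum of the empty set is 0. *)
Definition bm_dist (V W : normedModType K) : K :=
  infimum 0 [set r | exists (T : V -> W) (S : W -> V),
                       mutually_inverse T S /\ r = opnorm T * opnorm S].

Definition isometric (V W : normedModType K) : Prop :=
  exists T : V -> W, [/\ linear T, bijective T & forall x, `|T x| = `|x|].

Definition C1_sequence (G : nat -> completeNormedModType K) : Prop :=
  [/\ forall i, finite_dimensional [set: G i],
      forall H : completeNormedModType K, finite_dimensional [set: H] ->
        forall e : K, 0 < e ->
        exists i, isomorphic H (G i) /\ bm_dist H (G i) < 1 + e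
    & forall i, infinite_set [set j | j <> i /\ isometric (G j) (G i)]].

End Operators.


Section L1Sum.
Context {R : realType} {k : scalar_kind}.
Local Notation K := (scalars R k).
Variable G : nat -> completeNormedModType K.

Record l1_sum := L1Sum {
  l1_val :> forall i, G i;
  l1_summable : cvgn (series (fun i => `|l1_val i|)) }.

Lemma l1_sum_eq (x y : l1_sum) : (forall i, x i = y i) -> x = y.
Proof.
case: x y => [x xs] [y ys] /= xy.
have {}xy : x = y by exact: functional_extensionality_dep.
by case: y / xy ys => ys; congr L1Sum; exact: Prop_irrelevance.
Qed.

HB.instance Definition _ := gen_eqMixin l1_sum.
HB.instance Definition _ := gen_choiceMixin l1_sum.

Let nseries (x : forall i, G i) : nat -> K := series (fun i => `|x i|).

Definition l1_norm (x : l1_sum) : K := limn (series (fun i => `|x i|)).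

Let nseries_mono (x : forall i, G i) :
  {homo nseries x : m n / (m <= n)%N >-> m <= n}.
Proof. by apply/nondecreasing_seqP => n; rewrite /nseries seriesSr lerDl. Qed.

Let nseries_ge0 (x : forall i, G i) n : 0 <= nseries x n.
Proof. by apply: sumr_ge0. Qed.

Let nseriesP (x : forall i, G i) (M : K) : (forall n, nseries x n <= M) ->
  [/\ cvgn (nseries x), forall n, nseries x n <= limn (nseries x)
    & limn (nseries x) <= M].
Proof. exact: cvgn_monotone. Qed.

Let nseries_le (x : l1_sum) n : nseries x n <= l1_norm x.
Proof.
have /= /ex_bound [|M MP] :=
  @cvg_seq_bounded K K^o (nseries x) (@l1_summable x).
  exact: (@globally_properfilter _ setT 0%N).
have [|_ + _] := @nseriesP x M; last exact.
by move=> m; have := MP m I; rewrite /= ger0_norm.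
Qed.

Let bounded_summable (x : forall i, G i) (M : K) :
  (forall n, nseries x n <= M) -> cvgn (series (fun i => `|x i|)).
Proof. by case/nseriesP. Qed.

Let l1_norm_le (x : l1_sum) (M : K) :
  (forall n, nseries x n <= M) -> l1_norm x <= M.
Proof. by case/nseriesP. Qed.

Let nseries0 n : nseries (fun i => 0 : G i) n <= 0.
Proof. by rewrite /nseries /series/= big1// => i _; rewrite normr0. Qed.

Let nseriesN (x : l1_sum) n : nseries (fun i => - x i) n <= l1_norm x.
Proof.
rewrite (le_trans _ (nseries_le x n))//.
by apply: ler_sum => i _; rewrite normrN.
Qed.

Let nseriesD (x y : l1_sum) n :
  nseries (fun i => x i + y i) n <= l1_norm x + l1_norm y.
Proof.
rewrite (le_trans _ (lerD (nseries_le x n) (nseries_le y n)))//.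
by rewrite /nseries /series/= -big_split; apply: ler_sum => i _; exact: ler_normD.
Qed.

Let nseriesZ (c : K) (x : l1_sum) n :
  nseries (fun i => c *: x i) n <= `|c| * l1_norm x.
Proof.
rewrite (le_trans _ (ler_wpM2l _ (nseries_le x n)))//.
by rewrite /nseries /series/= big_distrr; apply: ler_sum => i _; rewrite normrZ.
Qed.

Definition l1_zero := L1Sum (bounded_summable nseries0).
Definition l1_opp (x : l1_sum) := L1Sum (bounded_summable (nseriesN x)).
Definition l1_add (x y : l1_sum) := L1Sum (bounded_summable (nseriesD x y)).
Definition l1_scale (c : K) (x : l1_sum) :=
  L1Sum (bounded_summable (nseriesZ c x)).

Let l1_addA : associative l1_add.
Proof. by move=> x y z; apply: l1_sum_eq => i /=; rewrite addrA. Qed.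

Let l1_addC : commutative l1_add.
Proof. by move=> x y; apply: l1_sum_eq => i /=; rewrite addrC. Qed.

Let l1_add0 : left_id l1_zero l1_add.
Proof. by move=> x; apply: l1_sum_eq => i /=; rewrite add0r. Qed.

Let l1_addN : left_inverse l1_zero l1_opp l1_add.
Proof. by move=> x; apply: l1_sum_eq => i /=; rewrite addNr. Qed.

HB.instance Definition _ :=
  GRing.isZmodule.Build l1_sum l1_addA l1_addC l1_add0 l1_addN.

Let l1_scaleA (a b : K) (x : l1_sum) :
  l1_scale a (l1_scale b x) = l1_scale (a * b) x.
Proof. by apply: l1_sum_eq => i /=; rewrite scalerA. Qed.

Let l1_scale1 : left_id 1 l1_scale.
Proof. by move=> x; apply: l1_sum_eq => i /=; rewrite scale1r. Qed.

Let l1_scaleDr : right_distributive l1_scale +%R.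
Proof. by move=> a x y; apply: l1_sum_eq => i /=; rewrite scalerDr. Qed.

Let l1_scaleDl (x : l1_sum) : {morph l1_scale^~ x : a b / a + b}.
Proof. by move=> a b; apply: l1_sum_eq => i /=; rewrite scalerDl. Qed.

HB.instance Definition _ := GRing.Zmodule_isLmodule.Build K l1_sum
  l1_scaleA l1_scale1 l1_scaleDr l1_scaleDl.

Let l1_normD (x y : l1_sum) : l1_norm (x + y) <= l1_norm x + l1_norm y.
Proof. exact/l1_norm_le/nseriesD. Qed.

Let l1_normZ (c : K) (x : l1_sum) : l1_norm (c *: x) = `|c| * l1_norm x.
Proof.
have le_normZ a y : l1_norm (a *: y) <= `|a| * l1_norm y.
  exact/l1_norm_le/nseriesZ.
have [->|c0] := eqVneq c 0.
  apply/le_anti; rewrite le_normZ normr0 mul0r /=.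
  exact: le_trans (nseries_ge0 _ 0%N) (nseries_le _ 0%N).
apply/le_anti; rewrite le_normZ -ler_pdivlMl ?normr_gt0// -normfV.
by rewrite -{1}[x](scalerK c0) le_normZ.
Qed.

Let l1_norm0_eq0 (x : l1_sum) : l1_norm x = 0 -> x = 0.
Proof.
move=> x0; apply: l1_sum_eq => i /=; apply/eqP; rewrite -normr_le0 -x0.
rewrite (le_trans _ (nseries_le x i.+1))// /nseries seriesSr lerDr.
exact: nseries_ge0.
Qed.

HB.instance Definition _ := Lmodule_isNormed.Build K l1_sum
  l1_normD l1_normZ l1_norm0_eq0.

End L1Sum.

Record algebra (K : fieldType) := Algebra {
  alg_sort :> lmodType K;
  amul : alg_sort -> alg_sort -> alg_sort;
  amulA : associative amul;
  amul_linearl : forall b, linear (amul^~ b);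
  amul_linearr : forall a, linear (amul a) }.

Section Modules.
Variables (K : fieldType) (A : algebra K).

Record left_module := LeftModule {
  lmod_sort :> lmodType K;
  lact : A -> lmod_sort -> lmod_sort;
  lactM : forall a b m, lact (amul a b) m = lact a (lact b m);
  lact_linearl : forall m, linear (lact^~ m);
  lact_linearr : forall a, linear (lact a) }.

Record right_module := RightModule {
  rmod_sort :> lmodType K;
  ract : rmod_sort -> A -> rmod_sort;
  ractM : forall x a b, ract x (amul a b) = ract (ract x a) b;
  ract_linearl : forall a, linear (ract^~ a);
  ract_linearr : forall x, linear (ract x) }.

Definition module_hom (M N : left_module) (f : M -> N) : Prop :=
  linear f /\ forall a m, f (lact a m) = lact a (f m).

Definition regular_module : right_module :=
  RightModule (fun x a b => amulA x a b) (@amul_linearl K A)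
    (@amul_linearr K A).

End Modules.

(* A finite formal sum [x_1 (x) m_1 + ... + x_n (x) m_n] is represented by the
   sequence of the pairs [(x_i, m_i)], the concatenation being the addition;
   the tensor product is the quotient by the smallest congruence containing the
   K-bilinearity and A-balancedness relations. *)
Section Tensor.
Variables (K : fieldType) (A : algebra K).
Variables (X : right_module A) (M : left_module A).
Local Notation fsum := (seq (X * M)).

Inductive teq : fsum -> fsum -> Prop :=
| teq_refl s : teq s s
| teq_sym s t : teq s t -> teq t s
| teq_trans s t u : teq s t -> teq t u -> teq s u
| teq_cat s s' t t' : teq s s' -> teq t t' -> teq (s ++ t) (s' ++ t')
| teq_catC s t : teq (s ++ t) (t ++ s)
| teq_0 m : teq [:: (0, m)] [::]
| teq_Dl x y m : teq [:: (x + y, m)] [:: (x, m); (y, m)]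
| teq_Dr x m n : teq [:: (x, m + n)] [:: (x, m); (x, n)]
| teq_Z c x m : teq [:: (c *: x, m)] [:: (x, c *: m)]
| teq_act x a m : teq [:: (ract x a, m)] [:: (x, lact a m)].

Definition teqb (s t : fsum) : bool := `[< teq s t >].

Let teqb_refl : reflexive teqb.
Proof. by move=> s; apply/asboolP; exact: teq_refl. Qed.

Let teqb_sym : symmetric teqb.
Proof. by move=> s t; apply/asboolP/asboolP; exact: teq_sym. Qed.

Let teqb_trans : transitive teqb.
Proof.
by move=> t s u /asboolP st /asboolP tu; apply/asboolP; exact: teq_trans st tu.
Qed.

Canonical teq_equiv := EquivRel teqb teqb_refl teqb_sym teqb_trans.

Definition tensor := {eq_quot teq_equiv}.

HB.instance Definition _ := Choice.on tensor.
HB.instance Definition _ := EqQuotient.on tensor.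

Definition tsum (s : fsum) : tensor := \pi_tensor s.

Definition tpure (x : X) (m : M) : tensor := tsum [:: (x, m)].

Lemma tsumP s t : tsum s = tsum t <-> teq s t.
Proof. by split=> [/eqmodP/asboolP//|st]; apply/eqmodP/asboolP. Qed.

Lemma tsum_repr (u : tensor) : tsum (repr u) = u.
Proof. exact: reprK. Qed.

Let zscale (c : K) (p : X * M) : X * M := (c *: p.1, p.2).

Let teq_zscale c s t : teq s t -> teq (map (zscale c) s) (map (zscale c) t).
Proof.
elim=> {s t} /=.
- by move=> s; exact: teq_refl.
- by move=> s t _; exact: teq_sym.
- by move=> s t u _ st _; exact: teq_trans.
- by move=> s s' t t' _ ss _ tt; rewrite !map_cat; exact: teq_cat.
- by move=> s t; rewrite !map_cat; exact: teq_catC.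
- by move=> m; rewrite /zscale/= scaler0; exact: teq_0.
- by move=> x y m; rewrite /zscale/= scalerDr; exact: teq_Dl.
- by move=> x m n; exact: teq_Dr.
- by move=> d x m; rewrite /zscale/= scalerA mulrC -scalerA; exact: teq_Z.
- move=> x a m; rewrite /zscale/=.
  have := ract_linearl a c x 0; rewrite !addr0 /=.
  have -> : ract (0 : X) a = 0.
    have := ract_linearl a (-1) (0 : X) 0.
    by rewrite /= scaler0 addr0 scaleN1r addNr.
  by rewrite addr0 => <-; exact: teq_act.
Qed.

Definition tensor_zero : tensor := tsum [::].
Definition tensor_add (u v : tensor) : tensor := tsum (repr u ++ repr v).
Definition tensor_scale (c : K) (u : tensor) : tensor :=
  tsum [seq (c *: p.1, p.2) | p <- repr u].

Let teq_repr s : teq (repr (tsum s)) s.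
Proof. by apply/tsumP; exact: tsum_repr. Qed.

Let addE s t : tensor_add (tsum s) (tsum t) = tsum (s ++ t).
Proof. by apply/tsumP/teq_cat; exact: teq_repr. Qed.

Let scaleE c s : tensor_scale c (tsum s) = tsum (map (zscale c) s).
Proof. by apply/tsumP/teq_zscale; exact: teq_repr. Qed.

Let tsum_ind (P : tensor -> Prop) : (forall s, P (tsum s)) -> forall u, P u.
Proof. by move=> Ps u; rewrite -(tsum_repr u). Qed.

Let tensor_addA : associative tensor_add.
Proof.
elim/tsum_ind=> s; elim/tsum_ind=> t; elim/tsum_ind=> u.
by rewrite !addE catA.
Qed.

Let tensor_addC : commutative tensor_add.
Proof.
elim/tsum_ind=> s; elim/tsum_ind=> t; rewrite !addE.
by apply/tsumP; exact: teq_catC.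
Qed.

Let tensor_add0 : left_id tensor_zero tensor_add.
Proof. by elim/tsum_ind=> s; rewrite addE. Qed.

Let tensor_addN : left_inverse tensor_zero (tensor_scale (-1)) tensor_add.
Proof.
elim/tsum_ind; elim=> [|[x m] s IH]; first by rewrite scaleE addE.
rewrite scaleE /= -cat1s -[(x, m) :: s]cat1s -!addE -scaleE.
set u := tensor_scale _ _ in IH *; set p := tsum [:: (x, m)].
rewrite -tensor_addA [tensor_add u _]tensor_addA (tensor_addC u p).
rewrite -tensor_addA IH tensor_addA tensor_addC tensor_add0 /p addE.
rewrite /zscale /= scaleN1r.
apply/tsumP; apply: teq_trans (teq_sym (teq_Dl _ _ _)) _.
by rewrite addNr; exact: teq_0.
Qed.

HB.instance Definition _ := GRing.isZmodule.Build tensor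
  tensor_addA tensor_addC tensor_add0 tensor_addN.

Let tsum_cons x m s : tsum ((x, m) :: s) = tpure x m + tsum s.
Proof. by rewrite -cat1s -addE. Qed.

Let tensor_scaleA (a b : K) (u : tensor) :
  tensor_scale a (tensor_scale b u) = tensor_scale (a * b) u.
Proof.
elim/tsum_ind: u => s; rewrite !scaleE -map_comp; congr tsum.
by apply: eq_map => p; rewrite /zscale/= scalerA.
Qed.

Let tensor_scale1 : left_id 1 tensor_scale.
Proof.
elim/tsum_ind=> s; rewrite scaleE -[in RHS](map_id s); congr tsum.
by apply: eq_map => -[x m]; rewrite /zscale/= scale1r.
Qed.

Let tensor_scaleDr : right_distributive tensor_scale +%R.
Proof.
move=> c; elim/tsum_ind=> s; elim/tsum_ind=> t.
by rewrite [_ + _]addE !scaleE map_cat [RHS]addE.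
Qed.

Let tensor_scaleDl (u : tensor) : {morph tensor_scale^~ u : a b / a + b}.
Proof.
move=> a b; elim/tsum_ind: u; elim=> [|[x m] s /=].
  by rewrite !scaleE; symmetry; exact: add0r.
rewrite !scaleE /= => IH.
rewrite !tsum_cons addrACA -IH; congr (_ + _).
by rewrite [RHS]addE /= scalerDl; apply/tsumP; exact: teq_Dl.
Qed.

HB.instance Definition _ := GRing.Zmodule_isLmodule.Build K tensor
  tensor_scaleA tensor_scale1 tensor_scaleDr tensor_scaleDl.

End Tensor.

(* The map induced on [X (x)_A M] by [f] does not depend on the choice of
   representatives when [f] is a module morphism, see [tensor_mapE]. *)
Definition tensor_map (K : fieldType) (A : algebra K) (X : right_module A)
    (M N : left_module A) (f : M -> N) (u : tensor X M) : tensor X N :=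
  tsum [seq (p.1, f p.2) | p <- repr u].

Lemma tensor_mapE (K : fieldType) (A : algebra K) (X : right_module A)
    (M N : left_module A) (f : M -> N) (s : seq (X * M)) :
  module_hom f ->
  tensor_map f (tsum s) = tsum [seq (p.1, f p.2) | p <- s].
Proof.
move=> [flin fA]; apply/tsumP; have /tsumP := tsum_repr (tsum s).
move: (repr _) => t.
pose F := GRing.isLinear.Build K M N *:%R f flin.
pose g : {linear M -> N} := HB.pack f F.
elim=> {s t} /=.
- by move=> s; exact: teq_refl.
- by move=> s t _; exact: teq_sym.
- by move=> s t u _ st _; exact: teq_trans.
- by move=> s s' t t' _ ss _ tt; rewrite !map_cat; exact: teq_cat.
- by move=> s t; rewrite !map_cat; exact: teq_catC.
- by move=> m; exact: teq_0.
- by move=> x y m; exact: teq_Dl.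
- by move=> x m n; rewrite -[f]/(g : M -> N) linearD; exact: teq_Dr.
- by move=> d x m; rewrite -[f]/(g : M -> N) linearZ; exact: teq_Z.
- by move=> x a m; rewrite fA; exact: teq_act.
Qed.

Definition short_exact (U V W : zmodType) (f : U -> V) (g : V -> W) : Prop :=
  [/\ injective f, range f = g @^-1` [set 0] & range g = setT].

Definition flat (K : fieldType) (A : algebra K) (X : right_module A) : Prop :=
  forall (M' M M'' : left_module A) (f : M' -> M) (g : M -> M''),
    module_hom f -> module_hom g -> short_exact f g ->
    short_exact (tensor_map (X := X) f) (tensor_map (X := X) g).

Definition right_flat (K : fieldType) (A : algebra K) : Prop :=
  flat (regular_module A).

Definition algebra_embedding (K : fieldType) (A B : algebra K) (j : A -> B) :=
  [/\ linear j, forall a b, j (amul a b) = amul (j a) (j b) & injective j].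

Definition right_ideal (K : fieldType) (B : algebra K) (I : set B) : Prop :=
  [/\ I 0, forall (c : K) x y, I x -> I y -> I (c *: x + y)
    & forall x b, I x -> I (amul x b)].

(* [A], embedded by [j] as a right ideal of [B], seen as a right [B]-module. *)
Section IdealModule.
Variables (K : fieldType) (A B : algebra K) (j : A -> B).
Hypotheses (je : algebra_embedding j) (jI : right_ideal (range j)).

Let ideal_act_ex (a : A) (b : B) : exists c, j c = amul (j a) b.
Proof.
case: jI => _ _ /(_ (j a) b) [|c _ jc]; first by exists a.
by exists c.
Qed.

Definition ideal_act (a : A) (b : B) : A := projT1 (cid (ideal_act_ex a b)).

Lemma ideal_actE a b : j (ideal_act a b) = amul (j a) b.
Proof. by rewrite /ideal_act; case: cid. Qed.

Let ideal_actM x a b : ideal_act x (amul a b) = ideal_act (ideal_act x a) b.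
Proof. by case: je => _ _; apply; rewrite !ideal_actE amulA. Qed.

Let ideal_act_linearl b : linear (ideal_act^~ b).
Proof.
by case: je => jl _ ji c x y; apply: ji; rewrite jl !ideal_actE jl amul_linearl.
Qed.

Let ideal_act_linearr a : linear (ideal_act a).
Proof.
by case: je => jl _ ji c x y; apply: ji; rewrite jl !ideal_actE amul_linearr.
Qed.

Definition ideal_module : right_module B :=
  RightModule ideal_actM ideal_act_linearl ideal_act_linearr.

End IdealModule.

Definition right_universally_flat (K : fieldType) (A : algebra K) : Prop :=
  forall (B : algebra K) (j : A -> B) (je : algebra_embedding j)
    (jI : right_ideal (range j)), flat (ideal_module je jI).

Section BoundedOperators.
Context {R : realType} {k : scalar_kind}.
Local Notation K := (scalars R k).

Lemma bounded_operatorP (V W : normedModType K) (T : V -> W) : linear T ->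
  continuous T <-> exists2 M : K, 0 < M & forall x, `|T x| <= M * `|x|.
Proof.
move=> Tl.
pose F := GRing.isLinear.Build K V W *:%R T Tl.
pose g : {linear V -> W} := HB.pack T F.
rewrite -[T]/(g : V -> W); split.
  by move=> /linear_bounded_continuous/linear_boundedP/pinfty_ex_gt0.
move=> [M M0 MP]; apply/linear_bounded_continuous/linear_boundedP.
exists M; split; first exact: gtr0_real.
by move=> r /ltW Mr x; rewrite (le_trans (MP x))// ler_wpM2r.
Qed.

Lemma opnorm_bound (V W : normedModType K) (T : V -> W) :
  bounded_operator T ->
  0 <= opnorm T /\ forall x, `|T x| <= opnorm T * `|x|.
Proof.
move=> [Tl Tc]; have [M M0 MP] := (bounded_operatorP Tl).1 Tc.
have T0 : T 0 = 0.
  by have := Tl (-1) 0 0; rewrite scaler0 addr0 scaleN1r addNr.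
have ne : supremums [set `|T x| | x in [set x : V | `|x| <= 1]] !=set0.
  apply: nonneg_supremums.
  - by exists `|T 0|; exists 0 => //=; rewrite normr0.
  - by move=> _ [x _ <-].
  - exists M => _ [x /= x1 <-].
    by rewrite (le_trans (MP x))// ler_piMr// ltW.
have ub x : `|x| <= 1 -> `|T x| <= opnorm T.
  move=> x1; rewrite /opnorm /supremum; case: ifPn => [/eqP A0|_].
    suff : [set `|T y| | y in [set y : V | `|y| <= 1]] `|T x| by rewrite A0.
    by exists x.
  case: ne => l lP; case: xgetP => [y _ [yub _]|/(_ l)//].
  by apply: yub; exists x.
split; first by have := ub 0; rewrite T0 !normr0; apply.
move=> x; have [->|x0] := eqVneq x 0; first by rewrite T0 !normr0 mulr0.
have nx : 0 < `|x| by rewrite normr_gt0.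
have Tx : T (`|x|^-1 *: x) = `|x|^-1 *: T x.
  by have := Tl `|x|^-1 x 0; rewrite T0 !addr0.
have := ub (`|x|^-1 *: x); rewrite Tx !normrZ normfV normr_id.
by rewrite mulVf ?gt_eqF// => /(_ (lexx _)); rewrite ler_pdivrMl// mulrC.
Qed.

Lemma opnorm_le (V W : normedModType K) (T : V -> W) (M : K) : 0 <= M ->
  (forall x, `|T x| <= M * `|x|) -> opnorm T <= M.
Proof.
move=> M0 MP; rewrite /opnorm /supremum; case: ifPn => // _.
have [|||l lP] := @nonneg_supremums R k
    [set `|T x| | x in [set x : V | `|x| <= 1]].
- by exists `|T 0|; exists 0 => //=; rewrite normr0.
- by move=> _ [x _ <-].
- by exists M => _ [x /= x1 <-]; rewrite (le_trans (MP x))// ler_piMr.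
case: xgetP => [y _ [_]|/(_ l) //]; apply.
by move=> _ [x /= x1 <-]; rewrite (le_trans (MP x))// ler_piMr.
Qed.

Definition approximable (X : normedModType K) (T : X -> X) : Prop :=
  bounded_operator T /\ forall e : K, 0 < e ->
    exists S : X -> X, finite_rank S /\ opnorm (T \- S) < e.

End BoundedOperators.

Section ApproximableAlgebra.
Context {R : realType} {k : scalar_kind}.
Local Notation K := (scalars R k).
Variable X : normedModType K.
Implicit Types S T : X -> X.

Let boundedD (c : K) S T : bounded_operator S -> bounded_operator T ->
  bounded_operator (fun x => c *: S x + T x).
Proof.
move=> [Sl Sc] [Tl Tc]; have [a a0 aP] := (bounded_operatorP Sl).1 Sc.
have [b b0 bP] := (bounded_operatorP Tl).1 Tc.
have l : linear (fun x => c *: S x + T x).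
  move=> d x y; rewrite Sl Tl !scalerDr !scalerA (mulrC c) addrACA.
  by rewrite -!scalerA.
split=> //; apply/(bounded_operatorP l); exists (`|c| * a + b).
  by rewrite ltr_wpDl// mulr_ge0// ltW.
move=> x; rewrite mulrDl (le_trans (ler_normD _ _))// lerD// normrZ -mulrA.
by rewrite ler_wpM2l.
Qed.

Let approxP T : approximable T <->
  bounded_operator T /\ forall e : K, 0 < e ->
    exists S, finite_rank S /\ forall x, `|T x - S x| <= e * `|x|.
Proof.
split=> -[Tb TP]; split=> // e e0.
  have [S [Sf TS]] := TP _ e0; exists S; split=> // x.
  have Db : bounded_operator (T \- S).
    have := boundedD (-1) Sf.1 Tb; congr bounded_operator.
    by apply/funext => y; rewrite scaleN1r addrC.
  have [_ /(_ x) h] := opnorm_bound Db.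
  by rewrite (le_trans h)// ler_wpM2r// ltW.
have e20 : 0 < e / 2 by rewrite divr_gt0.
have [S [Sf TS]] := TP _ e20; exists S; split=> //.
apply: (@le_lt_trans _ _ (e / 2)); first by apply: opnorm_le => //; rewrite ltW.
by rewrite ltr_pdivrMr// ltr_pMr// ltr1n.
Qed.

Let finite_rankD (c : K) S T : finite_rank S -> finite_rank T ->
  finite_rank (fun x => c *: S x + T x).
Proof.
move=> [Sb [n [e eP]]] [Tb [m [f fP]]]; split; first exact: boundedD.
exists (n + m)%N, (fun i => match fintype.split i with inl i => e i | inr j => f j end).
move=> _ [x _ <-].
have [|a ->] := eP (S x); first by exists x.
have [|b ->] := fP (T x); first by exists x.
exists (fun i => match fintype.split i with inl i => c * a i | inr j => b j end).
rewrite big_split_ord /= scaler_sumr; congr (_ + _); apply: eq_bigr => i _.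
  by rewrite -[lshift _ _]/(unsplit (inl i)) unsplitK scalerA.
by rewrite -[rshift _ _]/(unsplit (inr i)) unsplitK.
Qed.

Let finite_rank0 : finite_rank (fun _ : X => 0 : X).
Proof.
have l : linear (fun _ : X => 0 : X) by move=> c x y; rewrite scaler0 addr0.
split; first by split=> //; exact: cst_continuous.
exists 0%N, (fun=> 0) => _ [x _ <-]; exists (fun=> 0).
by rewrite big_ord0.
Qed.

Let approximable0 : approximable (fun _ : X => 0 : X).
Proof.
apply/approxP; split; first exact: finite_rank0.1.
move=> e e0; exists (fun=> 0); split=> // x.
by rewrite subrr normr0 mulr_ge0// ltW.
Qed.

Let approximableD (c : K) S T : approximable S -> approximable T ->
  approximable (fun x => c *: S x + T x).
Proof.
move=> /approxP[Sb SP] /approxP[Tb TP]; apply/approxP.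
split=> [|e e0]; first exact: boundedD.
have c1 : 0 < `|c| + 1 by rewrite ltr_wpDl.
have e2 : 0 < e / 2 by rewrite divr_gt0.
have [S' [S'f SS']] := SP (e / 2 / (`|c| + 1)) (divr_gt0 e2 c1).
have [T' [T'f TT']] := TP _ e2.
exists (fun x => c *: S' x + T' x); split; first exact: finite_rankD.
move=> x; rewrite opprD addrACA -scalerBr (le_trans (ler_normD _ _))//.
rewrite [e in leRHS](splitr e) mulrDl lerD// normrZ.
rewrite (le_trans (ler_wpM2l _ (SS' x)))// mulrA ler_wpM2r//.
by rewrite mulrA ler_pdivrMr// mulrC ler_pM2l// lerDl.
Qed.

Let approximableM S T : approximable S -> approximable T ->
  approximable (S \o T).
Proof.
move=> /approxP[[Sl Sc] _] /approxP[[Tl Tc] TP]; apply/approxP.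
have [a a0 aP] := (bounded_operatorP Sl).1 Sc.
have linc T' : linear T' -> linear (S \o T').
  by move=> T'l c x y /=; rewrite T'l Sl.
split=> [|e e0].
  split; first exact: linc.
  by move=> x; apply: continuous_comp; [exact: Tc|exact: Sc].
have [T' [[[T'l T'c] [n [f fP]]] TT']] := TP (e / a) (divr_gt0 e0 a0).
pose g : {linear X -> X} := HB.pack S (GRing.isLinear.Build K X X *:%R S Sl).
exists (S \o T'); split; last first.
  move=> x /=; rewrite -[S]/(g : X -> X) -linearB (le_trans (aP _))//.
  by rewrite mulrC -ler_pdivlMr// mulrAC.
split.
  split; first exact: linc.
  by move=> x; apply: continuous_comp; [exact: T'c|exact: Sc].
exists n, (S \o f) => _ [x _ <-] /=.
have [|c ->] := fP (T' x); first by exists x.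
exists c; rewrite -[S]/(g : X -> X) linear_sum; apply: eq_bigr => i _.
by rewrite linearZ.
Qed.

(* The carrier of the algebra of approximable operators, that is the norm
   closure, in the bounded operators on [X], of the finite rank ones. *)
Record approx_op := ApproxOp {
  approx_fun :> X -> X;
  approx_funP : approximable approx_fun }.

Lemma approx_op_eq (S T : approx_op) : S =1 T -> S = T.
Proof.
case: S T => [S Sa] [T Ta] /= /funext ST.
by case: T / ST Ta => Ta; congr ApproxOp; exact: Prop_irrelevance.
Qed.

HB.instance Definition _ := gen_eqMixin approx_op.
HB.instance Definition _ := gen_choiceMixin approx_op.

Let approximable_add S T : approximable S -> approximable T ->
  approximable (fun x => S x + T x).
Proof.
move=> Sa Ta; have := approximableD 1 Sa Ta; congr approximable.
by apply/funext => x; rewrite scale1r.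
Qed.

Let approximable_scale (c : K) S : approximable S ->
  approximable (fun x => c *: S x).
Proof.
move=> Sa; have := approximableD c Sa approximable0; congr approximable.
by apply/funext => x; rewrite addr0.
Qed.

Definition approx_zero := ApproxOp approximable0.
Definition approx_add (S T : approx_op) :=
  ApproxOp (approximable_add (approx_funP S) (approx_funP T)).
Definition approx_scale (c : K) (S : approx_op) :=
  ApproxOp (approximable_scale c (approx_funP S)).
Definition approx_mul (S T : approx_op) :=
  ApproxOp (approximableM (approx_funP S) (approx_funP T)).

Let approx_addA : associative approx_add.
Proof. by move=> S T U; apply: approx_op_eq => x /=; rewrite addrA. Qed.

Let approx_addC : commutative approx_add.
Proof. by move=> S T; apply: approx_op_eq => x /=; rewrite addrC. Qed.

Let approx_add0 : left_id approx_zero approx_add.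
Proof. by move=> S; apply: approx_op_eq => x /=; rewrite add0r. Qed.

Let approx_addN : left_inverse approx_zero (approx_scale (-1)) approx_add.
Proof.
by move=> S; apply: approx_op_eq => x /=; rewrite scaleN1r addNr.
Qed.

HB.instance Definition _ := GRing.isZmodule.Build approx_op
  approx_addA approx_addC approx_add0 approx_addN.

Let approx_scaleA (a b : K) (S : approx_op) :
  approx_scale a (approx_scale b S) = approx_scale (a * b) S.
Proof. by apply: approx_op_eq => x /=; rewrite scalerA. Qed.

Let approx_scale1 : left_id 1 approx_scale.
Proof. by move=> S; apply: approx_op_eq => x /=; rewrite scale1r. Qed.

Let approx_scaleDr : right_distributive approx_scale +%R.
Proof. by move=> c S T; apply: approx_op_eq => x /=; rewrite scalerDr. Qed.

Let approx_scaleDl (S : approx_op) : {morph approx_scale^~ S : a b / a + b}.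
Proof. by move=> a b; apply: approx_op_eq => x /=; rewrite scalerDl. Qed.

HB.instance Definition _ := GRing.Zmodule_isLmodule.Build K approx_op
  approx_scaleA approx_scale1 approx_scaleDr approx_scaleDl.

Let approx_mulA : associative approx_mul.
Proof. by move=> S T U; apply: approx_op_eq. Qed.

Let approx_mul_linearl (T : approx_op) : linear (approx_mul^~ T).
Proof. by move=> c S U; apply: approx_op_eq. Qed.

Let approx_mul_linearr (S : approx_op) : linear (approx_mul S).
Proof.
move=> c T U; apply: approx_op_eq => x /=.
by have [[Sl _] _] := approx_funP S; rewrite Sl.
Qed.

Definition approx_algebra : algebra K :=
  Algebra approx_mulA approx_mul_linearl approx_mul_linearr.

End ApproximableAlgebra.

(* Main.v *)
Require Import Defs.
From HB Require Import structures.
From mathcomp Require Import all_boot all_order all_algebra.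
From mathcomp Require Import complex ring.
From mathcomp Require Import all_classical all_reals all_analysis.

(** Write [C1] for the l1-sum of the [G i], [X] for the sum of [E] and [C1], and
    [A] for the algebra of approximable operators on [X].

    Factorization. Let the operator [T], with values in a Banach space, be the
    norm limit of the finite rank operators [S n]. Along a fast subsequence, the
    differences of consecutive [S n] form an absolutely convergent series of
    finite rank operators. The range of each term is within distortion 2 of some
    [G i], and the indices [i] may be taken distinct, since every [G i] is
    repeated infinitely often. Putting one half of the size of each term on
    either side of its summand, one obtains [T = U V] with [V] into [C1], [U] out
    of [C1], both approximable, where [V] vanishes wherever all the [S n] do:
    [factor_through_l1].

    From the approximation property to universal flatness. Any two elements of
    [A] have a common left factor, by factoring the map from [(x, y)] to
    [a x + b y]. If moreover [E], hence [X], has the approximation property and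
    [z y = 0] in [A], then [z = z' w] with [w y = 0]: indeed [z] is the limit of
    operators [Q n z] with [Q n] of finite rank, and these kill all that [z]
    kills. When [A] is a right ideal of [B], these two facts describe the tensor
    product of [A] with a left [B]-module completely: a formal sum represents
    zero if and only if it can be written as the sum of the tensors of [z c_i]
    and [m_i], with the sum of the [c_i m_i] equal to zero in the module
    ([ideal_tensor_criterion]). Injective maps of modules reflect this
    condition, so [A] is universally flat. The right exactness of the tensor
    product is general, and universal flatness implies flatness because [A] is a
    right ideal of itself.

    From flatness to the approximation property. If [A] is right flat and
    [c y = 0], then [c] is a sum of products [c_j d_j] with [c_j] in [A], [d_j]
    in its unitization and [d_j y = 0] ([right_flat_factor]). Hence [c] is a norm
    limit of finite rank operators that vanish on the range of [y]
    ([flat_annihilator]). Given a compact subset of [E], let [H n] be an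
    increasing sequence of finite-dimensional subspaces that contain nets of it
    for the radii [4^-n], and place copies of the [H n] in distinct summands of
    [C1]. The operator [C] is the sum of the embeddings of these copies into [E]
    with the weights [2^-n], and the range of [Y] consists of the obvious
    elements of the kernel of [C], those that identify [H n] with a subspace of
    the copy of [H n.+1] ([ladder_operators]). A finite rank operator [F] close
    to [C] and zero on the range of [Y] thus induces compatible maps on the
    [H n], of norm at most a multiple of [2^n], and the Hahn-Banach theorem
    extends the one on [H m] to a finite rank operator of the same size on [E]
    ([ladder_map_extends]). For large [m] the latter is close to the identity on
    the compact set ([flat_AP]). *)

Set Implicit Arguments.
Unset Strict Implicit.
Unset Printing Implicit Defensive.

Import Order.TTheory GRing.Theory Num.Theory.
Import numFieldNormedType.Exports.

Local Open Scope classical_set_scope.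
Local Open Scope ring_scope.

(** * Linear maps given as plain functions *)

Section LinearMaps.
Variables (K : fieldType) (V W : lmodType K) (f : V -> W).
Hypothesis fl : linear f.

Let g : {linear V -> W} := HB.pack f (GRing.isLinear.Build K V W *:%R f fl).

Lemma lin0 : f 0 = 0.
Proof. exact: (linear0 g). Qed.

Lemma linN : {morph f : x / - x}.
Proof. exact: (linearN g). Qed.

Lemma linD : {morph f : x y / x + y}.
Proof. exact: (linearD g). Qed.

Lemma linB : {morph f : x y / x - y}.
Proof. exact: (linearB g). Qed.

Lemma linZ c : {morph f : x / c *: x}.
Proof. exact: (linearZ_LR g). Qed.

Lemma lin_sum I (r : seq I) (P : pred I) (F : I -> V) :
  f (\sum_(i <- r | P i) F i) = \sum_(i <- r | P i) f (F i).
Proof. exact: (linear_sum g). Qed.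

End LinearMaps.

(** * Completeness along geometrically convergent sequences *)

Section Scalars.
Context {R : realType} {k : scalar_kind}.
Local Notation K := (scalars R k).

Lemma half_exp_gt0 n : 0 < (2^-1 : K) ^+ n.
Proof. by rewrite exprn_gt0// invr_gt0 ltr0n. Qed.

Lemma half_exp_ge0 n : 0 <= (2^-1 : K) ^+ n.
Proof. exact/ltW/half_exp_gt0. Qed.

Lemma half_exp_le1 n : (2^-1 : K) ^+ n <= 1.
Proof. by rewrite exprVn invf_le1 ?exprn_gt0 ?ltr0n// exprn_ege1// ler1n. Qed.

Lemma half_exp_le m n : (m <= n)%N -> (2^-1 : K) ^+ n <= 2^-1 ^+ m.
Proof.
by move=> /subnKC <-; rewrite exprD ler_piMr ?half_exp_ge0 ?half_exp_le1.
Qed.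

Lemma half_exp_small (e : K) : 0 < e -> exists n, (2^-1 : K) ^+ n < e.
Proof.
have real_case (d : R) : 0 < d -> exists n, (2^-1 : R) ^+ n < d.
  move=> d0; near \oo => n; exists n.
  have : 1 / 2 ^+ n < (PosNum d0)%:num.
    by near: n; exact: near_infty_natSinv_expn_lt.
  by rewrite div1r exprVn.
case: k e => /= e; first exact: real_case.
case: e => a b; rewrite ltcE /= => /andP[/eqP -> a0].
have [n na] := real_case _ a0; exists n.
have -> : (2^-1 : R[i]) ^+ n = ((2^-1 : R) ^+ n)%:C%C.
  by rewrite rmorphXn /= fmorphV /= rmorph_nat.
by rewrite ltcR.
Unshelve. all: by end_near. Qed.

(** Over the complex numbers the order is partial, which is why [x] and [y] are
    required to be real. *)
Lemma ler_half_exp (x y C : K) : x \is Num.real -> y \is Num.real -> 0 <= C ->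
  (forall n, x <= y + C * 2^-1 ^+ n) -> x <= y.
Proof.
move=> xr yr C0 h; rewrite real_leNgt//; apply/negP => yx.
have C1 : 0 < C + 1 by rewrite ltr_wpDl.
have [n] := @half_exp_small ((x - y) / (C + 1))
  (divr_gt0 (etrans (subr_gt0 _ _) yx) C1).
rewrite ltr_pdivlMr// => hn.
have := h n; rewrite -lerBlDl => /le_lt_trans h'.
suff /h' : C * 2^-1 ^+ n < x - y by rewrite ltxx.
apply: le_lt_trans hn; rewrite mulrC ler_wpM2l ?half_exp_ge0//.
by rewrite lerDl.
Qed.

Lemma half_expS n : (2^-1 : K) ^+ n.+1 + 2^-1 ^+ n.+1 = 2^-1 ^+ n.
Proof.
rewrite exprS -mulrDl; suff -> : 2^-1 + 2^-1 = 1 :> K by rewrite mul1r.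
by rewrite [RHS]splitr !div1r.
Qed.

Lemma ltr_mul_half_exp (C e : K) : 0 <= C -> 0 < e ->
  exists n, C * 2^-1 ^+ n < e.
Proof.
move=> C0 e0; have C1 : 0 < C + 1 by rewrite ltr_wpDl.
have [n] := @half_exp_small (e / (C + 1)) (divr_gt0 e0 C1).
rewrite ltr_pdivlMr// mulrC => hn; exists n; apply: le_lt_trans hn.
by rewrite ler_wpM2r ?half_exp_ge0// lerDl.
Qed.

End Scalars.

Section FastCauchy.
Context {R : realType} {k : scalar_kind}.
Local Notation K := (scalars R k).

(** Convergence is handled through sequences with explicit geometric error
    bounds: every limit of the proof is of this kind, and this form passes to
    l1-sums and to finite-dimensional subspaces by plain estimates. *)
Definition fast_cauchy (V : normedModType K) (C : K) (u : nat -> V) :=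
  forall n, `|u n.+1 - u n| <= C * 2^-1 ^+ n.+1.

Definition fast_complete (V : normedModType K) := forall (C : K) (u : nat -> V),
  0 <= C -> fast_cauchy C u -> exists l, forall n, `|l - u n| <= C * 2^-1 ^+ n.

Lemma fast_cauchy_dist (V : normedModType K) (C : K) (u : nat -> V) :
  0 <= C -> fast_cauchy C u ->
  forall n m, `|u (n + m)%N - u n| <= C * 2^-1 ^+ n.
Proof.
move=> C0 uC n m.
suff : `|u (n + m)%N - u n| <= C * 2^-1 ^+ n - C * 2^-1 ^+ (n + m).
  by move=> /le_trans; apply; rewrite gerBl mulr_ge0 ?half_exp_ge0.
elim: m => [|m IH]; first by rewrite addn0 !subrr normr0.
rewrite addnS -(subrKA (u (n + m)%N)) (le_trans (ler_normD _ _))//.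
rewrite (le_trans (lerD (uC _) IH))// -(half_expS (n + m)) addrC mulrDr.
by rewrite opprD addrA subrK.
Qed.

Lemma fast_limit_unique (V : normedModType K) (C D : K) (u : nat -> V) (l m : V) :
  0 <= C -> 0 <= D ->
  (forall n, `|l - u n| <= C * 2^-1 ^+ n) ->
  (forall n, `|m - u n| <= D * 2^-1 ^+ n) -> l = m.
Proof.
move=> C0 D0 lC mD; apply/eqP; rewrite -subr_eq0 -normr_le0.
apply: (@ler_half_exp _ _ _ _ (C + D)) => [|||n] //; first exact: addr_ge0.
rewrite add0r mulrDl -(subrKA (u n)) (le_trans (ler_normD _ _))//.
by rewrite lerD// distrC.
Qed.

(** The rate of convergence improves to the one dictated by the increments,
    whatever rate was known before. *)
Lemma fast_limit_bound (V : normedModType K) (C D : K) (u : nat -> V) (l : V) :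
  0 <= C -> 0 <= D -> fast_cauchy C u ->
  (forall n, `|l - u n| <= D * 2^-1 ^+ n) ->
  forall n, `|l - u n| <= C * 2^-1 ^+ n.
Proof.
move=> C0 D0 uC lD n.
apply: (@ler_half_exp _ _ _ _ D) => // [|m].
  by rewrite rpredM ?ger0_real ?half_exp_ge0.
rewrite [leRHS]addrC -(subrKA (u (n + m)%N)) (le_trans (ler_normD _ _))//.
rewrite lerD ?fast_cauchy_dist// (le_trans (lD _))// ler_wpM2l//.
by rewrite half_exp_le// leq_addl.
Qed.

Lemma complete_fast (V : completeNormedModType K) : fast_complete V.
Proof.
move=> C u C0 uC; have ud := fast_cauchy_dist C0 uC.
have : cvg (u @ \oo).
  apply: cauchy_cvg; apply/cauchyP => e e0.
  have [n hn] := ltr_mul_half_exp C0 e0.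
  exists (u n); rewrite -ball_normE; exists n => //= m /= nm.
  by rewrite distrC -(subnKC nm) (le_lt_trans (ud _ _)).
move=> /cvg_ex[l ul]; exists l => n.
apply: (@ler_half_exp _ _ _ _ 1) => // [|m].
  by rewrite rpredM ?ger0_real ?half_exp_ge0.
have [N _ hN] := (cvgrPdist_lt _ _).1 ul _ (half_exp_gt0 m).
rewrite mul1r [leRHS]addrC -(subrKA (u (n + N)%N)) (le_trans (ler_normD _ _))//.
by rewrite lerD// ltW// hN//= leq_addl.
Qed.

(** A Cauchy filter is followed along points whose balls of radius [2^-n]
    belong to it; these points form a fast Cauchy sequence. *)
Lemma fast_complete_cauchy (V : normedModType K) : fast_complete V ->
  forall F : set_system V, ProperFilter F -> cauchy F -> cvg F.
Proof.
move=> Vc F FF /cauchyP Fc.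
have Fx n := Fc _ (half_exp_gt0 (k := k) (R := R) n.+2).
pose u n := projT1 (cid (Fx n)).
have uF n : F (ball (u n) (2^-1 ^+ n.+2)) by rewrite /u; case: cid.
have [|l ul] := Vc 1 u ler01.
  move=> n; rewrite mul1r.
  have /filter_ex[x [/= + +]] := @filterI _ F FF _ _ (uF n.+1) (uF n).
  rewrite -!ball_normE /ball_/= => x1 x2; rewrite -(subrKA x).
  rewrite (le_trans (ler_normD _ _))// -[leRHS](half_expS n.+1).
  rewrite lerD//; last by rewrite distrC ltW.
  by rewrite ltW// (lt_le_trans x1)// half_exp_le.
apply/cvg_ex; exists l; apply/cvgrPdist_le => e e0.
have [n hn] := ltr_mul_half_exp (ler0n K 2) e0.
apply: filterS (uF n) => x; rewrite -ball_normE /ball_/= => xn.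
rewrite -(subrKA (u n)) (le_trans (ler_normD _ _))// (le_trans _ (ltW hn))//.
rewrite mulr_natl mulr2n lerD//; first by rewrite (le_trans (ul n))// mul1r.
by rewrite (le_trans (ltW xn))// half_exp_le// ltnW// ltnW.
Qed.

Lemma prod_norm_le (V W : normedModType K) (x : V * W) (M : K) :
  (`|x| <= M) = (`|x.1| <= M) && (`|x.2| <= M).
Proof.
by rewrite prod_normE comparable_ge_max ?real_comparable.
Qed.

Lemma fast_complete_prod (V W : normedModType K) :
  fast_complete V -> fast_complete W -> fast_complete (V * W)%type.
Proof.
move=> Vc Wc C u C0 uC.
have [|l lC] := Vc C (fun n => (u n).1) C0.
  by move=> n; have := uC n; rewrite prod_norm_le => /andP[].
have [|m mC] := Wc C (fun n => (u n).2) C0.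
  by move=> n; have := uC n; rewrite prod_norm_le => /andP[].
by exists (l, m) => n; rewrite prod_norm_le lC mC.
Qed.

End FastCauchy.

(** * Real and complex scalars *)

Section ComplexNorm.
Variable R : realType.
Implicit Types z w : R[i].

Lemma normc_geRe z : `|complex.Re z|%:C%C <= `|z|.
Proof.
by rewrite normc_def lecR -sqrtr_sqr ler_wsqrtr// lerDl sqr_ge0.
Qed.

Lemma normc_geIm z : `|complex.Im z|%:C%C <= `|z|.
Proof.
by rewrite normc_def lecR -sqrtr_sqr ler_wsqrtr// lerDr sqr_ge0.
Qed.

Lemma normc_real (a : R) : `|a%:C%C| = `|a|%:C%C.
Proof. by rewrite normc_def/= expr0n addr0 sqrtr_sqr. Qed.

Lemma normc_leReIm z : `|z| <= (`|complex.Re z| + `|complex.Im z|)%:C%C.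
Proof.
rewrite {1}(complexE z) (le_trans (ler_normD _ _))// normrM !normc_real.
have -> : `|'i%C : R[i]| = 1 by rewrite normc_def/= expr0n expr1n add0r sqrtr1.
by rewrite mul1r rmorphD.
Qed.

Lemma ReB z w : complex.Re (z - w) = complex.Re z - complex.Re w.
Proof. by case: z w => a b []. Qed.

Lemma ImB z w : complex.Im (z - w) = complex.Im z - complex.Im w.
Proof. by case: z w => a b []. Qed.

End ComplexNorm.

Section ScalarTopology.
Context {R : realType} {k : scalar_kind}.
Local Notation K := (scalars R k).

Lemma scalars_fast_complete : fast_complete K^o.
Proof.
case: k; first exact: (@complete_fast R RealScalars R).
move=> C u C0 uC.
case: C C0 uC => c d; rewrite lecE/= => /andP[/eqP -> c0] uC.
have half n : (2^-1 : R[i]) ^+ n = ((2^-1 : R) ^+ n)%:C%C.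
  by rewrite rmorphXn /= fmorphV /= rmorph_nat.
have mono n : (c +i* 0)%C * (2^-1 : R[i]) ^+ n = (c * 2^-1 ^+ n)%:C%C.
  by rewrite half -[(c +i* 0)%C]/(c%:C%C) -rmorphM.
have [|a aC] := @complete_fast R RealScalars R c (fun n => complex.Re (u n)) c0.
  move=> n; have := le_trans (normc_geRe _) (uC n).
  by rewrite /scalars mono lecR ReB.
have [|b bC] := @complete_fast R RealScalars R c (fun n => complex.Im (u n)) c0.
  move=> n; have := le_trans (normc_geIm _) (uC n).
  by rewrite /scalars mono lecR ImB.
exists (a +i* b)%C => n.
move: n; apply: (@fast_limit_bound R ComplexScalars R[i]^o _ (c *+ 2)%:C%C) => //.
- by rewrite lecE/= eqxx.
- by rewrite lecR mulrn_wge0.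
- move=> n; apply: (le_trans (normc_leReIm _)).
  rewrite half -rmorphM lecR ReB ImB/= mulrnAl mulr2n.
  exact: (lerD (aC n) (bC n)).
Qed.

Lemma real_disc_net (C e : R) : 0 <= C -> 0 < e ->
  exists s : seq R, forall x, `|x| <= C -> exists2 y, y \in s & `|x - y| <= e.
Proof.
move=> C0 e0; pose N := (Num.truncn ((C + C) / e)).+1.
exists [seq e * i%:R - C | i <- iota 0 N] => x; rewrite ler_norml => /andP[Cx xC].
have x0 : 0 <= (x + C) / e by rewrite divr_ge0 ?(ltW e0)// -lerBlDr sub0r.
have /andP[nx xn] := truncn_itv x0; set n := Num.truncn _ in nx xn.
exists (e * n%:R - C).
  apply/mapP; exists n => //; rewrite mem_iota add0n /N ltnS le_truncn//.
  by rewrite ler_pM2r ?invr_gt0// lerD2r.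
rewrite opprB addrCA addrA [C + x]addrC.
move: nx xn; rewrite ler_pdivlMr// ltr_pdivrMr// mulrC => nx xn.
rewrite ger0_norm ?subr_ge0// lerBlDr (le_trans (ltW xn))//.
by rewrite -natr1 mulrDl mul1r addrC mulrC.
Qed.

Lemma scalar_disc_net (C e : K) : 0 <= C -> 0 < e ->
  exists s : seq K, forall x, `|x| <= C -> exists2 y, y \in s & `|x - y| <= e.
Proof.
case: k C e; first exact: real_disc_net.
move=> [C d] [e f]; rewrite lecE ltcE/= => /andP[/eqP -> C0] /andP[/eqP -> e0].
have [s sP] := real_disc_net C0 (divr_gt0 e0 (ltr0n R 2)).
exists [seq (a +i* b)%C | a <- s, b <- s] => z zC.
have [|a as_ az] := sP (complex.Re z).
  by have := le_trans (normc_geRe z) zC; rewrite lecR.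
have [|b bs bz] := sP (complex.Im z).
  by have := le_trans (normc_geIm z) zC; rewrite lecR.
exists (a +i* b)%C; first by apply/allpairsP; exists (a, b).
apply: le_trans (normc_leReIm _) _; rewrite ReB ImB lecR/=.
by rewrite [leRHS]splitr lerD.
Qed.

End ScalarTopology.

(** * Finite-dimensional subspaces *)

Section FiniteDimension.
Context {R : realType} {k : scalar_kind}.
Local Notation K := (scalars R k).
Variable V : normedModType K.

Definition totally_bounded (A : set V) := forall e : K, 0 < e ->
  exists s : seq V, forall x, A x -> exists2 y, y \in s & `|x - y| <= e.

(** Families are indexed by [nat] and cut at [n], so that they are extended by
    one vector without casts between ordinals. *)
Definition comb n (b : nat -> V) (c : nat -> K) : V :=
  \sum_(i < n) c i *: b i.

Definition lin_free n (b : nat -> V) := forall c : nat -> K,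
  comb n b c = 0 -> forall i, (i < n)%N -> c i = 0.

Lemma combS n b c : comb n.+1 b c = comb n b c + c n *: b n.
Proof. by rewrite /comb big_ord_recr. Qed.

Lemma combD n b c d : comb n b (fun i => c i + d i) = comb n b c + comb n b d.
Proof. by rewrite /comb -big_split; apply: eq_bigr => i _; exact: scalerDl. Qed.

Lemma combZ n b (a : K) c : comb n b (fun i => a * c i) = a *: comb n b c.
Proof. by rewrite /comb scaler_sumr; apply: eq_bigr => i _; rewrite scalerA. Qed.

Lemma combB n b c d : comb n b (fun i => c i - d i) = comb n b c - comb n b d.
Proof.
rewrite /comb -sumrB; apply: eq_bigr => i _; exact: scalerBl.
Qed.

Lemma eq_comb n b b' c c' : (forall i, (i < n)%N -> b i = b' i) ->
  (forall i, (i < n)%N -> c i = c' i) -> comb n b c = comb n b' c'.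
Proof. by move=> bb cc; apply: eq_bigr => i _; rewrite bb ?cc. Qed.

Lemma norm_comb_le n b c (C : K) : (forall i, (i < n)%N -> `|c i| <= C) ->
  `|comb n b c| <= C * \sum_(i < n) `|b i|.
Proof.
move=> cC; rewrite (le_trans (ler_norm_sum _ _ _))// mulr_sumr ler_sum// => i _.
by rewrite normrZ ler_wpM2r// cC.
Qed.

(** All norms of a finite-dimensional space are equivalent. By induction, the
    coordinates of a convergent sequence of combinations of the first [n]
    vectors converge, so the last vector is at a distance [d > 0] from their
    span; this bounds its coordinate, hence the other ones. *)
Lemma lin_free_bound n b : lin_free n b -> exists2 C : K, 0 <= C &
  forall c i, (i < n)%N -> `|c i| <= C * `|comb n b c|.
Proof.
elim: n => [|n IH] bf; first by exists 0.
have [|C C0 CP] := IH.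
  move=> c c0 i ni.
  have := bf (fun j => if (j < n)%N then c j else 0).
  rewrite combS ltnn scale0r addr0.
  rewrite (@eq_comb _ _ b _ c)// => [/(_ c0 i)|j ->//].
  by rewrite ni; apply; exact: leqW.
have [d d0 dP] : exists2 d : K, 0 < d &
    forall c, d <= `|comb n b c - b n|.
  apply: contrapT => nd.
  have cP m : exists c, `|comb n b c - b n| < 2^-1 ^+ m.+2.
    apply: contrapT => /forallNP h; apply: nd.
    exists (2^-1 ^+ m.+2); first exact: half_exp_gt0.
    by move=> c; rewrite real_leNgt ?ger0_real ?half_exp_ge0//; apply/negP.
  pose c m := projT1 (cid (cP m)).
  have cb m : `|comb n b (c m) - b n| < 2^-1 ^+ m.+2.
    by rewrite /c; case: cid.
  have cfast i : (i < n)%N -> @fast_cauchy R k K^o C (fun m => c m i).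
    move=> ni m; apply: le_trans (CP (fun i => c m.+1 i - c m i) i ni) _.
    rewrite ler_wpM2l// combB -(subrKA (b n)) (le_trans (ler_normD _ _))//.
    rewrite -[leRHS]half_expS lerD//.
      by rewrite (le_trans (ltW (cb _)))// half_exp_le.
    by rewrite distrC (le_trans (ltW (cb _))).
  have l_ex i : exists l, (i < n)%N ->
      forall m, `|(l : K) - c m i| <= C * 2^-1 ^+ m.
    case: (ltnP i n) => [ni|_]; last by exists 0.
    by have [l lP] := @scalars_fast_complete R k _ _ C0 (cfast i ni); exists l.
  pose l i := projT1 (cid (l_ex i)).
  have lP i : (i < n)%N -> forall m, `|l i - c m i| <= C * 2^-1 ^+ m.
    by rewrite /l; case: cid.
  have : comb n b l - b n = 0.
    apply/eqP; rewrite -normr_le0; pose B := \sum_(i < n) `|b i|.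
    apply: (@ler_half_exp _ _ _ _ (C * B + 1)) => // [|m].
      by rewrite addr_ge0// mulr_ge0// sumr_ge0.
    rewrite add0r -(subrKA (comb n b (c m))) (le_trans (ler_normD _ _))//.
    rewrite mulrDl lerD//.
      rewrite -combB mulrAC; apply: norm_comb_le => i ni; exact: lP.
    by rewrite mul1r (le_trans (ltW (cb m)))// half_exp_le// ltnW// ltnW.
  move=> ln; have := bf (fun j => if (j < n)%N then l j else -1).
  rewrite combS ltnn scaleN1r (@eq_comb _ _ b _ l) => [|//|j ->//].
  by move=> /(_ ln n (leqnn _))/eqP; rewrite ltnn oppr_eq0 oner_eq0.
have cn c : `|c n| <= d^-1 * `|comb n.+1 b c|.
  have [->|c0] := eqVneq (c n) 0.
    by rewrite normr0 mulr_ge0// invr_ge0 ltW.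
  rewrite mulrC ler_pdivlMr//.
  have /(ler_wpM2l (normr_ge0 (c n))) := dP (fun i => - (c n)^-1 * c i).
  move=> /le_trans; apply; rewrite -normrZ combZ combS -normrN scalerBr scalerA.
  by rewrite mulrN divff// scaleN1r opprB opprK addrC.
exists (C * (1 + d^-1 * `|b n|) + d^-1) => [|c i].
  by rewrite addr_ge0 ?mulr_ge0 ?addr_ge0 ?mulr_ge0 ?invr_ge0// ltW.
rewrite ltnS leq_eqVlt => /predU1P[->|ni].
  rewrite (le_trans (cn c))// ler_wpM2r// lerDr mulr_ge0// addr_ge0//.
  by rewrite mulr_ge0// invr_ge0 ltW.
rewrite (le_trans (CP c i ni))// mulrDl -[leLHS]addr0 lerD//; last first.
  by rewrite mulr_ge0// invr_ge0 ltW.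
rewrite -mulrA ler_wpM2l// mulrDl mul1r.
have -> : comb n b c = comb n.+1 b c - c n *: b n by rewrite combS addrK.
by rewrite (le_trans (ler_normB _ _))// lerD// normrZ mulrAC ler_wpM2r.
Qed.

End FiniteDimension.

(** Bundling the closure properties gives the subtype of the elements of a
    subspace its canonical structures. *)
Record lsubspace (K : fieldType) (V : lmodType K) := Subspace {
  lsub_set :> V -> Prop;
  lsub_0 : lsub_set 0;
  lsub_linear : forall (c : K) x y, lsub_set x -> lsub_set y -> lsub_set (c *: x + y) }.

Definition sub_pred (K : fieldType) (V : lmodType K) (S : lsubspace V) : {pred V} :=
  fun x => `[< S x >].

Fact sub_pred_submod (K : fieldType) (V : lmodType K) (S : lsubspace V) :
  submod_closed (sub_pred S).
Proof.
split; first exact/asboolP/lsub_0.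
move=> c x y /asboolP Sx /asboolP Sy; exact/asboolP/lsub_linear.
Qed.

HB.instance Definition _ (K : fieldType) (V : lmodType K) (S : lsubspace V) :=
  GRing.isSubmodClosed.Build K V (sub_pred S) (sub_pred_submod S).

Definition lsub_type (K : fieldType) (V : lmodType K) (S : lsubspace V) :=
  {x : V | x \in sub_pred S}.

HB.instance Definition _ (K : fieldType) (V : lmodType K) (S : lsubspace V) :=
  SubChoice.on (lsub_type S).
HB.instance Definition _ (K : fieldType) (V : lmodType K) (S : lsubspace V) :=
  [SubChoice_isSubLmodule of lsub_type S by <:].

(** A second name for the carrier, on which the norm is installed. *)
Definition nlsub_type (K : numFieldType) (V : normedModType K) (S : lsubspace V) := lsub_type S.
HB.instance Definition _ (K : numFieldType) (V : normedModType K) (S : lsubspace V) :=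
  GRing.Lmodule.on (nlsub_type S).

Section NormedSub.
Variables (K : numFieldType) (V : normedModType K) (S : lsubspace V).

Let norm (x : nlsub_type S) : K := `|val x|.
Let normD x y : norm (x + y) <= norm x + norm y.
Proof. exact: ler_normD. Qed.
Let normZ (l : K) x : norm (l *: x) = `|l| * norm x.
Proof. exact: normrZ. Qed.
Let norm0 x : norm x = 0 -> x = 0.
Proof. by move=> /normr0_eq0 x0; apply: val_inj. Qed.

HB.instance Definition _ := Lmodule_isNormed.Build K (nlsub_type S) normD normZ norm0.
End NormedSub.

Section FiniteDimensionalSubspaces.
Context {R : realType} {k : scalar_kind}.
Local Notation K := (scalars R k).

(** [S] is only assumed to lie in the span of finitely many vectors [e i] of
    [V]. By induction on their number, the vectors of [S] that do not use the
    last one have a basis, and one more vector of [S] completes it if needed. *)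
Lemma fd_basis (V : normedModType K) (S : lsubspace V) :
  finite_dimensional (lsub_set S) ->
  exists n (b : nat -> V), lin_free n b /\ forall x, S x <-> exists c, x = comb n b c.
Proof.
move=> [n [e0 e0P]].
have [e eP] : exists e : nat -> V, forall x, S x -> exists c, x = comb n e c.
  exists (fun i => if insub i is Some j then e0 j else 0) => x /e0P[c ->].
  exists (fun i => if insub i is Some j then c j else 0).
  by apply: eq_bigr => i _; rewrite valK.
elim: n S eP {e0 e0P} => [|n IH] S eP.
  exists 0%N, (fun=> 0); split=> // x; split.
    by move=> /eP[c ->]; exists c; rewrite /comb !big_ord0.
  by move=> [c ->]; rewrite /comb big_ord0; exact: lsub_0.
pose S' x := S x /\ exists c, x = comb n e c.
have S'0 : S' 0.
  split; first exact: lsub_0.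
  by exists (fun=> 0); rewrite /comb big1// => i _; rewrite scale0r.
have S'P (c : K) x y : S' x -> S' y -> S' (c *: x + y).
  move=> [Sx [cx xE]] [Sy [cy yE]]; split; first exact: lsub_linear.
  by exists (fun i => c * cx i + cy i); rewrite combD combZ xE yE.
have [|m [b [bf bP]]] := IH (Subspace S'0 S'P); first by move=> x [_].
have {}bP x : S' x <-> exists c, x = comb m b c := bP x.
have [[v [c [Sv vc cn0]]]|nv] :=
    pselect (exists v c, [/\ S v, v = comb n.+1 e c & c n != 0]); last first.
  exists m, b; split=> // x; rewrite -bP; split=> [Sx|[]//]; split=> //.
  have [c xc] := eP x Sx; exists c; rewrite xc combS.
  suff /eqP -> : c n == 0 by rewrite scale0r addr0.
  by apply: contrapT => /negP cn; apply: nv; exists x, c.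
have [S'v|S'v] := pselect (S' v).
  exists m, b; split=> // x; rewrite -bP; split=> [Sx|[]//].
  have [d xd] := eP x Sx.
  have -> : x = (d n / c n) *: v + (x - (d n / c n) *: v) by rewrite addrC subrK.
  apply: S'P => //; split.
    by rewrite addrC -scaleNr; apply: lsub_linear.
  exists (fun i => d i - d n / c n * c i).
  by rewrite combB combZ xd vc !combS scalerDr scalerA divfK// opprD addrACA subrr addr0.
pose b' i := if (i < m)%N then b i else v.
have b'E d : comb m b' d = comb m b d by apply: eq_comb => // i im; rewrite /b' im.
exists m.+1, b'; split.
  move=> d; rewrite combS b'E {1}/b' ltnn => d0.
  have [dm|dm] := eqVneq (d m) 0.
    move=> i; rewrite ltnS leq_eqVlt => /predU1P[->//|im]; apply: bf im.
    by move: d0; rewrite dm scale0r addr0.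
  case: S'v; apply/bP; exists (fun i => - (d m)^-1 * d i).
  rewrite combZ; apply: (scalerI dm); rewrite scalerA mulrN divff// scaleN1r.
  by apply/eqP; rewrite -addr_eq0 addrC d0.
move=> x; split=> [Sx|[d ->]]; last first.
  rewrite combS {2}/b' ltnn addrC; apply: lsub_linear => //.
  by rewrite b'E; have /bP[] : exists d', comb m b d = comb m b d' by exists d.
have [d xd] := eP x Sx.
have /bP[f fP] : S' (x - (d n / c n) *: v).
  split; first by rewrite addrC -scaleNr; apply: lsub_linear.
  exists (fun i => d i - d n / c n * c i).
  by rewrite combB combZ xd vc !combS scalerDr scalerA divfK// opprD addrACA subrr addr0.
exists (fun i => if (i < m)%N then f i else d n / c n).
rewrite combS b'E {1}/b' ltnn (@eq_comb _ _ _ _ b b _ f)//.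
  by rewrite -fP subrK.
by move=> i ->.
Qed.

Lemma fd_fast_complete (V : normedModType K) (S : lsubspace V) :
  finite_dimensional (lsub_set S) -> fast_complete (nlsub_type S).
Proof.
move=> /fd_basis[n [b [bf bP]]] C u C0 uC.
have [D D0 DP] := lin_free_bound bf.
have cP m : exists c, val (u m) = comb n b c by apply/bP/asboolP; case: (u m) => x /= Sx; exact: Sx.
pose c m := projT1 (cid (cP m)).
have uc m : val (u m) = comb n b (c m) by rewrite /c; case: cid.
have cfast i : (i < n)%N -> @fast_cauchy R k K^o (D * C) (fun m => c m i).
  move=> ni m; apply: le_trans (DP (fun i => c m.+1 i - c m i) i ni) _.
  by rewrite -mulrA ler_wpM2l// combB -!uc; exact: uC.
have l_ex i : exists l, (i < n)%N ->
    forall m, `|(l : K) - c m i| <= D * C * 2^-1 ^+ m.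
  case: (ltnP i n) => [ni|_]; last by exists 0.
  have [l lP] := @scalars_fast_complete R k _ _ (mulr_ge0 D0 C0) (cfast i ni).
  by exists l.
pose l i := projT1 (cid (l_ex i)).
have lP i : (i < n)%N -> forall m, `|l i - c m i| <= D * C * 2^-1 ^+ m.
  by rewrite /l; case: cid.
have Sl : comb n b l \in sub_pred S by apply/asboolP/bP; exists l.
exists (Sub (comb n b l) Sl).
apply: (@fast_limit_bound _ _ _ _ (D * C * \sum_(i < n) `|b i|)) => //.
  by rewrite !mulr_ge0// sumr_ge0.
move=> m; rewrite [leLHS]/(`|comb n b l - val (u m)|) uc -combB mulrAC.
by apply: norm_comb_le => i ni; exact: lP.
Qed.

End FiniteDimensionalSubspaces.

(** * Bounded and finite rank operators *)

Section BoundedMaps.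
Context {R : realType} {k : scalar_kind}.
Local Notation K := (scalars R k).

Lemma bounded_operatorI (V W : normedModType K) (T : V -> W) (M : K) : linear T ->
  0 <= M -> (forall x, `|T x| <= M * `|x|) -> bounded_operator T.
Proof.
move=> Tl M0 TM; split=> //; apply/(bounded_operatorP Tl).
exists (M + 1) => [|x]; first by rewrite ltr_wpDl.
by rewrite (le_trans (TM x))// ler_wpM2r// lerDl.
Qed.

Lemma bounded_operatorE (V W : normedModType K) (T : V -> W) : bounded_operator T ->
  exists2 M : K, 0 <= M & forall x, `|T x| <= M * `|x|.
Proof. by move=> /opnorm_bound[]; exists (opnorm T). Qed.

Lemma range_sub0 (V W : lmodType K) (T : V -> W) : linear T -> range T 0.
Proof. by move=> Tl; exists 0 => //; exact: lin0. Qed.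

Lemma range_subP (V W : lmodType K) (T : V -> W) : linear T ->
  forall (c : K) x y, range T x -> range T y -> range T (c *: x + y).
Proof.
move=> Tl c _ _ [x _ <-] [y _ <-]; exists (c *: x + y) => //; exact: Tl.
Qed.

Definition range_lsubspace (V W : lmodType K) (T : V -> W) (Tl : linear T) :=
  Subspace (range_sub0 Tl) (range_subP Tl).

Lemma comb_delta (V : normedModType K) n (b : nat -> V) i : (i < n)%N ->
  comb n b (fun j => (j == i)%:R) = b i.
Proof.
move=> ni; rewrite /comb (bigD1 (Ordinal ni))//= eqxx scale1r big1 ?addr0//.
by move=> j /negbTE ji; rewrite -val_eqE/= in ji; rewrite ji scale0r.
Qed.

(** A finite rank operator is a sum of rank one operators: the coordinates in a
    basis of its range are bounded functionals. *)
Lemma finite_rank_functionals (V W : normedModType K) (T : W -> V) : finite_rank T ->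
  exists n (b : nat -> V) (phi : nat -> W -> K) (C : K),
    [/\ 0 <= C, forall i, linear (phi i : W -> K^o),
       forall i x, `|phi i x| <= C * `|x| &
       forall x, T x = comb n b (phi^~ x)] /\
       forall i, (i < n)%N -> range T (b i).
Proof.
move=> [Tb Tfd]; have [Tl _] := Tb; have [M M0 TM] := bounded_operatorE Tb.
have [n [b [bf bP]]] := @fd_basis _ _ _ (range_lsubspace Tl) Tfd.
have [C C0 CP] := lin_free_bound bf.
have cP x : exists c, T x = comb n b c by apply/bP; exists x.
pose phi i x := if (i < n)%N then projT1 (cid (cP x)) i else 0.
have phiE x : T x = comb n b (phi^~ x).
  rewrite {1}(projT2 (cid (cP x))); apply: eq_comb => // i ni.
  by rewrite /phi ni.
have uniq c d : comb n b c = comb n b d -> forall i, (i < n)%N -> c i = d i.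
  move=> cd i ni; apply/eqP; rewrite -subr_eq0; apply/eqP.
  by apply: (bf (fun i => c i - d i)) => //; rewrite combB cd subrr.
exists n, b, phi, (C * M); split; [split=> //|].
- exact: mulr_ge0.
- move=> i a x y; case: (ltnP i n) => [ni|]; last first.
    by rewrite /phi leqNgt => /negbTE ->; rewrite scaler0 addr0.
  apply: (uniq (phi^~ (a *: x + y)) (fun i => a * phi i x + phi i y)) => //.
  by rewrite combD combZ -!phiE Tl.
- move=> i x; case: (ltnP i n) => [ni|]; last first.
    by rewrite /phi leqNgt => /negbTE ->; rewrite normr0 !mulr_ge0.
  by rewrite (le_trans (CP (phi^~ x) i ni))// -phiE -mulrA ler_wpM2l.
- by move=> i ni; apply/bP; exists (fun j => (j == i)%:R); rewrite comb_delta.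
Qed.

Lemma comb_finite_rank (V W : normedModType K) n (b : nat -> V)
    (phi : nat -> W -> K) (C : K) : 0 <= C ->
  (forall i, linear (phi i : W -> K^o)) -> (forall i x, `|phi i x| <= C * `|x|) ->
  finite_rank (fun x => comb n b (phi^~ x)).
Proof.
move=> C0 pl pC; split.
  apply: (bounded_operatorI (M := C * \sum_(i < n) `|b i|)).
  - by move=> a x y; rewrite -combZ -combD; apply: eq_comb => // i _; exact: pl.
  - by rewrite mulr_ge0// sumr_ge0.
  - by move=> x; rewrite mulrAC; apply: norm_comb_le.
exists n, (fun i : 'I_n => b i) => _ [x _ <-].
by exists (fun i : 'I_n => phi i x).
Qed.

Lemma comb_ball_totally_bounded (V : normedModType K) n (b : nat -> V) (C : K) : 0 <= C ->
  totally_bounded [set comb n b c | c in [set c | forall i, (i < n)%N -> `|c i| <= C]].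
Proof.
move=> C0; elim: n => [|n IH] e e0.
  exists [:: 0] => _ [c _ <-]; exists 0; rewrite ?mem_seq1//.
  by rewrite /comb big_ord0 subrr normr0 ltW.
have e2 : 0 < e / 2 by rewrite divr_gt0.
have b1 : 0 < `|b n| + 1 by rewrite ltr_wpDl.
have [s sP] := IH _ e2.
have [t tP] := scalar_disc_net C0 (divr_gt0 e2 b1).
exists [seq y + d *: b n | y <- s, d <- t] => _ [c cC <-].
have [|y ys cy] := sP (comb n b c).
  by exists c => // i ni; apply: cC; exact: leqW.
have [d dt cd] := tP (c n) (cC n (ltnSn n)).
exists (y + d *: b n); first by apply/allpairsP; exists (y, d).
rewrite combS opprD addrACA -scalerBl (le_trans (ler_normD _ _))//.
rewrite [leRHS]splitr lerD// normrZ (le_trans (ler_wpM2r _ cd))//.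
by rewrite mulrAC ler_pdivrMr// ler_wpM2l ?(ltW e2)// lerDl.
Qed.

Lemma finite_rank_totally_bounded (V W : normedModType K) (T : W -> V) (r : K) :
  finite_rank T -> totally_bounded [set T x | x in [set x | `|x| <= r]].
Proof.
move=> /finite_rank_functionals[n [b [phi [C [[C0 _ pC TE] _]]]]] e e0.
have [/eqP r0|r0] := boolP (`|r| == r); last first.
  exists [::] => z [x /= xr _]; case/negP: r0.
  by rewrite ger0_norm// (le_trans _ xr).
have rC : 0 <= C * r by rewrite mulr_ge0// -r0.
have [s sP] := comb_ball_totally_bounded n b rC e0.
exists s => _ [x /= xr <-]; apply: sP; exists (phi^~ x); last by rewrite TE.
by move=> i _ /=; rewrite (le_trans (pC i x))// ler_wpM2l.
Qed.

End BoundedMaps.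

(** * Copies of finite-dimensional subspaces among the summands *)

Section Models.
Context {R : realType} {k : scalar_kind}.
Local Notation K := (scalars R k).

(** Up to the constant 2, [W] contains a copy of [S] onto which it is projected.
    The bounds normalise an isomorphism of distortion less than 2; [a] is a
    function on the whole of [V], to avoid subtypes, but is only meaningful on
    [S]. *)
Definition model (V W : normedModType K) (S : lsubspace V) (a : V -> W) (b : W -> V) :=
  [/\ forall (c : K) x y, S x -> S y -> a (c *: x + y) = c *: a x + a y,
     forall x, S x -> `|a x| <= 2 * `|x|,
     linear b, forall w, S (b w) /\ `|b w| <= `|w| &
     forall x, S x -> b (a x) = x].

Lemma nonneg_infimums (A : set K) : A !=set0 -> (forall x, A x -> 0 <= x) ->
  infimums A !=set0.
Proof.
move=> [a Aa] A0.
have [|x []//||s [sub slub]] := @nonneg_supremums R k [set x | 0 <= x /\ lbound A x].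
- by exists 0; split.
- by exists a => x [_]; apply.
exists s; split.
  by move=> x Ax; apply: slub => y [_]; apply.
move=> y yA; have ya := yA _ Aa.
have : y \is Num.real by rewrite (ler_real ya) ger0_real// A0.
move=> /orP[y0|y0]; first by apply: sub; split.
by apply: le_trans y0 _; apply: sub; split=> // x /A0.
Qed.

(** The set of products of norms has a greatest lower bound because it
    consists of nonnegative numbers; [bm_dist] is then this bound. *)
Lemma bm_dist_lt (V W : normedModType K) (r : K) : isomorphic V W -> 0 <= r ->
  bm_dist V W < r -> exists (T : V -> W) (S : W -> V),
    mutually_inverse T S /\ opnorm T * opnorm S < r.
Proof.
move=> [T0 [S0 TS0]] r0; rewrite /bm_dist; set A := [set _ | _].
have A0 : A !=set0 by exists (opnorm T0 * opnorm S0), T0, S0.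
have Age x : A x -> 0 <= x.
  move=> [T [S [[Tb Sb _ _] ->]]].
  by rewrite mulr_ge0// ?(opnorm_bound Tb).1 ?(opnorm_bound Sb).1.
have [l lP] := nonneg_infimums A0 Age.
rewrite /infimum ifF; last by apply/negbTE/set0P.
case: xgetP => [y _ [yl yg]|/(_ l)//] yr; apply: contrapT => h.
have : r <= y.
  apply: yg => x Ax; rewrite real_leNgt ?ger0_real//; last exact: Age.
  by apply/negP => xr; apply: h; move: Ax xr => [T [S [TS ->]]]; exists T, S.
by move=> /(lt_le_trans yr); rewrite ltxx.
Qed.

Variable G : nat -> completeNormedModType K.
Hypothesis hG : C1_sequence G.

Lemma fd_space (V : normedModType K) (S : lsubspace V) :
  finite_dimensional (lsub_set S) ->
  exists (H : completeNormedModType K) (j : H -> V), [/\ linear j,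
    forall h, `|j h| = `|h|, forall h, S (j h) & forall x, S x -> exists h, j h = x].
Proof.
move=> Sfd; pose H0 := nlsub_type S.
pose H : completeNormedModType K := HB.pack H0
  (Uniform_isComplete.Build H0 (fast_complete_cauchy (fd_fast_complete Sfd))).
exists H, (fun h : H => val (h : H0)).
split=> //; first by case=> x Sx; apply/asboolP; exact: Sx.
by move=> x Sx; exists (Sub x (asboolT Sx) : H0).
Qed.

Lemma fd_model (V : normedModType K) (S : lsubspace V) :
  finite_dimensional (lsub_set S) ->
  exists i (a : V -> G i) (b : G i -> V), model S a b.
Proof.
move=> Sfd; have [H [j [jl jn jS Sj]]] := fd_space Sfd.
have jinj : injective j.
  move=> x y xy; apply/eqP; rewrite -subr_eq0 -normr_eq0 -jn (linB jl) xy.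
  by rewrite subrr normr0.
have [n [e [_ eP]]] := fd_basis Sfd.
have /choice[f fP] m : exists h, (m < n)%N -> j h = e m.
  case: (ltnP m n) => [mn|_]; last by exists 0.
  have [|h hm] := Sj (e m); last by exists h.
  by apply/eP; exists (fun i => (i == m)%:R); rewrite comb_delta.
have Hfd : finite_dimensional [set: H].
  exists n, (fun i : 'I_n => f i) => h _.
  have /eP[c hc] := jS h; exists (fun i : 'I_n => c i).
  apply: jinj; rewrite hc (lin_sum jl).
  by apply: eq_bigr => i _; rewrite (linZ jl) fP.
have [_ /(_ H Hfd 1 ltr01)[i [iHG dHG]] _] := hG.
have [T [T' [[Tb T'b TK T'K] tt]]] := bm_dist_lt iHG (addr_ge0 ler01 ler01) dHG.
have [t0 tP] := opnorm_bound Tb; have [t0' tP'] := opnorm_bound T'b.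
set t := opnorm T in tt t0 tP; set t' := opnorm T' in tt t0' tP'.
have [[Tl _] [T'l _]] := (Tb, T'b).
have /choice[inc incE] x : exists h, S x -> j h = x.
  have [Sx|nSx] := pselect (S x); last by exists 0.
  by have [h hx] := Sj x Sx; exists h.
have incl (c : K) x y : S x -> S y -> inc (c *: x + y) = c *: inc x + inc y.
  move=> Sx Sy; apply: jinj; rewrite jl !incE //.
exact: lsub_linear.
have incn x : S x -> `|inc x| = `|x| by move=> Sx; rewrite -jn incE.
suff [a [b [al a2 bl b1 ab]]] : exists (a : H -> G i) (b : G i -> H),
    [/\ linear a, forall h, `|a h| <= 2 * `|h|, linear b,
       forall g, `|b g| <= `|g| & cancel a b].
  exists i, (fun x => a (inc x)), (fun g => j (b g)); split.
  - by move=> c x y Sx Sy; rewrite incl// al.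
  - by move=> x Sx; rewrite (le_trans (a2 _))// incn.
  - by move=> c x y; rewrite bl jl.
  - by move=> w; split=> //; rewrite jn.
  - by move=> x Sx; rewrite ab incE.
(* [T] is multiplied and [T'] divided by the norm of [T'], so that the product
   of the norms bounds the norm of the first one. *)
have [t'0|t'0] := eqVneq t' 0.
  have T'0 g : T' g = 0.
    by apply/eqP; rewrite -normr_le0 (le_trans (tP' g))// t'0 mul0r.
  have H_0 (h : H) : h = 0 by rewrite -(TK h) T'0.
  exists T, T'; split=> //.
  - by move=> h; rewrite (H_0 h) (lin0 Tl) !normr0 mulr0.
  - by move=> g; rewrite T'0 normr0.
have {}t'0 : 0 < t' by rewrite lt_def t'0.
exists (fun h => t' *: T h), (fun g => t'^-1 *: T' g); split.
- by move=> c x y; rewrite Tl scalerDr !scalerA mulrC.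
- move=> h; rewrite normrZ ger0_norm// (le_trans (ler_wpM2l _ (tP h)))//.
  by rewrite mulrA ler_wpM2r// mulrC ltW.
- by move=> c x y; rewrite T'l scalerDr !scalerA mulrC.
- move=> g; rewrite normrZ normfV ger0_norm// mulrC ler_pdivrMr// mulrC.
  exact: tP'.
- by move=> h; rewrite (linZ T'l) scalerA mulVf ?gt_eqF// scale1r TK.
Qed.

Lemma model_isometric (V W W' : normedModType K) (S : lsubspace V) (a : V -> W)
    (b : W -> V) : isometric W' W -> model S a b ->
  exists a' b', model (W := W') S a' b'.
Proof.
move=> [T [Tl [T' TK T'K] Tn]] [al a2 bl b1 ab].
have T'l : linear T' by move=> c x y; rewrite -{1}(T'K x) -{1}(T'K y) -Tl TK.
exists (T' \o a), (b \o T); split=> /=.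
- by move=> c x y Sx Sy; rewrite al// T'l.
- by move=> x Sx; rewrite -Tn T'K a2.
- by move=> c x y /=; rewrite Tl bl.
- by move=> w; rewrite -(Tn w).
- by move=> x Sx; rewrite T'K ab.
Qed.

(** Each summand occurs infinitely often up to isometry, so that the summands
    modelling the [S n] may be taken with increasing indices. *)
Lemma fd_models (V : normedModType K) (S : nat -> lsubspace V) :
  (forall n, finite_dimensional (lsub_set (S n))) ->
  exists2 i : nat -> nat, injective i &
    forall n, exists a b, model (W := G (i n)) (S n) a b.
Proof.
move=> Sfd; have [_ _ inf] := hG.
have next n m : exists j, (m <= j)%N /\ exists a b, model (W := G j) (S n) a b.
  have [i [a [b ab]]] := fd_model (Sfd n).
  apply: contrapT => h; apply: (inf i).
  apply: (@sub_finite_set _ _ `I_m); last exact: finite_II.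
  move=> j [_ ji] /=; rewrite ltnNge; apply/negP => mj; apply: h.
  by exists j; split=> //; exact: model_isometric ji ab.
pose nx n m := projT1 (cid (next n m)).
have nxP n m : (m <= nx n m)%N /\ exists a b, model (W := G (nx n m)) (S n) a b.
  by rewrite /nx; case: cid.
pose fix i n := if n is n'.+1 then nx n (i n').+1 else nx 0%N 0%N.
exists i; last by case=> [|n]; [exact: (nxP 0 0)%N.2|exact: (nxP n.+1 (i n).+1).2].
have iS n : (i n < i n.+1)%N by have [] := nxP n.+1 (i n).+1.
have imono : {homo i : m n / (m < n)%N} by apply: homo_ltn => // ? ? ?; apply: ltn_trans.
move=> m n mn; apply/eqP; rewrite eqn_leq; apply/andP; split.
  by rewrite leqNgt; apply/negP => /imono; rewrite mn ltnn.
by rewrite leqNgt; apply/negP => /imono; rewrite mn ltnn.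
Qed.

End Models.

(** * The l1-sum *)

Section L1SumTheory.
Context {R : realType} {k : scalar_kind}.
Local Notation K := (scalars R k).
Variable G : nat -> completeNormedModType K.
Local Notation l1 := (l1_sum G).

Let norms (x : forall i, G i) : nat -> K := series (fun i => `|x i|).

Let normsE x n : norms x n = \sum_(i < n) `|x i|.
Proof. by rewrite /norms /series/= big_mkord. Qed.

Let norms_cvg (x : forall i, G i) (M : K) : (forall n, \sum_(i < n) `|x i| <= M) ->
  [/\ cvgn (norms x), forall n, norms x n <= limn (norms x) & limn (norms x) <= M].
Proof.
move=> xM; apply: cvgn_monotone => [|n|n]; last by rewrite normsE.
- by apply/nondecreasing_seqP => m; rewrite /norms seriesSr lerDl.
- exact: sumr_ge0.
Qed.

Lemma l1_partial_le (x : l1) n : \sum_(i < n) `|x i| <= `|x|.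
Proof.
have [M MP] : exists M, forall m, \sum_(i < m) `|x i| <= M.
  have /= /ex_bound [|M MP] :=
    @cvg_seq_bounded K K^o (norms x) (@l1_summable _ _ _ x).
    exact: (@globally_properfilter _ setT 0%N).
  by exists M => m; have := MP m I; rewrite /= normsE ger0_norm// sumr_ge0.
by have [_ h _] := norms_cvg MP; have := h n; rewrite normsE.
Qed.

Lemma l1_norm_le (x : l1) (M : K) :
  (forall n, \sum_(i < n) `|x i| <= M) -> `|x| <= M.
Proof. by case/norms_cvg. Qed.

Lemma l1_of_family (x : forall i, G i) (M : K) :
  (forall n, \sum_(i < n) `|x i| <= M) -> exists y : l1, forall i, y i = x i.
Proof. by case/norms_cvg => xc _ _; exists (L1Sum xc). Qed.

Lemma l1_coord_le (x : l1) i : `|x i| <= `|x|.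
Proof.
by apply: le_trans (l1_partial_le x i.+1); rewrite big_ord_recr/= lerDr sumr_ge0.
Qed.

Lemma l1_coord_linear i : linear (fun x : l1 => x i).
Proof. by []. Qed.

Lemma l1_coord_bounded i : bounded_operator (fun x : l1 => x i).
Proof.
apply: (bounded_operatorI (l1_coord_linear i) ler01) => x.
by rewrite mul1r l1_coord_le.
Qed.

(** The coordinates converge at the rate of the sequence itself. Comparison with
    later and later terms gives the same rate for each partial sum of the norms
    of the coordinates, uniformly in its length. *)
Lemma l1_fast_complete : fast_complete l1.
Proof.
move=> C u C0 uC.
have ui i : fast_cauchy C (fun n => u n i).
  by move=> n; apply: le_trans (uC n); exact: (l1_coord_le (u n.+1 - u n)).
have /all_sig[l lP] i : {l | forall n, `|l - u n i| <= C * 2^-1 ^+ n}.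
  by apply: cid; apply: complete_fast.
have lu n m : \sum_(i < m) `|l i - u n i| <= C * 2^-1 ^+ n.
  apply: (@ler_half_exp _ _ _ _ (C * m%:R)).
  - by rewrite ger0_real// sumr_ge0.
  - by rewrite ger0_real// mulr_ge0// half_exp_ge0.
  - by rewrite mulr_ge0.
  move=> p; pose q := (n + p)%N.
  apply: (@le_trans _ _ (\sum_(i < m) `|l i - u q i| + \sum_(i < m) `|(u q - u n) i|)).
    rewrite -big_split; apply: ler_sum => i _ /=.
    by rewrite -(subrKA (u q i)) (le_trans (ler_normD _ _)).
  rewrite addrC lerD//.
    exact: le_trans (l1_partial_le _ _) (fast_cauchy_dist C0 uC _ _).
  apply: (@le_trans _ _ (\sum_(i < m) C * 2^-1 ^+ p)).
    apply: ler_sum => i _; apply: le_trans (lP i q) _.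
    by rewrite ler_wpM2l// half_exp_le// leq_addl.
  by rewrite sumr_const card_ord -mulrnAl -mulr_natr.
have [|y yl] := @l1_of_family l (C + `|u 0%N|).
  move=> m; apply: (@le_trans _ _ (\sum_(i < m) `|l i - u 0%N i| + \sum_(i < m) `|u 0%N i|)).
    rewrite -big_split; apply: ler_sum => i _ /=.
    by rewrite -{1}[l i](subrK (u 0%N i)) ler_normD.
  by rewrite lerD ?l1_partial_le// (le_trans (lu _ _))// expr0 mulr1.
exists y => n; apply: l1_norm_le => m.
rewrite (eq_bigr (fun i : 'I_m => `|l i - u n i|)) ?lu// => i _.
by rewrite -[(y - u n) i]/(y i - u n i) yl.
Qed.

Lemma l1_inj_subproof i (g : G i) n :
  \sum_(j < n) `|dfwith (fun j => 0 : G j) i g j| <= `|g|.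
Proof.
have [ni|ni] := ltnP i n.
  rewrite (bigD1 (Ordinal ni))//= dfwithin big1 ?addr0// => j ji.
  by rewrite dfwithout ?normr0//; rewrite eq_sym -val_eqE in ji.
rewrite big1// => j _; rewrite dfwithout ?normr0//.
by rewrite gtn_eqF// (leq_trans (ltn_ord j)).
Qed.

Definition l1_inj i (g : G i) : l1 :=
  projT1 (cid (l1_of_family (l1_inj_subproof g))).

Lemma l1_injE i (g : G i) j : l1_inj g j = dfwith (fun j => 0 : G j) i g j.
Proof. by rewrite /l1_inj; case: cid. Qed.

Lemma l1_inj_in i (g : G i) : l1_inj g i = g.
Proof. by rewrite l1_injE dfwithin. Qed.

Lemma l1_inj_out i (g : G i) j : i != j -> l1_inj g j = 0.
Proof. by move=> ij; rewrite l1_injE dfwithout. Qed.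

Lemma l1_inj_linear i : linear (@l1_inj i).
Proof.
move=> c g h; apply: l1_sum_eq => j.
rewrite -[(_ + _ : l1) j]/(c *: l1_inj g j + l1_inj h j).
have [<-|ij] := eqVneq i j; first by rewrite !l1_inj_in.
by rewrite !l1_inj_out// scaler0 addr0.
Qed.

Lemma l1_inj_norm i (g : G i) : `|l1_inj g| <= `|g|.
Proof.
apply: l1_norm_le => n; apply: le_trans (l1_inj_subproof g n).
by apply: ler_sum => j _; rewrite l1_injE.
Qed.

Lemma l1_inj_bounded i : bounded_operator (@l1_inj i).
Proof.
by apply: (bounded_operatorI (@l1_inj_linear i) ler01) => g; rewrite mul1r l1_inj_norm.
Qed.

End L1SumTheory.

(** * Norm limits of finite rank operators *)

Section ApproximableMaps.
Context {R : realType} {k : scalar_kind}.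
Local Notation K := (scalars R k).

(** The notion of [approximable], between two different spaces and with
    pointwise bounds instead of operator norms. *)
Definition approximable_map (V W : normedModType K) (T : V -> W) : Prop :=
  bounded_operator T /\ forall e : K, 0 < e ->
    exists S, finite_rank S /\ forall x, `|T x - S x| <= e * `|x|.

Lemma approximableP (X : normedModType K) (T : X -> X) :
  approximable T <-> approximable_map T.
Proof.
split=> -[Tb TP]; split=> // e e0.
  have [S [Sf TS]] := TP _ e0; exists S; split=> // x.
  have [SM SM0 SP] := bounded_operatorE Sf.1.
  have [M M0 MP] := bounded_operatorE Tb.
  have Db : bounded_operator (T \- S).
    apply: (bounded_operatorI _ (addr_ge0 M0 SM0)) => [a y z|y].
      by rewrite /= Tb.1 Sf.1.1 opprD addrACA scalerBr.
    by rewrite mulrDl (le_trans (ler_normB _ _))// lerD.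
  by rewrite (le_trans ((opnorm_bound Db).2 x))// ler_wpM2r// ltW.
have e20 : 0 < e / 2 by rewrite divr_gt0.
have [S [Sf TS]] := TP _ e20; exists S; split=> //.
apply: (@le_lt_trans _ _ (e / 2)); first by apply: opnorm_le => //; rewrite ltW.
by rewrite ltr_pdivrMr// ltr_pMr// ltr1n.
Qed.

Lemma bounded_comp (U V W : normedModType K) (S : V -> W) (T : U -> V) :
  bounded_operator S -> bounded_operator T -> bounded_operator (S \o T).
Proof.
move=> Sb Tb; have [a a0 aP] := bounded_operatorE Sb.
have [b b0 bP] := bounded_operatorE Tb.
apply: (bounded_operatorI _ (mulr_ge0 a0 b0)) => [c x y|x] /=.
  by rewrite Tb.1 Sb.1.
by rewrite (le_trans (aP _))// -mulrA ler_wpM2l.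
Qed.

Lemma finite_rank_compl (U V W : normedModType K) (S : V -> W) (T : U -> V) :
  bounded_operator S -> finite_rank T -> finite_rank (S \o T).
Proof.
move=> Sb [Tb [n [e eP]]]; split; first exact: bounded_comp.
exists n, (S \o e) => _ [x _ <-]; have [|c cx] := eP (T x); first by exists x.
by exists c; rewrite /= cx (lin_sum Sb.1); apply: eq_bigr => i _; rewrite (linZ Sb.1).
Qed.

Lemma finite_rank_compr (U V W : normedModType K) (S : V -> W) (T : U -> V) :
  finite_rank S -> bounded_operator T -> finite_rank (S \o T).
Proof.
move=> [Sb [n [e eP]]] Tb; split; first exact: bounded_comp.
by exists n, e => _ [x _ <-]; apply: eP; exists (T x).
Qed.

Lemma finite_rank_lin (V W : normedModType K) (c : K) (S T : V -> W) :
  finite_rank S -> finite_rank T -> finite_rank (fun x => c *: S x + T x).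
Proof.
move=> [Sb [n [e eP]]] [Tb [m [f fP]]].
have [a a0 aP] := bounded_operatorE Sb; have [b b0 bP] := bounded_operatorE Tb.
split.
  apply: (bounded_operatorI (M := `|c| * a + b)) => [d x y||x].
  - by rewrite Sb.1 Tb.1 !scalerDr !scalerA (mulrC c) addrACA.
  - by rewrite addr_ge0 ?mulr_ge0.
  - rewrite mulrDl (le_trans (ler_normD _ _))// lerD// normrZ -mulrA.
    by rewrite ler_wpM2l.
exists (n + m)%N, (fun i => match fintype.split i with inl i => e i | inr j => f j end).
move=> _ [x _ <-].
have [|a' ->] := eP (S x); first by exists x.
have [|b' ->] := fP (T x); first by exists x.
exists (fun i => match fintype.split i with inl i => c * a' i | inr j => b' j end).
rewrite big_split_ord /= scaler_sumr; congr (_ + _); apply: eq_bigr => i _.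
  by rewrite -[lshift _ _]/(unsplit (inl i)) unsplitK scalerA.
by rewrite -[rshift _ _]/(unsplit (inr i)) unsplitK.
Qed.

Lemma finite_rank0 (V W : normedModType K) : finite_rank (fun _ : V => 0 : W).
Proof.
split; last by exists 0%N, (fun=> 0) => _ [x _ <-]; exists (fun=> 0); rewrite big_ord0.
apply: (bounded_operatorI (M := 0)) => // [c x y|x]; first by rewrite scaler0 addr0.
by rewrite normr0 mul0r.
Qed.

Lemma finite_rank_sum (V W : normedModType K) (w : nat -> V -> W) n :
  (forall i, finite_rank (w i)) -> finite_rank (fun x => \sum_(i < n) w i x).
Proof.
move=> wf; elim: n => [|n IH].
  have := finite_rank0 V W; congr finite_rank.
  by apply/funext => x; rewrite big_ord0.
have := finite_rank_lin 1 IH (wf n); congr finite_rank.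
by apply/funext => x; rewrite big_ord_recr/= scale1r.
Qed.

Lemma fd_finite_rank (V W : normedModType K) (T : V -> W) :
  finite_dimensional [set: V] -> bounded_operator T -> finite_rank T.
Proof.
move=> [n [e eP]] Tb; split=> //; exists n, (T \o e) => _ [x _ <-].
have [//|c {1}->] := eP x; exists c.
by rewrite (lin_sum Tb.1); apply: eq_bigr => i _; rewrite (linZ Tb.1).
Qed.

(** The remainder bound in the conclusion determines [T], and is the form in
    which the sum of the series is used. *)
Lemma operator_series (V W : normedModType K) (w : nat -> V -> W) (M : K) :
  fast_complete W -> 0 <= M -> (forall n, finite_rank (w n)) ->
  (forall n x, `|w n x| <= M * 2^-1 ^+ n.+1 * `|x|) ->
  exists T : V -> W, approximable_map T /\
    forall x n, `|T x - \sum_(i < n) w i x| <= M * `|x| * 2^-1 ^+ n.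
Proof.
move=> Wc M0 wf wM.
have /choice[T TP] x : exists l, forall n, `|l - \sum_(i < n) w i x| <= M * `|x| * 2^-1 ^+ n.
  apply: Wc; first by rewrite mulr_ge0.
  move=> n; rewrite big_ord_recr/= addrAC subrr add0r mulrAC.
  exact: wM.
exists T; split=> //.
have Tl : linear T.
  move=> c x y; apply: (@fast_limit_unique _ _ _ (M * `|c *: x + y|)
      (`|c| * (M * `|x|) + M * `|y|) (fun n => \sum_(i < n) w i (c *: x + y))) => //.
  - by rewrite mulr_ge0.
  - by rewrite addr_ge0 ?mulr_ge0.
  move=> n; have -> : \sum_(i < n) w i (c *: x + y) =
      c *: (\sum_(i < n) w i x) + \sum_(i < n) w i y.
    rewrite scaler_sumr -big_split; apply: eq_bigr => i _.
    by have [[wl _] _] := wf i; rewrite wl.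
  rewrite opprD addrACA -scalerBr mulrDl (le_trans (ler_normD _ _))// lerD//.
  by rewrite normrZ -mulrA ler_wpM2l.
split.
  apply: (bounded_operatorI Tl M0) => x; have := TP x 0%N.
  by rewrite big_ord0 subr0 expr0 mulr1.
move=> e e0; have [n ne] := ltr_mul_half_exp M0 e0.
exists (fun x => \sum_(i < n) w i x); split; first exact: finite_rank_sum.
by move=> x; rewrite (le_trans (TP x n))// mulrAC ler_wpM2r// ltW.
Qed.

Lemma bounded_scale (V W : normedModType K) (c : K) (T : V -> W) :
  bounded_operator T -> bounded_operator (fun x => c *: T x).
Proof.
move=> Tb; have [M M0 MP] := bounded_operatorE Tb.
apply: (bounded_operatorI (M := `|c| * M)) => [a x y||x].
- by rewrite Tb.1 scalerDr !scalerA mulrC.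
- by rewrite mulr_ge0.
- by rewrite normrZ -mulrA ler_wpM2l.
Qed.

Lemma approximable_compl (U V W : normedModType K) (S : V -> W) (T : U -> V) :
  bounded_operator S -> approximable_map T -> approximable_map (S \o T).
Proof.
move=> Sb [Tb Ta]; split=> [|e e0]; first exact: bounded_comp.
have [M M0 MP] := bounded_operatorE Sb; have M1 : 0 < M + 1 by rewrite ltr_wpDl.
have [T' [T'f T'T]] := Ta _ (divr_gt0 e0 M1).
exists (S \o T'); split; first exact: finite_rank_compl.
move=> x /=; rewrite -(linB Sb.1) (le_trans (MP _))//.
rewrite (le_trans (ler_wpM2l M0 (T'T x)))// mulrA ler_wpM2r// mulrA.
by rewrite ler_pdivrMr// mulrC ler_wpM2l ?(ltW e0)// lerDl.
Qed.

Lemma approximable_compr (U V W : normedModType K) (S : V -> W) (T : U -> V) :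
  approximable_map S -> bounded_operator T -> approximable_map (S \o T).
Proof.
move=> [Sb Sa] Tb; split=> [|e e0]; first exact: bounded_comp.
have [M M0 MP] := bounded_operatorE Tb; have M1 : 0 < M + 1 by rewrite ltr_wpDl.
have [S' [S'f S'S]] := Sa _ (divr_gt0 e0 M1).
exists (S' \o T); split; first exact: finite_rank_compr.
move=> x /=; rewrite (le_trans (S'S _))// -mulrA ler_wpM2l ?(ltW e0)// ler_pdivrMl//.
by rewrite (le_trans (MP x))// ler_wpM2r// lerDl.
Qed.

Lemma fst_bounded (V W : normedModType K) : bounded_operator (fst : V * W -> V).
Proof.
apply: (bounded_operatorI (M := 1)) => // x; rewrite mul1r.
by have := lexx `|x|; rewrite {1}prod_norm_le => /andP[].
Qed.

Lemma snd_bounded (V W : normedModType K) : bounded_operator (snd : V * W -> W).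
Proof.
apply: (bounded_operatorI (M := 1)) => // x; rewrite mul1r.
by have := lexx `|x|; rewrite {1}prod_norm_le => /andP[].
Qed.

Lemma inl_bounded (V W : normedModType K) : bounded_operator (fun x : V => (x, 0 : W)).
Proof.
apply: (bounded_operatorI (M := 1)) => // [c x y|x].
  by congr pair; rewrite /= scaler0 addr0.
by rewrite mul1r prod_norm_le/= normr0 lexx normr_ge0.
Qed.

Lemma inr_bounded (V W : normedModType K) : bounded_operator (fun x : W => (0 : V, x)).
Proof.
apply: (bounded_operatorI (M := 1)) => // [c x y|x].
  by congr pair; rewrite /= scaler0 addr0.
by rewrite mul1r prod_norm_le/= normr0 lexx normr_ge0.
Qed.

Lemma approximable_add (V W : normedModType K) (S T : V -> W) :
  approximable_map S -> approximable_map T -> approximable_map (fun x => S x + T x).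
Proof.
move=> [Sb Sa] [Tb Ta]; split=> [|e e0].
  have [a a0 aP] := bounded_operatorE Sb; have [b b0 bP] := bounded_operatorE Tb.
  apply: (bounded_operatorI _ (addr_ge0 a0 b0)) => [c x y|x].
    by rewrite Sb.1 Tb.1 scalerDr addrACA.
  by rewrite mulrDl (le_trans (ler_normD _ _))// lerD.
have e2 : 0 < e / 2 by rewrite divr_gt0.
have [S' [S'f S'S]] := Sa _ e2; have [T' [T'f T'T]] := Ta _ e2.
exists (fun x => 1 *: S' x + T' x); split; first exact: finite_rank_lin.
move=> x; rewrite scale1r opprD addrACA (le_trans (ler_normD _ _))//.
by rewrite [e in leRHS]splitr mulrDl lerD.
Qed.

Definition approx_of (X : normedModType K) (T : X -> X) (Ta : approximable_map T) :=
  ApproxOp ((approximableP T).2 Ta).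

End ApproximableMaps.

(** * Factorization through the l1-sum *)

Section Factorization.
Context {R : realType} {k : scalar_kind}.
Local Notation K := (scalars R k).
Variable G : nat -> completeNormedModType K.
Hypothesis hG : C1_sequence G.
Local Notation l1 := (l1_sum G).

Lemma l1_coord_limit (y : l1) (s : nat -> l1) (C : K) i (g : G i) m : 0 <= C ->
  (forall n, `|y - s n| <= C * 2^-1 ^+ n) -> (forall n, (m <= n)%N -> s n i = g) ->
  y i = g.
Proof.
move=> C0 ys sg; apply/eqP; rewrite -subr_eq0 -normr_le0.
apply: (@ler_half_exp _ _ _ _ C) => // n; rewrite add0r.
rewrite -(sg (n + m)%N) ?leq_addl//.
rewrite (le_trans (l1_coord_le (y - s (n + m)%N) i))// (le_trans (ys _))//.
by rewrite ler_wpM2l// half_exp_le// leq_addr.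
Qed.

Lemma l1_coord_sum n (s : nat -> l1) i :
  (\sum_(j < n) s j) i = \sum_(j < n) s j i.
Proof. exact: (lin_sum (@l1_coord_linear _ _ G i)). Qed.

(** The differences [f n] of consecutive [S n] have norms of order [4^-n], and
    their ranges are modelled in distinct summands. Sending [x] to the copies of
    the [2^n f n x], and these back to the [f n x], splits [T] into two
    operators that are both sums of absolutely convergent series of finite rank
    operators. The last conclusion carries the information on kernels: it is
    used for [S n = Q n \o T], which vanishes wherever [T] does. *)
Lemma factor_through_l1 (Z Y : normedModType K) (T : Z -> Y) (S : nat -> Z -> Y) :
  fast_complete Y -> (forall n, finite_rank (S n)) ->
  (forall n x, `|T x - S n x| <= 2^-1 ^+ (n + n) * `|x|) ->
  exists (U : l1 -> Y) (V : Z -> l1), [/\ approximable_map U, approximable_map V,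
    forall x, T x = U (V x) & forall x, (forall n, S n x = 0) -> V x = 0].
Proof.
move=> Yc Sf TS.
pose f n x := if n is n'.+1 then S n x - S n' x else S 0%N x.
have ff n : finite_rank (f n).
  case: n => [|n]; first exact: Sf.
  have := finite_rank_lin (-1) (Sf n) (Sf n.+1); congr finite_rank.
  by apply/funext => x; rewrite scaleN1r addrC.
have fsum x n : \sum_(j < n.+1) f j x = S n x.
  elim: n => [|n IH]; first by rewrite big_ord1.
  by rewrite big_ord_recr/= IH addrC subrK.
have [M0 M00 M0P] := bounded_operatorE (Sf 0%N).1.
pose M := M0 + 8.
have M_ge0 : 0 <= M by rewrite addr_ge0.
have fM n x : `|f n x| <= M * 2^-1 ^+ n * 2^-1 ^+ n * `|x|.
  case: n => [|n].
    by rewrite !expr0 !mulr1 (le_trans (M0P x))// ler_wpM2r// lerDl.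
  apply: (@le_trans _ _ (8 * 2^-1 ^+ n.+1 * 2^-1 ^+ n.+1 * `|x|)); last first.
    by rewrite !ler_wpM2r ?half_exp_ge0// lerDr.
  rewrite /f -(subrKA (T x)) (le_trans (ler_normD _ _))// distrC.
  rewrite (le_trans (lerD (TS _ x) (TS _ x)))// -mulrDl ler_wpM2r//.
  have -> : 8 * 2^-1 ^+ n.+1 * 2^-1 ^+ n.+1 = 2^-1 ^+ (n + n) + 2^-1 ^+ (n + n) :> K.
    rewrite -mulrA -exprD addSn addnS !exprS.
    by field.
  by rewrite lerD2r half_exp_le// leq_add.
pose Sf' n := range_lsubspace (ff n).1.1.
have [i iinj mod] := @fd_models _ _ G hG Y Sf' (fun n => (ff n).2).
have /all_sig[ab abP] n : {ab : (Y -> G (i n)) * (G (i n) -> Y) |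
    model (W := G (i n)) (Sf' n) ab.1 ab.2}.
  by apply: cid; have [a [b]] := mod n; exists (a, b).
have rf n x : Sf' n (f n x) by exists x.
pose v n x := (2^-1 ^+ n)^-1 *: l1_inj ((ab n).1 (f n x)).
pose u n (y : l1) := 2^-1 ^+ n *: (ab n).2 (y (i n)).
have af_bounded n : bounded_operator (fun x => (ab n).1 (f n x)).
  have [al a2 _ _ _] := abP n; have [F F0 FP] := bounded_operatorE (ff n).1.
  apply: (bounded_operatorI (M := 2 * F)) => [c x y||x].
  - by rewrite (ff n).1.1 al.
  - by rewrite mulr_ge0.
  - by rewrite (le_trans (a2 _ _))// -mulrA ler_wpM2l.
have Gfd n : finite_dimensional [set: G n] by have [+ _ _] := hG; apply.
have injb n := bounded_scale ((2^-1 : K) ^+ n)^-1 (@l1_inj_bounded _ _ G (i n)).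
have vf n : finite_rank (v n).
  by have := finite_rank_compr (fd_finite_rank (@Gfd _) (injb n)) (af_bounded n).
have bb n : bounded_operator (ab n).2.
  have [_ _ bl b1 _] := abP n; apply: (bounded_operatorI bl ler01) => g.
  by rewrite mul1r; have [] := b1 g.
have uf n : finite_rank (u n).
  have := fd_finite_rank (@Gfd _) (bounded_scale (2^-1 ^+ n) (bb n)).
  by move=> /finite_rank_compr /(_ (@l1_coord_bounded _ _ G (i n))).
have [||V [Va VP]] := @operator_series _ _ _ _ v (4 * M) (@l1_fast_complete _ _ G) _ vf.
- by rewrite mulr_ge0.
- move=> n x; have [_ a2 _ _ _] := abP n.
  rewrite /v normrZ normfV ger0_norm ?half_exp_ge0// ler_pdivrMl ?half_exp_gt0//.
  rewrite (le_trans (l1_inj_norm _))// (le_trans (a2 _ (rf n x)))//.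
  have -> : 2^-1 ^+ n * (4 * M * 2^-1 ^+ n.+1 * `|x|) =
      2 * (M * 2^-1 ^+ n * 2^-1 ^+ n * `|x|) :> K by rewrite exprS; field.
  by rewrite ler_wpM2l.
have [||U [Ua UP]] := @operator_series _ _ _ _ u 2 Yc _ uf.
- by [].
- move=> n y; have [_ _ _ b1 _] := abP n.
  rewrite /u normrZ ger0_norm ?half_exp_ge0// exprS mulrA divff ?pnatr_eq0// mul1r.
  by rewrite ler_wpM2l ?half_exp_ge0// (le_trans (b1 _).2)// l1_coord_le.
have Vi x n : (V x) (i n) = (2^-1 ^+ n)^-1 *: (ab n).1 (f n x).
  apply: (@l1_coord_limit _ _ (4 * M * `|x|) _ _ n.+1 _ (VP x)) => [|m nm].
    by rewrite !mulr_ge0.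
  apply: etrans (l1_coord_sum m (fun j => v j x) (i n)) _.
  rewrite (bigD1 (Ordinal nm))//= big1 => [|j jn].
    by rewrite addr0 l1_inj_in.
  rewrite l1_inj_out ?scaler0//.
  by apply: contra jn => /eqP/iinj jn; apply/eqP/val_inj.
exists U, V; split=> // x.
  apply: (@fast_limit_unique _ _ _ `|x| (2 * `|V x|) (fun n => S n x)) => [||n|n].
  - by [].
  - by rewrite mulr_ge0.
  - by rewrite (le_trans (TS n x))// mulrC ler_wpM2l// half_exp_le// leq_addr.
  have -> : S n x = \sum_(j < n.+1) u j (V x).
    rewrite -fsum; apply: eq_bigr => j _; have [_ _ bl _ ba] := abP j.
    by rewrite /u Vi (linZ bl) scalerA divff ?gt_eqF ?half_exp_gt0// scale1r ba.
  by rewrite (le_trans (UP _ _))// ler_wpM2l ?mulr_ge0// half_exp_le.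
move=> Sx; apply: (@fast_limit_unique _ _ _ (4 * M * `|x|) 0 (fun=> 0)) => //.
- by rewrite !mulr_ge0.
- move=> n; have := VP x n; rewrite big1// => j _; rewrite /v.
  have -> : f j x = 0 by case: (j : nat) => [|m]; rewrite /f !Sx ?subr0.
  have [al a2 _ _ _] := abP j; have := a2 0 (@lsub_0 _ _ (Sf' j)).
  by rewrite normr0 mulr0 normr_le0 => /eqP ->; rewrite (lin0 (@l1_inj_linear _ _ G _)) scaler0.
- by move=> n; rewrite subr0 normr0 mul0r.
Qed.

End Factorization.

(** * Approximation of approximable operators from the left *)

Section ApproximateIdentities.
Context {R : realType} {k : scalar_kind}.
Local Notation K := (scalars R k).

Lemma approximable_totally_bounded (V W : normedModType K) (T : V -> W) :
  approximable_map T -> totally_bounded [set T x | x in [set x | `|x| <= 1]].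
Proof.
move=> [_ Ta] e e0; have e2 : 0 < e / 2 by rewrite divr_gt0.
have [S [Sf ST]] := Ta _ e2.
have [s sP] := finite_rank_totally_bounded 1 Sf e2.
exists s => _ [x /= x1 <-]; have [|y ys xy] := sP (S x); first by exists x.
exists y => //; rewrite -(subrKA (S x)) (le_trans (ler_normD _ _))//.
rewrite [leRHS]splitr lerD// (le_trans (ST x))// ler_piMr// ltW//.
Qed.

Lemma totally_bounded_closure (V : normedModType K) (A : set V) :
  totally_bounded A -> totally_bounded (closure A).
Proof.
move=> Atb e e0; have e2 : 0 < e / 2 by rewrite divr_gt0.
have [s sP] := Atb _ e2; exists s => x xA.
have [z [Az]] := xA _ (nbhsx_ballx x _ e2); rewrite -ball_normE /= => xz.
have [y ys zy] := sP z Az; exists y => //.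
by rewrite -(subrKA z) (le_trans (ler_normD _ _))// [leRHS]splitr lerD// ltW.
Qed.

(** A net for the radius [e] splits [A] into finitely many pieces, one of which
    belongs to any given ultrafilter on [A]; hence the ultrafilter is Cauchy. *)
Lemma totally_bounded_compact (V : normedModType K) (A : set V) :
  fast_complete V -> totally_bounded A -> compact (closure A).
Proof.
move=> Vc /totally_bounded_closure Atb; rewrite compact_ultra => F FU FA.
have pF : ProperFilter F by exact: ultra_proper.
have pick (B : set V) (s : seq V) (e : K) : F B ->
    (forall x, B x -> exists2 y, y \in s & `|x - y| <= e) ->
    exists y, F [set x | `|x - y| <= e].
  elim: s B => [|y s IH] B FB sP.
    by have [x /sP[]] := filter_ex FB.
  have [Fy|Fny] := in_ultra_setVsetC [set x | `|x - y| <= e] FU.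
    by exists y.
  apply: (IH (B `&` ~` [set x | `|x - y| <= e])); first exact: filterI.
  move=> x [/sP[z + xz] /= nxy]; rewrite inE => /predU1P[zy|zs]; last by exists z.
  by case: nxy; rewrite -zy.
have Fc : cauchy F.
  apply/cauchyP => e e0; have e2 : 0 < e / 2 by rewrite divr_gt0.
  have [s sP] := Atb _ e2; have [y Fy] := pick _ _ _ FA sP.
  exists y; apply: filterS Fy => x /= xy; rewrite -ball_normE /= distrC.
  by rewrite (le_lt_trans xy)// ltr_pdivrMr// ltr_pMr// ltr1n.
have /cvg_ex[p Fp] := fast_complete_cauchy Vc pF Fc.
exists p; split; last exact: Fp.
apply: closed_closure => B pB.
by apply: (@filter_ex _ F); apply: filterI => //; exact: (Fp B pB).
Qed.

(** The form in which the approximation property is used: it passes to products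
    and to the l1-sum without a description of their compact subsets. *)
Definition left_approximable (V : normedModType K) := forall (Z : normedModType K)
  (T : Z -> V), approximable_map T -> forall e : K, 0 < e ->
  exists Q : V -> V, finite_rank Q /\ forall x, `|T x - Q (T x)| <= e * `|x|.

Lemma le_unit_ball (Z V : normedModType K) (T : Z -> V) (e : K) : linear T ->
  (forall x, `|x| <= 1 -> `|T x| <= e) -> forall x, `|T x| <= e * `|x|.
Proof.
move=> Tl h x; have [->|x0] := eqVneq x 0; first by rewrite (lin0 Tl) !normr0 mulr0.
have nx : 0 < `|x| by rewrite normr_gt0.
have := h (`|x|^-1 *: x); rewrite (linZ Tl) !normrZ normfV normr_id.
by rewrite mulVf ?gt_eqF// => /(_ (lexx _)); rewrite ler_pdivrMl// mulrC.
Qed.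

Lemma AP_left_approximable (E : completeNormedModType K) :
  approximation_property E -> left_approximable E.
Proof.
move=> Eap Z T Ta e e0.
have Kc := totally_bounded_compact (@complete_fast _ _ E) (approximable_totally_bounded Ta).
have [Q [Qf QP]] := Eap _ Kc e e0; exists Q; split=> //.
apply: (le_unit_ball (T := fun x => T x - Q (T x))) => [c x y|x x1].
  by rewrite Ta.1.1 Qf.1.1 scalerBr opprD addrACA.
by rewrite distrC ltW// QP//; apply: subset_closure; exists x.
Qed.

Lemma left_approximable_prod (V W : normedModType K) :
  left_approximable V -> left_approximable W -> left_approximable (V * W)%type.
Proof.
move=> Va Wa Z T Ta e e0.
have [P [Pf PP]] := Va _ _ (approximable_compl (fst_bounded V W) Ta) e e0.
have [Q [Qf QP]] := Wa _ _ (approximable_compl (snd_bounded V W) Ta) e e0.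
exists (fun x => 1 *: (P x.1, 0) + (0, Q x.2)); split.
  apply: finite_rank_lin.
    exact: finite_rank_compl (inl_bounded V W) (finite_rank_compr Pf (fst_bounded V W)).
  exact: finite_rank_compl (inr_bounded V W) (finite_rank_compr Qf (snd_bounded V W)).
move=> x; rewrite scale1r prod_norm_le /= addr0 add0r.
by rewrite PP QP.
Qed.

End ApproximateIdentities.

Section L1ApproximateIdentity.
Context {R : realType} {k : scalar_kind}.
Local Notation K := (scalars R k).
Variable G : nat -> completeNormedModType K.
Hypothesis Gfd : forall n, finite_dimensional [set: G n].
Local Notation l1 := (l1_sum G).

Definition l1_trunc m (y : l1) : l1 := \sum_(i < m) l1_inj (y i).

Lemma l1_trunc_finite_rank m : finite_rank (l1_trunc m).
Proof.
apply: (@finite_rank_sum _ _ l1 l1 (fun i y => l1_inj (y i)) m) => i.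
apply: (finite_rank_compr (S := @l1_inj _ _ G i)); last exact: l1_coord_bounded.
exact: (fd_finite_rank (@Gfd i) (@l1_inj_bounded R k G i)).
Qed.

Lemma l1_trunc_le m y : `|l1_trunc m y| <= `|y|.
Proof.
rewrite (le_trans (ler_norm_sum _ _ _))// (le_trans _ (l1_partial_le y m))//.
by apply: ler_sum => i _; exact: l1_inj_norm.
Qed.

Lemma l1_truncE m y i : l1_trunc m y i = if (i < m)%N then y i else 0.
Proof.
apply: etrans (l1_coord_sum m (fun j => l1_inj (y j)) i) _.
case: ltnP => [im|mi].
  rewrite (bigD1 (Ordinal im))//= l1_inj_in big1 ?addr0// => j ji.
  by rewrite l1_inj_out.
by rewrite big1// => j _; rewrite l1_inj_out// ltn_eqF// (leq_trans (ltn_ord j)).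
Qed.

Lemma l1_trunc_cvg y (e : K) : 0 < e ->
  exists m, forall n, (m <= n)%N -> `|y - l1_trunc n y| <= e.
Proof.
move=> e0.
have [m mP] : exists m, `|y| - e <= \sum_(i < m) `|y i|.
  apply: contrapT => /forallNP h.
  suff : `|y| <= `|y| - e by rewrite lerBrDl gerDr => /(lt_le_trans e0); rewrite ltxx.
  apply: l1_norm_le => m; have /negP := h m.
  rewrite -real_ltNge ?rpredB ?ger0_real ?sumr_ge0// ?(ltW e0)//.
  by move=> /ltW.
exists m => n mn; apply: l1_norm_le => p.
rewrite (eq_bigr (fun i : 'I_p => if (i < n)%N then 0 else `|y i|)); last first.
  move=> i _; rewrite -[(y - _) i]/(y i - l1_trunc n y i) l1_truncE.
  by case: ifP; rewrite ?subrr ?normr0 ?subr0.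
have [pn|np] := leqP p n.
  rewrite big1 ?(ltW e0)// => i _.
  by rewrite (leq_trans (ltn_ord i) pn).
rewrite -(big_mkord xpredT (fun i => if (i < n)%N then 0 else `|y i|)).
rewrite (@big_cat_nat _ _ _ n)//= ?(ltnW np)// big_nat big1 ?add0r; last first.
  by move=> i /andP[_ ->].
have := l1_partial_le y p; rewrite -(big_mkord xpredT (fun i => `|y i|)).
rewrite (@big_cat_nat _ _ _ n)//= ?(ltnW np)// -lerBrDl => yp.
rewrite (@eq_big_nat _ _ _ _ _ _ (fun i => `|y i|)); last first.
  by move=> i /andP[ni _]; rewrite ltnNge ni.
apply: (le_trans yp); rewrite lerBlDl -lerBlDr (le_trans mP)//.
rewrite -(big_mkord xpredT (fun i => `|y i|)) (@big_cat_nat _ _ _ m _ n)//= lerDl.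
by apply: sumr_ge0.
Qed.

(** Truncations are contractions that converge to the identity pointwise, hence
    uniformly on a totally bounded set. *)
Lemma l1_left_approximable : left_approximable l1.
Proof.
move=> Z T Ta e e0.
have e4 : 0 < e / 2 / 2 by rewrite !divr_gt0.
have [s sP] := approximable_totally_bounded Ta e4.
have [m mP] : exists m, forall y, y \in s -> `|y - l1_trunc m y| <= e / 2.
  have e2 : 0 < e / 2 by rewrite divr_gt0.
  suff [m mP] : exists m, forall n, (m <= n)%N -> forall y, y \in s ->
      `|y - l1_trunc n y| <= e / 2 by exists m => y; exact: mP.
  elim: s {sP} => [|y s [m IH]]; first by exists 0%N.
  have [m' m'P] := l1_trunc_cvg y e2.
  exists (maxn m m') => n; rewrite geq_max => /andP[mn m'n] z.
  by rewrite inE => /predU1P[->|zs]; [exact: m'P|exact: IH].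
have Pf := l1_trunc_finite_rank m.
exists (l1_trunc m); split=> //.
apply: (le_unit_ball (T := fun x => T x - l1_trunc m (T x))) => [c x y|x x1].
  by rewrite Ta.1.1 Pf.1.1 scalerBr opprD addrACA.
have [|y ys xy] := sP (T x); first by exists x.
have -> : T x - l1_trunc m (T x) = (T x - y) + (y - l1_trunc m y) - l1_trunc m (T x - y).
  by rewrite (linB Pf.1.1) subrKA opprB addrA subrK.
rewrite (le_trans (ler_normB _ _))// [e in leRHS]splitr [X in _ <= X + _]splitr.
rewrite [leRHS]addrAC; apply: lerD; last exact: le_trans (l1_trunc_le _ _) xy.
by rewrite (le_trans (ler_normD _ _))// lerD// mP.
Qed.

End L1ApproximateIdentity.

(** * The Hahn-Banach theorem over both scalar fields *)

Section RealHahnBanach.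
Variables (R : realType) (V : lmodType R) (p : V -> R).
Hypothesis pD : forall x y, p (x + y) <= p x + p y.
Hypothesis pZ : forall (r : R) x, 0 <= r -> p (r *: x) = r * p x.

(** Partial functionals are represented by their graphs, for which the union of
    a chain is immediate. That the graph is functional is not part of the
    definition: it follows from the bound by [p]. *)
Let dominated_graph (A : set (V * R)) :=
  [/\ A (0, 0), forall (c : R) x y, A x -> A y -> A (c *: x.1 + y.1, c * x.2 + y.2) &
     forall x, A x -> x.2 <= p x.1].

Let graphZ A (c : R) x : dominated_graph A -> A x -> A (c *: x.1, c * x.2).
Proof. by move=> [A0 Al _] Ax; have := Al c _ _ Ax A0; rewrite /= !addr0. Qed.

(** The new value [a] at [v] has to lie above all [r - p (x - v)] and below all
    [p (x + v) - r], for [(x, r)] in the graph. *)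
Let graph_extend A v : dominated_graph A -> exists B,
  [/\ dominated_graph B, A `<=` B & exists a, B (v, a)].
Proof.
move=> Ad; have [A0 Al Ap] := Ad.
pose L := [set x.2 - p (x.1 - v) | x in A].
have LU x y : A x -> A y -> x.2 - p (x.1 - v) <= p (y.1 + v) - y.2.
  move=> Ax Ay; rewrite lerBrDr addrAC lerBlDr.
  have := Ap _ (Al 1 _ _ Ax Ay); rewrite /= scale1r mul1r => /le_trans; apply.
  rewrite [leRHS]addrC; apply: le_trans (pD _ _).
  by rewrite addrACA addNr addr0.
have hL : has_sup L.
  split; first by exists ((0 : R) - p (0 - v)), (0, 0).
  by exists (p (0 + v) - 0) => _ [x Ax <-]; exact: (LU x (0, 0)).
pose a := sup L.
have La x : A x -> x.2 - p (x.1 - v) <= a.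
  by move=> Ax; apply: sup_upper_bound => //; exists x.
have aU y : A y -> a <= p (y.1 + v) - y.2.
  move=> Ay; apply: ge_sup; first by case: hL.
  by move=> _ [x Ax <-]; exact: LU.
exists [set z | exists x t, A x /\ z = (x.1 + t *: v, x.2 + t * a)]; split.
- split.
  + by exists (0, 0), 0; split=> //=; rewrite scale0r mul0r !addr0.
  + move=> c _ _ [x [t [Ax ->]]] [y [s [Ay ->]]] /=.
    exists (c *: x.1 + y.1, c * x.2 + y.2), (c * t + s); split; first exact: Al.
    rewrite /= !scalerDr scalerDl scalerA !mulrDr mulrDl mulrA.
    by congr pair; rewrite addrACA.
  + move=> _ [x [t [Ax ->]]] /=; have [t0|t0|->] := ltgtP t 0; last first.
    * by rewrite scale0r mul0r !addr0; exact: Ap.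
    * have := aU _ (graphZ t^-1 Ad Ax); rewrite /= -(ler_pM2l t0) mulrBr.
      rewrite -pZ ?(ltW t0)// scalerDr scalerA mulrA divff ?gt_eqF// scale1r mul1r.
      by rewrite lerBrDr addrC.
    * have s0 : 0 < - t by rewrite oppr_gt0.
      have := La _ (graphZ (- t)^-1 Ad Ax); rewrite /= -(ler_pM2l s0) mulrBr.
      rewrite -pZ ?(ltW s0)// scalerBr scalerA mulrA divff ?gt_eqF// scale1r mul1r.
      by rewrite scaleNr opprK mulNr lerBlDr -lerBlDl opprK.
- by move=> x Ax; exists x, 0; rewrite scale0r mul0r !addr0; case: x Ax.
- by exists a, (0, 0), 1; split=> //=; rewrite scale1r mul1r !add0r.
Qed.

Lemma real_hahn_banach (S : lsubspace V) (f : V -> R) :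
  (forall (c : R) x y, S x -> S y -> f (c *: x + y) = c * f x + f y) ->
  (forall x, S x -> f x <= p x) ->
  exists g : V -> R, [/\ forall c x y, g (c *: x + y) = c * g x + g y,
    forall x, g x <= p x & forall x, S x -> g x = f x].
Proof.
move=> fl fp; pose F : set (V * R) := [set z | S z.1 /\ z.2 = f z.1].
have f0 : f 0 = 0.
  have := fl (-1) 0 0 (lsub_0 S) (lsub_0 S).
  by rewrite scaler0 addr0 mulN1r addNr.
have Fd : dominated_graph F.
  split; first by split=> //=; exact: lsub_0.
    move=> c x y [Sx ->] [Sy ->]; split=> /=; first exact: lsub_linear.
    by rewrite fl.
  by move=> x [Sx ->]; exact: fp.
(* The empty chain has the empty union, so emptiness must be tolerated. *)
pose P A := A !=set0 -> dominated_graph A /\ F `<=` A.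
have [A [PA Amax]] : exists A, P A /\ forall B, A `<` B -> ~ P B.
  apply: Zorn_bigcup => C CP Ctot [z [X CX Xz]].
  have CPd Y w : C Y -> Y w -> dominated_graph Y /\ F `<=` Y.
    by move=> CY Yw; apply: (CP _ CY); exists w.
  split; last by apply: subset_trans (CPd _ _ CX Xz).2 (bigcup_sup CX).
  split.
  - by exists X => //; have [[]] := CPd _ _ CX Xz.
  - move=> c x y [Y CY Yx] [Z CZ Zy].
    have [YZ|ZY] := Ctot _ _ CY CZ.
      by exists Z => //; have [[_ Zl _] _] := CPd _ _ CZ Zy; apply: Zl => //; exact: YZ.
    by exists Y => //; have [[_ Yl _] _] := CPd _ _ CY Yx; apply: Yl => //; exact: ZY.
  - by move=> x [Y CY Yx]; have [[_ _ Yp] _] := CPd _ _ CY Yx; exact: Yp.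
have A0 : A !=set0.
  apply/set0P/eqP => A0; apply: (Amax F); last by move=> _; split.
  by rewrite A0; split=> // /(_ (0, 0)); case: Fd => F0 _ _ /(_ F0).
have [Ad FA] := PA A0; have [A00 Al Ap] := Ad.
have /choice[g gA] x : exists r, A (x, r).
  have [B [Bd AB [a Ba]]] := graph_extend x Ad.
  have [BA|nBA] := pselect (B `<=` A); first by exists a; exact: BA.
  by case: (Amax B) => // _; split=> //; exact: subset_trans AB.
have uniq x r s : A (x, r) -> A (x, s) -> r = s.
  have le0 t : A (0, t) -> t <= 0.
    by move=> /Ap /= /le_trans; apply; have := pZ 0 (lexx 0); rewrite scale0r mul0r => ->.
  move=> Ar As; have := Al (-1) _ _ Ar As; rewrite /= scaleN1r addNr mulN1r => A1.
  have := Al (-1) _ _ As Ar; rewrite /= scaleN1r addNr mulN1r => A2.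
  apply/eqP; rewrite eq_le -subr_le0 addrC le0//= -subr_le0 addrC le0//.
exists g; split.
- by move=> c x y; apply: uniq (gA _) _; exact: (Al c _ _ (gA x) (gA y)).
- by move=> x; exact: (Ap _ (gA x)).
- by move=> x Sx; apply: uniq (gA x) _; apply: FA.
Qed.

End RealHahnBanach.

Definition realified (R : realType) (V : lmodType R[i]) : Type := V.

Section Realified.
Variables (R : realType) (V : lmodType R[i]).
HB.instance Definition _ := GRing.Zmodule.on (realified V).

Let scale (r : R) (x : realified V) : realified V := (r%:C%C) *: (x : V).
Let scaleA a b x : scale a (scale b x) = scale (a * b) x.
Proof. by rewrite /scale scalerA rmorphM. Qed.
Let scale1 : left_id 1 scale.
Proof. by move=> x; rewrite /scale rmorph1 scale1r. Qed.
Let scaleDr : right_distributive scale +%R.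
Proof. by move=> a x y; rewrite /scale scalerDr. Qed.
Let scaleDl x : {morph scale^~ x : a b / a + b}.
Proof. by move=> a b; rewrite /scale rmorphD scalerDl. Qed.

HB.instance Definition _ := GRing.Zmodule_isLmodule.Build R (realified V)
  scaleA scale1 scaleDr scaleDl.

End Realified.

(** In the complex case the real part of [f] is extended to a real functional
    [g], which is the real part of the complex functional
    [x |-> g x - i g (i x)]. Multiplying [x] by a scalar of modulus one makes
    the value of the latter real, hence bounded by the bound of [g]. *)
Lemma hahn_banach (R : realType) (k : scalar_kind) (V : normedModType (scalars R k))
    (S : lsubspace V) (f : V -> scalars R k) (M : scalars R k) : 0 <= M ->
  (forall c x y, S x -> S y -> f (c *: x + y) = c * f x + f y) ->
  (forall x, S x -> `|f x| <= M * `|x|) ->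
  exists g : V -> scalars R k, [/\ linear (g : V -> (scalars R k)^o),
    forall x, `|g x| <= M * `|x| & forall x, S x -> g x = f x].
Proof.
case: k V S f M => /= V S f M M0 fl fM.
  have [x y|r x r0|x Sx|g [gl gM gf]] := @real_hahn_banach R V (fun x => M * `|x|) _ _ S f fl _.
  - by rewrite -mulrDr ler_wpM2l// ler_normD.
  - by rewrite normrZ ger0_norm// mulrCA.
  - by rewrite (le_trans (ler_norm _))// fM.
  exists g; split=> // x; rewrite ler_norml gM andbT.
  have := gM (- x); rewrite normrN -[- x]addr0 -scaleN1r gl mulN1r.
  have g0 : g 0 = 0 by have := gl (-1) 0 0; rewrite scaler0 addr0 mulN1r addNr.
  by rewrite g0 addr0 lerNl.
pose V' : lmodType R := realified V; pose m := complex.Re M.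
have mE : M = m%:C%C by rewrite RRe_real// ger0_real.
pose n (x : V') : R := complex.Re `|x : V|.
have nE (x : V) : `|x| = (n x)%:C%C by rewrite RRe_real// normr_real.
have m0 : 0 <= m by rewrite -ler0c -mE.
have n0 (x : V) : 0 <= n x by rewrite -ler0c -nE.
have S'P (c : R) (x y : V') : S x -> S y -> S (c *: x + y : V').
  by move=> Sx Sy; exact: (lsub_linear c%:C%C Sx Sy).
pose S' : lsubspace V' := @Subspace R V' S (lsub_0 S) S'P.
have ReD (z w : R[i]) : complex.Re (z + w) = complex.Re z + complex.Re w.
  by case: z w => ? ? [].
have ReZ (c : R) (z : R[i]) : complex.Re (c%:C%C * z) = c * complex.Re z.
  by case: z => a b /=; rewrite mul0r subr0.
have fl' (c : R) (x y : V') : S' x -> S' y ->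
    complex.Re (f (c *: x + y)) = c * complex.Re (f x) + complex.Re (f y).
  by move=> Sx Sy; rewrite [f _](fl c%:C%C x y Sx Sy) ReD ReZ.
have [x y|c x c0|x Sx|g [gl gM gf]] :=
    @real_hahn_banach R V' (fun x => m * n x) _ _ S' (fun x => complex.Re (f x)) fl' _.
- rewrite -mulrDr ler_wpM2l//.
  by have := ler_normD (x : V) y; rewrite !nE -rmorphD lecR.
- rewrite mulrCA; congr (_ * _).
  have h := normrZ c%:C%C (x : V).
  rewrite normc_real (ger0_norm c0) [LHS]nE [in RHS]nE -rmorphM in h.
  exact: (complexI h).
- have := fM x Sx; rewrite mE nE -rmorphM normc_def lecR => /(le_trans _); apply.
  by rewrite (le_trans (ler_norm _))// -sqrtr_sqr ler_wsqrtr// lerDl sqr_ge0.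
have g0 : g 0 = 0.
  by have := gl (-1) 0 0; rewrite scaler0 addr0 mulN1r addNr.
have gD (x y : V) : g (x + y) = g x + g y.
  by have := gl 1 x y; rewrite scale1r mul1r.
have gZ (c : R) (x : V) : g (c%:C%C *: x) = c * g x.
  by have := gl c x 0; rewrite !addr0 g0 addr0.
have gN (x : V) : g (- x) = - g x.
  by have := gZ (-1) x; rewrite rmorphN1 scaleN1r mulN1r.
pose G (x : V) : R[i] := (g x +i* - g ('i%C *: x))%C.
have Gi (x : V) : G ('i%C *: x) = 'i%C * G x.
  rewrite /G scalerA -expr2 sqr_i scaleN1r gN.
  by congr Complex; rewrite /= ?mul0r ?mul1r ?sub0r ?add0r ?opprK ?mulrN ?addr0.
have GD (x y : V) : G (x + y) = G x + G y.
  by rewrite /G scalerDr !gD opprD.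
have GZr (c : R) (x : V) : G (c%:C%C *: x) = c%:C%C * G x.
  rewrite /G gZ scalerA [_ * c%:C%C]mulrC -scalerA gZ.
  by congr Complex; rewrite /= ?mul0r ?subr0 ?addr0 ?mulrN.
have GZ (c : R[i]) (x : V) : G (c *: x) = c * G x.
  rewrite {1}(complexE c) scalerDl GD GZr -scalerA Gi GZr mulrA -mulrDl.
  by rewrite -complexE.
exists G; split.
- by move=> c x y; rewrite GD GZ.
- move=> x; have [->|Gx0] := eqVneq (G x) 0; first by rewrite normr0 mulr_ge0.
  pose t := `|G x| / G x.
  have t1 : `|t| = 1 by rewrite normrM normfV normr_id divff ?normr_eq0.
  have Gt : G (t *: x) = `|G x| by rewrite GZ divfK.
  have -> : `|G x| = (g (t *: x))%:C%C.
    by rewrite -Gt -[LHS]RRe_real// Gt normr_real.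
  have -> : `|x| = `|t *: x| by rewrite normrZ t1 mul1r.
  by rewrite mE nE -rmorphM lecR.
- move=> x Sx; have Six : S ('i%C *: x).
    by rewrite -[X in S X]addr0; apply: lsub_linear => //; exact: lsub_0.
  have fi : f ('i%C *: x) = 'i%C * f x.
    have f0 : f 0 = 0.
      have := fl (-1) 0 0 (lsub_0 S) (lsub_0 S).
      by rewrite scaler0 addr0 mulN1r addNr.
    by have := fl 'i%C x 0 Sx (lsub_0 S); rewrite !addr0 f0 addr0.
  rewrite /G gf// gf// fi; case: (f x) => a b /=.
  by rewrite mul0r mul1r sub0r opprK.
Qed.

(** * Tensor products are right exact *)

Section TensorFacts.
Variables (K : fieldType) (A : algebra K) (X : right_module A).

Lemma tsum_cat (M : left_module A) (s t : seq (X * M)) :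
  tsum (s ++ t) = tsum s + tsum t.
Proof.
apply/tsumP/teq_sym; apply: teq_cat; apply/tsumP; exact: tsum_repr.
Qed.

Lemma tsum0 (M : left_module A) : tsum [::] = 0 :> tensor X M.
Proof. by []. Qed.

Lemma tsum_cons (M : left_module A) x m (s : seq (X * M)) :
  tsum ((x, m) :: s) = tpure x m + tsum s.
Proof. by rewrite -cat1s tsum_cat. Qed.

Lemma tpureDl (M : left_module A) x y m :
  tpure (x + y) m = tpure x m + tpure y m :> tensor X M.
Proof. by rewrite -tsum_cat; apply/tsumP/teq_Dl. Qed.

Lemma tpureDr (M : left_module A) x m n :
  tpure x (m + n) = tpure x m + tpure x n :> tensor X M.
Proof. by rewrite -tsum_cat; apply/tsumP/teq_Dr. Qed.

Lemma tpureZ (M : left_module A) c x m :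
  tpure (c *: x) m = tpure x (c *: m) :> tensor X M.
Proof. by apply/tsumP/teq_Z. Qed.

Lemma tpure_act (M : left_module A) x a m :
  tpure (ract x a) m = tpure x (lact a m) :> tensor X M.
Proof. by apply/tsumP/teq_act. Qed.

Lemma tpure0l (M : left_module A) m : tpure 0 m = 0 :> tensor X M.
Proof. by apply/tsumP/teq_0. Qed.

Lemma tpure0r (M : left_module A) x : tpure x 0 = 0 :> tensor X M.
Proof. by rewrite -(scale0r (0 : M)) -tpureZ scale0r tpure0l. Qed.

Lemma tpureNr (M : left_module A) x m : tpure x (- m) = - tpure x m :> tensor X M.
Proof. by apply/eqP; rewrite -addr_eq0 -tpureDr addNr tpure0r. Qed.

Lemma tensor_ind (M : left_module A) (P : tensor X M -> Prop) :
  (forall s, P (tsum s)) -> forall u, P u.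
Proof. by move=> Ps u; rewrite -(tsum_repr u). Qed.

Section RightExact.
Variables (M' M M'' : left_module A) (f : M' -> M) (g : M -> M'').
Hypotheses (fh : module_hom f) (gh : module_hom g).
Hypotheses (fg : range f = g @^-1` [set 0]) (gs : range g = setT).

Let D (u : tensor X M) := exists r, u = tsum [seq (p.1, f p.2) | p <- r].

Let D0 : D 0. Proof. by exists [::]. Qed.

Let DD u v : D u -> D v -> D (u + v).
Proof. by move=> [r ->] [s ->]; exists (r ++ s); rewrite map_cat tsum_cat. Qed.

Let Dpure x m : D (tpure x (f m)).
Proof. by exists [:: (x, m)]. Qed.

Let DN u : D u -> D (- u).
Proof.
move=> [r ->]; exists [seq (p.1, - p.2) | p <- r].
elim: r => [|[x m] r IH] /=; first by rewrite oppr0.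
by rewrite !tsum_cons opprD IH (linN fh.1) tpureNr.
Qed.

(** Choose preimages [h m] under [g]. Each relation of the tensor product over
    [M''] is satisfied by the [h m] up to tensors coming from [M'], because the
    defects of additivity and equivariance of [h] are in the kernel of [g]. *)
Lemma tensor_map_exact :
  range (tensor_map (X := X) f) = tensor_map (X := X) g @^-1` [set 0].
Proof.
have gf m : g (f m) = 0.
  have : range f (f m) by exists m.
  by rewrite fg.
have kerg m : g m = 0 -> exists n, m = f n.
  move=> gm; have : range f m by rewrite fg.
  by move=> [n _ <-]; exists n.
have [gl gA] := gh.
have [[gB gD] gZ] := (linB gl, linD gl, linZ gl).
have /choice[h hK] m : exists n, g n = m.
  have : range g m by rewrite gs.
  by move=> [n _ <-]; exists n.
have hD (s t : seq (X * M'')) : teq s t ->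
    D (tsum [seq (p.1, h p.2) | p <- s] - tsum [seq (p.1, h p.2) | p <- t]).
  elim=> {s t}.
  - by move=> s; rewrite subrr.
  - by move=> s t _ /DN; rewrite opprB.
  - by move=> s t u _ st _ tu; rewrite -(subrKA (tsum [seq (p.1, h p.2) | p <- t])); exact: DD.
  - move=> s s' t t' _ ss _ tt; rewrite !map_cat !tsum_cat opprD addrACA; exact: DD.
  - by move=> s t; rewrite !map_cat !tsum_cat [X in X - _]addrC subrr.
  - by move=> m /=; rewrite subr0 -/(tpure _ _) tpure0l.
  - move=> x y m /=; rewrite !tsum_cons !tsum0 !addr0 tpureDl subrr; exact: D0.
  - move=> x m n /=; rewrite !tsum_cons !tsum0 !addr0 -tpureDr -tpureNr -tpureDr.
    have [|p ->] := kerg (h (m + n) - (h m + h n)); last exact: Dpure.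
    by rewrite gB gD !hK subrr.
  - move=> c x m /=; rewrite !tsum_cons !tsum0 !addr0 tpureZ -tpureNr -tpureDr.
    have [|p ->] := kerg (c *: h m - h (c *: m)); last exact: Dpure.
    by rewrite gB gZ !hK subrr.
  - move=> x a m /=; rewrite !tsum_cons !tsum0 !addr0 tpure_act -tpureNr -tpureDr.
    have [|p ->] := kerg (lact a (h m) - h (lact a m)); last exact: Dpure.
    by rewrite gB gA !hK subrr.
apply/seteqP; split.
  move=> _ [u _ <-]; elim/tensor_ind: u => s.
  rewrite /= tensor_mapE// tensor_mapE//; elim: s => [//|[x m] s IH] /=.
  by rewrite tsum_cons IH gf tpure0r addr0.
move=> u; elim/tensor_ind: u => s; rewrite /= tensor_mapE// => /tsumP/hD.
rewrite subr0 -map_comp /= => gu.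
have [r rP] : D (tsum s).
  rewrite -(subrK (tsum [seq (p.1, h (g p.2)) | p <- s]) (tsum s)); apply: DD => //.
  elim: s {gu} => [|[x m] s IH] /=; first by rewrite subrr.
  rewrite !tsum_cons opprD addrACA; apply: DD => //.
  rewrite -tpureNr -tpureDr.
  by have [|p ->] := kerg (m - h (g m)); [rewrite gB hK subrr|exact: Dpure].
by exists (tsum r); rewrite ?tensor_mapE.
Qed.

Lemma tensor_map_surjective : range (tensor_map (X := X) g) = setT.
Proof.
apply/seteqP; split=> // u _; elim/tensor_ind: u; elim=> [|[x m] s [v _ vs]].
  by exists (tsum [::]); rewrite ?tensor_mapE.
have : range g m by rewrite gs.
move=> [n _ gn]; elim/tensor_ind: v vs => r; rewrite tensor_mapE// => rs.
exists (tsum ((x, n) :: r)); rewrite ?tensor_mapE//= tsum_cons rs gn -tsum_cons.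
by [].
Qed.

End RightExact.
End TensorFacts.

(** * A criterion for universal flatness *)

Section Criterion.
Variables (K : fieldType) (A : algebra K).

Definition common_left_factors := forall a b : A, exists z c d,
  a = amul z c /\ b = amul z d.

Definition annihilating_left_factors := forall (z : A) (ys : seq A),
  (forall y, y \in ys -> amul z y = 0) ->
  exists z' w, z = amul z' w /\ forall y, y \in ys -> amul w y = 0.

Hypotheses (Af : common_left_factors) (An : annihilating_left_factors).

Variables (B : algebra K) (j : A -> B).
Hypotheses (je : algebra_embedding j) (jI : right_ideal (range j)).
Variable M : left_module B.
Local Notation X := (ideal_module je jI).

Let ev (d : seq (A * M)) : M := \sum_(p <- d) lact (j p.1) p.2.
Let lft (z : A) (d : seq (A * M)) : seq (X * M) := [seq (amul z p.1, p.2) | p <- d].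

(** The explicit description of the tensor relation: [s] and [t] have a common
    left factor after the removal of which they have the same value in [M]. *)
Let R (s t : seq (X * M)) := exists z ds dt,
  [/\ s = lft z ds, t = lft z dt & ev ds = ev dt].

Let mull w (d : seq (A * M)) := [seq (amul w p.1, p.2) | p <- d].

Let lft_mull z w d : lft (amul z w) d = lft z (mull w d).
Proof. by rewrite /lft /mull -map_comp; apply: eq_map => p /=; rewrite amulA. Qed.

Let ev_mull w d : ev (mull w d) = lact (j w) (ev d).
Proof.
rewrite /ev big_map.
have lw := lact_linearr (l := M) (j w).
elim: d => [|p d IH]; first by rewrite !big_nil (lin0 lw).
by rewrite !big_cons (linD lw) IH; have [_ -> _] := je; rewrite lactM.
Qed.

Let factor (s : seq (X * M)) : exists z d, s = lft z d.
Proof.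
elim: s => [|[x m] s [z [d ->]]]; first by exists 0, [::].
have [z' [c [w [xz zw]]]] := Af x z.
by exists z', ((c, m) :: mull w d); rewrite /= zw lft_mull xz.
Qed.

(** Two ways to write the same formal sum with the left factor [z] differ by
    elements annihilated by [z]; a smaller left factor makes them agree. This is
    what makes [R] transitive. *)
Let lft_inj z d d' : lft z d = lft z d' ->
  exists z' w, z = amul z' w /\ mull w d = mull w d'.
Proof.
move=> dd; pose ys := [seq p.1.1 - p.2.1 | p <- zip d d'].
have amulB (a b c : A) : amul a (b - c) = amul a b - amul a c :=
  linB (amul_linearr a) b c.
have sz : size d = size d' by have := congr1 size dd; rewrite !size_map.
have zy y : y \in ys -> amul z y = 0.
  move=> /mapP[p pd ->]; rewrite amulB; apply/eqP; rewrite subr_eq0; apply/eqP.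
  elim: d d' sz dd pd {ys} => [|q d IH] [|q' d']//= [sz] [q1 q2 dd].
  by rewrite inE => /predU1P[->//|]; exact: IH.
have [z' [w [zw wy]]] := An zy; exists z', w; split=> //.
have {}wy : forall y, y \in ys -> amul w y = 0 by [].
elim: d d' sz dd @ys zy wy => [|[q m] d IH] [|[q' m'] d']//= [sz] [q1 -> dd] zy wy.
congr ((_, _) :: _).
  apply/eqP; rewrite -subr_eq0 -amulB; apply/eqP; apply: wy.
  by rewrite inE eqxx.
apply: IH => // y yd; [apply: zy|apply: wy]; by rewrite inE yd orbT.
Qed.

Let teq_R s t : teq s t -> R s t.
Proof.
have [jl jM ji] := je.
have [[j0 jD] jZ] := (lin0 jl, linD jl, linZ jl).
have amul0 (a : A) : amul a 0 = 0 := lin0 (amul_linearr a).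
have amulD (a : A) := linD (amul_linearr a).
have amulZ (a : A) := linZ (amul_linearr a).
have lact0l (m : M) : lact 0 m = 0 := lin0 (lact_linearl m).
have lactDl (m : M) a b : lact (a + b) m = lact a m + lact b m :=
  linD (lact_linearl m) a b.
have lactZl c (m : M) a : lact (c *: a) m = c *: lact a m :=
  linZ (lact_linearl m) c a.
have lactDr (a : B) := linD (lact_linearr (l := M) a).
have lactZr (a : B) := linZ (lact_linearr (l := M) a).
have evcat d d' : ev (d ++ d') = ev d + ev d' by rewrite /ev big_cat.
have ev1 a m : ev [:: (a, m)] = lact (j a) m by rewrite /ev big_seq1.
have ev0 : ev [::] = 0 by rewrite /ev big_nil.
have evS a m d : ev ((a, m) :: d) = lact (j a) m + ev d by rewrite /ev big_cons.
have fact1 (x : A) : exists z c, x = amul z c.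
  by have [z [c [_ [xz _]]]] := Af x x; exists z, c.
elim=> {s t}.
- by move=> s; have [z [d ->]] := factor s; exists z, d, d.
- by move=> s t _ [z [ds [dt [-> -> e]]]]; exists z, dt, ds.
- move=> s t u _ [z1 [ds [dt [-> tE e1]]]] _ [z2 [dt' [du [tE' -> e2]]]].
  have [z [w1 [w2 [z1E z2E]]]] := Af z1 z2.
  have [|z' [w [zE wdt]]] := @lft_inj z (mull w1 dt) (mull w2 dt').
    by rewrite -!lft_mull -z1E -z2E -tE.
  exists z', (mull w (mull w1 ds)), (mull w (mull w2 du)); split.
  + by rewrite -!lft_mull -zE -z1E.
  + by rewrite -!lft_mull -zE -z2E.
  + by rewrite ev_mull ev_mull e1 -!ev_mull wdt !ev_mull e2.
- move=> s s' t t' _ [z1 [ds [ds' [-> -> e1]]]] _ [z2 [dt [dt' [-> -> e2]]]].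
  have [z [w1 [w2 [z1E z2E]]]] := Af z1 z2.
  exists z, (mull w1 ds ++ mull w2 dt), (mull w1 ds' ++ mull w2 dt'); split.
  + by rewrite /lft map_cat -!/(lft _ _) -!lft_mull -z1E -z2E.
  + by rewrite /lft map_cat -!/(lft _ _) -!lft_mull -z1E -z2E.
  + by rewrite !evcat !ev_mull e1 e2.
- move=> s t; have [z [d sd]] := factor s; have [z' [d' td]] := factor t.
  have [y [w [w' [zw zw']]]] := Af z z'.
  exists y, (mull w d ++ mull w' d'), (mull w' d' ++ mull w d).
  by rewrite /lft !map_cat -!/(lft _ _) -!lft_mull -zw -zw' -sd -td !evcat addrC.
- move=> m; exists 0, [:: (0, m)], [::]; rewrite ev1 j0 lact0l /ev big_nil.
  by rewrite /= amul0.
- move=> x y m; have [z [c [d [-> ->]]]] := Af x y.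
  exists z, [:: (c + d, m)], [:: (c, m); (d, m)]; rewrite /= amulD ev1.
  by rewrite !evS ev0 addr0 jD lactDl.
- move=> x m n; have [z [c ->]] := fact1 x.
  exists z, [:: (c, m + n)], [:: (c, m); (c, n)]; rewrite /= ev1.
  by rewrite !evS ev0 addr0 lactDr.
- move=> c x m; have [z [d ->]] := fact1 x.
  exists z, [:: (c *: d, m)], [:: (d, c *: m)]; rewrite /= amulZ !ev1.
  by rewrite jZ lactZl lactZr.
- move=> x b m; have [z [c ->]] := fact1 x.
  exists z, [:: (ideal_act jI c b, m)], [:: (c, lact b m)]; rewrite !ev1 ideal_actE lactM.
  split=> //=; congr [:: (_, _)]; apply: ji.
  by rewrite [LHS]ideal_actE !jM ideal_actE amulA.
Qed.

Let tsum_lft z d : tsum (lft z d) = tpure (z : X) (ev d).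
Proof.
have [jl jM ji] := je.
elim: d => [|[c m] d IH]; first by rewrite /ev big_nil tpure0r.
rewrite /= tsum_cons IH /ev big_cons tpureDr; congr (_ + _).
rewrite -tpure_act; congr tpure; apply: ji.
by rewrite [RHS]ideal_actE jM.
Qed.

Lemma ideal_tensor_criterion (s t : seq (X * M)) : tsum s = tsum t <->
  exists z (ds dt : seq (A * M)), [/\ s = [seq (amul z p.1, p.2) | p <- ds],
    t = [seq (amul z p.1, p.2) | p <- dt] &
    \sum_(p <- ds) lact (j p.1) p.2 = \sum_(p <- dt) lact (j p.1) p.2].
Proof.
split=> [/tsumP/teq_R//|[z [ds [dt [-> -> e]]]]].
by rewrite -!/(lft z _) !tsum_lft /ev e.
Qed.

End Criterion.

(** The criterion only involves the vanishing of an element of [M'], which an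
    injective [f] reflects. *)
Lemma right_universally_flatI (K : fieldType) (A : algebra K) :
  common_left_factors A -> annihilating_left_factors A -> right_universally_flat A.
Proof.
move=> Af An B j je jI M' M M'' f g fh gh [fi fg gs].
split; [|exact: tensor_map_exact|exact: tensor_map_surjective].
have [fl fA] := fh.
have lift z (s : seq (ideal_module je jI * M')) (d : seq (A * M)) :
    [seq (p.1, f p.2) | p <- s] = [seq (amul z p.1, p.2) | p <- d] ->
    exists d', s = [seq (amul z p.1, p.2) | p <- d'] /\
      \sum_(p <- d) lact (j p.1) p.2 = f (\sum_(p <- d') lact (j p.1) p.2).
  elim: s d => [|[x m] s IH] [|[c n] d]//=.
    by exists [::]; rewrite !big_nil (lin0 fl).
  move=> [-> <- /IH[d' [-> e]]]; exists ((c, m) :: d'); split=> //.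
  by rewrite !big_cons e (linD fl) fA.
elim/tensor_ind=> s; elim/tensor_ind=> t; rewrite !tensor_mapE//.
move=> /(ideal_tensor_criterion Af An)[z [ds [dt [/lift[d [-> e]] /lift[d' [-> e']] ee]]]].
apply/(ideal_tensor_criterion Af An); exists z, d, d'; split=> //.
by apply: fi; rewrite -e -e'.
Qed.

(** [A] is a right ideal of itself. *)
Lemma right_universally_flat_flat (K : fieldType) (A : algebra K) :
  right_universally_flat A -> right_flat A.
Proof.
move=> /(_ A id) Auf.
have je : algebra_embedding (id : A -> A) by split.
have jI : right_ideal (range (id : A -> A)).
  by split=> [|c x y _ _|x b _]; [exists 0|exists (c *: x + y)|exists (amul x b)].
rewrite /right_flat; suff -> : regular_module A = ideal_module je jI by exact: Auf.
have actE : (fun x b => amul x b) = ideal_act jI.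
  by apply/funext => x; apply/funext => b; have := ideal_actE jI x b.
have mod_eq (V : lmodType K) (r r' : V -> A -> V) (rr' : r = r') rM rl rr rM' rl' rm' :
    @RightModule K A V r rM rl rr = @RightModule K A V r' rM' rl' rm'.
  by case: r' / rr' rM' rl' rm' => *; congr RightModule; exact: Prop_irrelevance.
exact: mod_eq.
Qed.

(** * The equational consequence of flatness *)

Section Quotient.
Variables (K : fieldType) (V : lmodType K) (S : lsubspace V).

Let SD x y : S x -> S y -> S (x + y).
Proof. by move=> Sx Sy; have := lsub_linear 1 Sx Sy; rewrite scale1r. Qed.

Let SZ c x : S x -> S (c *: x).
Proof. by move=> Sx; have := lsub_linear c Sx (lsub_0 S); rewrite addr0. Qed.

Let SN x : S x -> S (- x).
Proof. by move=> /(SZ (-1)); rewrite scaleN1r. Qed.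

(** Quotients are realised on canonical representatives of the cosets. *)
Definition coset_rep (x : V) : V := xget 0 [set z | S (x - z)].

Lemma coset_repP x : S (x - coset_rep x).
Proof.
rewrite /coset_rep; case: xgetP => [y _ //|/(_ x)[]] /=.
by rewrite subrr; exact: lsub_0.
Qed.

Lemma coset_rep_eq x y : S (x - y) -> coset_rep x = coset_rep y.
Proof.
move=> xy; congr xget; apply/seteqP; split=> z /= xz.
  by rewrite -(subrKA x) addrC; apply: SD => //; rewrite -opprB; exact: SN.
by rewrite -(subrKA y); exact: SD.
Qed.

Definition quot := {x : V | coset_rep x == x}.

HB.instance Definition _ := SubChoice.on quot.

Fact coset_rep_idem x : coset_rep (coset_rep x) == coset_rep x.
Proof. by apply/eqP/esym/coset_rep_eq/coset_repP. Qed.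

Definition quot_proj (x : V) : quot :=
  exist (fun x => coset_rep x == x) (coset_rep x) (coset_rep_idem x).

Lemma quot_projK (q : quot) : quot_proj (val q) = q.
Proof. by apply: val_inj => /=; apply/eqP; exact: (valP q). Qed.

Lemma quot_proj_eq x y : S (x - y) -> quot_proj x = quot_proj y.
Proof. by move=> xy; apply: val_inj; exact: coset_rep_eq. Qed.

Lemma quot_proj_inj x y : quot_proj x = quot_proj y -> S (x - y).
Proof.
move=> /(congr1 val)/= xy; rewrite -(subrKA (coset_rep x)); apply: SD.
  exact: coset_repP.
by rewrite xy -opprB; apply: SN; exact: coset_repP.
Qed.

Let val_proj x : S (val (quot_proj x) - x).
Proof. by rewrite -opprB; apply: SN; exact: coset_repP. Qed.

Definition quot_add (p q : quot) := quot_proj (val p + val q).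
Definition quot_scale c (p : quot) := quot_proj (c *: val p).

Let addE x y : quot_add (quot_proj x) (quot_proj y) = quot_proj (x + y).
Proof.
apply: quot_proj_eq; rewrite opprD addrACA.
by apply: SD; exact: val_proj.
Qed.

Let scaleE c x : quot_scale c (quot_proj x) = quot_proj (c *: x).
Proof. by apply: quot_proj_eq; rewrite -scalerBr; apply: SZ; exact: val_proj. Qed.

Let ind (P : quot -> Prop) : (forall x, P (quot_proj x)) -> forall q, P q.
Proof. by move=> Pq q; rewrite -(quot_projK q). Qed.

Let quot_addA : associative quot_add.
Proof. by elim/ind=> x; elim/ind=> y; elim/ind=> z; rewrite !addE addrA. Qed.

Let quot_addC : commutative quot_add.
Proof. by elim/ind=> x; elim/ind=> y; rewrite !addE addrC. Qed.

Let quot_add0 : left_id (quot_proj 0) quot_add.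
Proof. by elim/ind=> x; rewrite addE add0r. Qed.

Let quot_addN : left_inverse (quot_proj 0) (quot_scale (-1)) quot_add.
Proof. by elim/ind=> x; rewrite scaleE addE scaleN1r addNr. Qed.

HB.instance Definition _ := GRing.isZmodule.Build quot
  quot_addA quot_addC quot_add0 quot_addN.

Let quot_scaleA a b (p : quot) : quot_scale a (quot_scale b p) = quot_scale (a * b) p.
Proof. by elim/ind: p => x; rewrite !scaleE scalerA. Qed.

Let quot_scale1 : left_id 1 quot_scale.
Proof. by elim/ind=> x; rewrite scaleE scale1r. Qed.

Let quot_scaleDr : right_distributive quot_scale +%R.
Proof.
move=> c; elim/ind=> x; elim/ind=> y.
by rewrite [_ + _]addE !scaleE [RHS]addE scalerDr.
Qed.

Let quot_scaleDl (p : quot) : {morph quot_scale^~ p : a b / a + b}.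
Proof.
by move=> a b; elim/ind: p => x; rewrite !scaleE [RHS]addE scalerDl.
Qed.

HB.instance Definition _ := GRing.Zmodule_isLmodule.Build K quot
  quot_scaleA quot_scale1 quot_scaleDr quot_scaleDl.

Lemma quot_proj_linear : linear quot_proj.
Proof. by move=> c x y; rewrite -addE -scaleE. Qed.

End Quotient.

Section ModuleConstructions.
Variables (K : fieldType) (A : algebra K) (M : left_module A) (S : lsubspace M).
Hypothesis SA : forall a m, S m -> S (lact a m).

Let lact_sub_mem a (m : lsub_type S) : lact a (val m) \in sub_pred S.
Proof. by apply/asboolP/SA/asboolP; case: m => m Sm; exact: Sm. Qed.

Let lact_sub a (m : lsub_type S) : lsub_type S := Sub (lact a (val m)) (lact_sub_mem a m).

Let lact_subM a b m : lact_sub (amul a b) m = lact_sub a (lact_sub b m).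
Proof. by apply: val_inj; rewrite /= lactM. Qed.

Let lact_sub_linearl m : linear (lact_sub^~ m).
Proof. by move=> c a b; apply: val_inj; rewrite /= lact_linearl. Qed.

Let lact_sub_linearr a : linear (lact_sub a).
Proof. by move=> c m n; apply: val_inj; rewrite /= lact_linearr. Qed.

Definition submodule : left_module A :=
  LeftModule lact_subM lact_sub_linearl lact_sub_linearr.

Lemma submodule_inc_hom : module_hom (val : submodule -> M).
Proof. by split. Qed.

Lemma submodule_mem (m : submodule) : S (val m).
Proof. by case: m => m Sm /=; apply/asboolP; exact: Sm. Qed.

Lemma submodule_lift m : S m -> exists n : submodule, val n = m.
Proof. by move=> Sm; exists (Sub m (asboolT Sm)). Qed.

Let lact_quot a (q : quot S) : quot S := quot_proj S (lact a (val q)).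

Let lact_quotE a m : lact_quot a (quot_proj S m) = quot_proj S (lact a m).
Proof.
apply: quot_proj_eq.
rewrite -(linB (lact_linearr (l := M) a)); apply: SA; apply: quot_proj_inj; exact: quot_projK.
Qed.

Let lact_quotM a b m : lact_quot (amul a b) m = lact_quot a (lact_quot b m).
Proof. by rewrite -(quot_projK m) !lact_quotE lactM. Qed.

Let lact_quot_linearl m : linear (lact_quot^~ m).
Proof.
by move=> c a b; rewrite -(quot_projK m) !lact_quotE lact_linearl quot_proj_linear.
Qed.

Let lact_quot_linearr a : linear (lact_quot a).
Proof.
move=> c m n; rewrite -(quot_projK m) -(quot_projK n) -quot_proj_linear !lact_quotE.
by rewrite lact_linearr quot_proj_linear.
Qed.

Definition quotient_module : left_module A :=
  LeftModule lact_quotM lact_quot_linearl lact_quot_linearr.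

Lemma quotient_proj_hom : module_hom (quot_proj S : M -> quotient_module).
Proof. by split=> [|a m]; [exact: quot_proj_linear|rewrite [RHS]lact_quotE]. Qed.

Lemma quotient_short_exact :
  short_exact (val : submodule -> M) (quot_proj S : M -> quotient_module).
Proof.
split; first exact: val_inj.
  apply/seteqP; split=> [_ [m _ <-]|m /= /(quot_proj_inj (y := 0))].
    by apply: quot_proj_eq; rewrite subr0; exact: submodule_mem.
  by rewrite subr0 => /submodule_lift[n <-]; exists n.
by apply/seteqP; split=> // q _; exists (val q) => //; exact: quot_projK.
Qed.

End ModuleConstructions.

Section Unitization.
Variables (K : fieldType) (A : algebra K).
Local Notation U := (K^o * A)%type.

Let amulr0 (a : A) : amul a 0 = 0.
Proof. exact: (lin0 (amul_linearr a)). Qed.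

Let amulrD (a b c : A) : amul a (b + c) = amul a b + amul a c.
Proof. exact: (linD (amul_linearr a)). Qed.

Let amulrZ c (a b : A) : amul a (c *: b) = c *: amul a b.
Proof. exact: (linZ (amul_linearr a)). Qed.

Let amul0r (a : A) : amul 0 a = 0.
Proof. exact: (lin0 (amul_linearl a)). Qed.

Let amulDr (a b c : A) : amul (b + c) a = amul b a + amul c a.
Proof. exact: (linD (amul_linearl a)). Qed.

Let amulZr c (a b : A) : amul (c *: b) a = c *: amul b a.
Proof. exact: (linZ (amul_linearl a)). Qed.

(** [U] is the underlying space of the unitization of [A], in which [A] is an
    ideal; these are the products of its elements with those of [A]. *)
Definition uact (a : A) (u : U) : A := u.1 *: a + amul a u.2.
Definition uactr (u : U) (a : A) : A := u.1 *: a + amul u.2 a.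

Let uact_left a (u : U) : U := (0, uact a u).

Let uact_leftM a b u : uact_left (amul a b) u = uact_left a (uact_left b u).
Proof.
congr pair; rewrite /uact /= scale0r add0r amulrD amulrZ.
by rewrite amulA.
Qed.

Let uact_left_linearl u : linear (uact_left^~ u).
Proof.
move=> c a b; congr pair; first by rewrite addr0 [RHS]mulr0.
rewrite /uact /=.
rewrite amulDr amulZr !scalerDr addrACA; congr (_ + _ + _).
by rewrite !scalerA mulrC.
Qed.

Let uact_left_linearr a : linear (uact_left a).
Proof.
move=> c u v; congr pair; first by rewrite addr0 [RHS]mulr0.
rewrite /uact /=.
by rewrite amulrD amulrZ !scalerDr scalerDl -scalerA addrACA.
Qed.

Definition unitization : left_module A :=
  LeftModule uact_leftM uact_left_linearl uact_left_linearr.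

Let ev (s : seq (regular_module A * unitization)) : A := \sum_(p <- s) uact p.1 p.2.

Let teq_ev s t : teq s t -> ev s = ev t.
Proof.
rewrite /ev; elim=> {s t}//.
- by move=> s t u _ -> _ ->.
- by move=> s s' t t' _ ss _ tt; rewrite !big_cat/= ss tt.
- by move=> s t; rewrite !big_cat/= addrC.
- by move=> m; rewrite big_seq1 big_nil /uact scaler0 amul0r addr0.
- move=> x y m; rewrite !big_cons !big_nil !addr0 /uact/= scalerDr amulDr.
  by rewrite addrACA.
- move=> x m n; rewrite !big_cons !big_nil !addr0 /uact/= scalerDl amulrD.
  by rewrite addrACA.
- move=> c x m; rewrite !big_seq1 /uact/= amulrZ amulZr !scalerA.
  by rewrite mulrC.
- move=> x a m; rewrite !big_seq1 /uact/= scale0r add0r amulrD amulrZ.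
  by rewrite amulA.
Qed.

(** Let [r] be the right multiplication by [y] on the unitization [U]. The tensor
    of [c] and [y], seen in [A (x) im r], is mapped to that of [c y = 0] and [1]
    in [A (x) U], so it vanishes by flatness of the inclusion of [im r] in [U].
    Exactness for [ker r -> U -> im r] then writes the tensor of [c] and [1] with
    elements of the kernel, and [A (x) U] evaluates into [A]. *)
Lemma right_flat_factor (c y : A) : right_flat A -> amul c y = 0 ->
  exists r : seq (A * U), c = \sum_(p <- r) uact p.1 p.2 /\
    forall p, p \in r -> uactr p.2 y = 0.
Proof.
move=> Afl cy0.
pose r (u : unitization) : unitization := (0, uactr u y).
have rl : linear r.
  move=> a u v; congr pair; first by rewrite addr0 [RHS]mulr0.
  rewrite /uactr /=.
  by rewrite amulDr amulZr !scalerDr scalerDl -scalerA addrACA.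
have rA a u : r (lact a u) = lact a (r u).
  congr pair; rewrite /uactr /uact /= !scale0r !add0r amulDr amulZr amulrD amulrZ.
  by rewrite amulA.
pose ker u := r u = 0; pose im u := range r u.
have ker0 : ker 0 by congr pair; rewrite /uactr /= scale0r amul0r addr0.
have kerP (a : K) u v : ker u -> ker v -> ker (a *: u + v).
  by rewrite /ker rl => -> ->; rewrite scaler0 addr0.
have im0 : im 0 by exists 0.
have imP (a : K) u v : im u -> im v -> im (a *: u + v).
  by move=> [w _ <-] [w' _ <-]; exists (a *: w + w') => //; rewrite rl.
have lact0 a : lact a (0 : unitization) = 0.
  by congr pair; rewrite /uact /= scale0r amulr0 addr0.
have kerA a u : Subspace ker0 kerP u -> Subspace ker0 kerP (lact a u).
  by rewrite /= /ker rA => ->; rewrite lact0.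
have imA a u : Subspace im0 imP u -> Subspace im0 imP (lact a u).
  by move=> [w _ <-]; exists (lact a w) => //; rewrite rA.
pose L := submodule kerA; pose I := submodule imA.
have /choice[p pE] u : exists v : I, val v = r u by apply: submodule_lift; exists u.
have ph : module_hom p.
  split=> [a u v|a u]; apply: val_inj; first by rewrite pE rl /= !pE.
  by rewrite pE rA /= pE.
have Lp : short_exact (val : L -> unitization) p.
  split; first exact: val_inj.
    apply/seteqP; split=> [_ [l _ <-]|u /= pu].
      by apply: val_inj; rewrite pE; exact: (submodule_mem l).
    have [|l <-] := @submodule_lift _ _ _ _ kerA u; last by exists l.
    by rewrite /= /ker -pE pu.
  apply/seteqP; split=> // v _; have [u _ uv] := submodule_mem v.
  by exists u => //; apply: val_inj; rewrite pE.
have [_ LU _] := Afl _ _ _ _ _ (submodule_inc_hom kerA) ph Lp.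
have [IU _ _] := Afl _ _ _ _ _ (submodule_inc_hom imA) (quotient_proj_hom imA)
  (quotient_short_exact imA).
pose X := regular_module A; pose one : unitization := (1, 0).
have : tensor_map (X := X) p (tpure (c : X) one) = 0.
  apply: IU; transitivity (0 : tensor X unitization); last first.
    exact/esym/(tensor_mapE (X := X) [::] (submodule_inc_hom imA)).
  rewrite /tpure (tensor_mapE _ ph) (tensor_mapE _ (submodule_inc_hom imA)) /=.
  have -> : val (p one) = lact y one.
    by rewrite pE; congr pair; rewrite /uactr /uact /= scale1r amulr0 amul0r.
  by rewrite -/(tpure _ _) -tpure_act /= cy0 tpure0l.
have : (tensor_map (X := X) p @^-1` [set 0]) (tpure (c : X) one) =
  range (tensor_map (X := X) (val : L -> unitization)) (tpure (c : X) one) by rewrite LU.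
move=> /= -> [u _]; elim/tensor_ind: u => s.
rewrite tensor_mapE; last exact: submodule_inc_hom.
move=> /tsumP/teq_ev; rewrite /ev big_seq1 /uact /= scale1r amulr0 addr0 => e.
exists [seq (q.1, val q.2) | q <- s]; split; first by rewrite -e.
move=> _ /mapP[q _ ->].
have rq : r (val q.2) = 0 := @submodule_mem _ _ _ _ kerA q.2.
exact: (congr1 snd rq).
Qed.

End Unitization.

(** * Flatness of the algebra of approximable operators *)

Section ProductWithL1.
Context {R : realType} {k : scalar_kind}.
Local Notation K := (scalars R k).

Variable G : nat -> completeNormedModType K.
Hypothesis hG : C1_sequence G.
Variable E : completeNormedModType K.
Local Notation X := (E * l1_sum G)%type.

Lemma X_fast_complete : fast_complete X.
Proof.
by apply: fast_complete_prod; [exact: complete_fast|exact: l1_fast_complete].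
Qed.

Lemma approximable_factor (Z : normedModType K) (T : Z -> X) (S : nat -> Z -> X) :
  (forall n, finite_rank (S n)) ->
  (forall n x, `|T x - S n x| <= 2^-1 ^+ (n + n) * `|x|) ->
  exists (U : X -> X) (V : Z -> X), [/\ approximable_map U, approximable_map V,
    forall x, T x = U (V x) & forall x, (forall n, S n x = 0) -> V x = 0].
Proof.
move=> Sf TS.
have [U [V [Ua Va TUV V0]]] := factor_through_l1 hG X_fast_complete Sf TS.
exists (U \o snd), ((fun y => (0, y)) \o V); split => //.
- exact: approximable_compr (snd_bounded _ _).
- exact: approximable_compl (inr_bounded _ _) _.
- by move=> x Sx; rewrite /= V0.
Qed.

(** Factor the operator that sends [(x, y)] to [a x + b y]. *)
Lemma approx_common_left_factors : common_left_factors (approx_algebra X).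
Proof.
move=> a b.
have aa := (approximableP _).1 (approx_funP a).
have ba := (approximableP _).1 (approx_funP b).
have Ta := approximable_add (approximable_compr aa (fst_bounded X X))
  (approximable_compr ba (snd_bounded X X)).
have /choice[S SP] n := Ta.2 _ (half_exp_gt0 (n + n)).
have [U [V [Ua Va TUV _]]] := approximable_factor (fun n => (SP n).1) (fun n => (SP n).2).
exists (approx_of Ua), (approx_of (approximable_compr Va (inl_bounded X X))),
  (approx_of (approximable_compr Va (inr_bounded X X))).
split; apply: approx_op_eq => x /=; rewrite -TUV /=.
  by rewrite (lin0 ba.1.1) addr0.
by rewrite (lin0 aa.1.1) add0r.
Qed.

(** Factor [z] along its approximations [Q n \o z], which annihilate whatever [z]
    annihilates. *)
Lemma approx_annihilating_left_factors : approximation_property E ->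
  annihilating_left_factors (approx_algebra X).
Proof.
move=> Eap z ys zy.
have Xa : left_approximable X.
  apply: left_approximable_prod; first exact: AP_left_approximable.
  by apply: l1_left_approximable; have [] := hG.
have za := (approximableP _).1 (approx_funP z).
have /choice[Q QP] n := Xa _ _ za _ (half_exp_gt0 (n + n)).
have Sf n := finite_rank_compr (QP n).1 za.1.
have [U [V [Ua Va zUV V0]]] := approximable_factor Sf (fun n => (QP n).2).
exists (approx_of Ua), (approx_of Va); split; first exact: approx_op_eq.
move=> y /zy zy0; apply: approx_op_eq => x /=; apply: V0 => n /=.
have := congr1 (fun T : approx_op X => T x) zy0 => /= ->.
exact: lin0 (QP n).1.1.1.
Qed.

Lemma AP_universally_flat : approximation_property E ->
  right_universally_flat (approx_algebra X).
Proof.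
move=> Eap; apply: right_universally_flatI; first exact: approx_common_left_factors.
exact: approx_annihilating_left_factors.
Qed.

(** Flatness writes [C], extended to [X], as a sum of products [p d] with [p]
    approximable and [d] a sum of a scalar and an approximable operator such that
    [d Y = 0]; replace each [p] by a finite rank operator. *)
Lemma flat_annihilator (C : l1_sum G -> E) (Y : l1_sum G -> l1_sum G) :
  right_flat (approx_algebra X) -> approximable_map C -> approximable_map Y ->
  (forall z, C (Y z) = 0) -> forall e : K, 0 < e ->
  exists F : l1_sum G -> E, [/\ finite_rank F, forall z, F (Y z) = 0 &
    forall z, `|F z - C z| <= e * `|z|].
Proof.
move=> Xfl Ca Ya CY0 e e0.
pose c := approx_of (approximable_compl (inl_bounded E (l1_sum G))
  (approximable_compr Ca (snd_bounded E (l1_sum G)))).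
pose y := approx_of (approximable_compl (inr_bounded E (l1_sum G))
  (approximable_compr Ya (snd_bounded E (l1_sum G)))).
have cy : amul (c : approx_algebra X) y = 0.
  by apply: approx_op_eq => x /=; rewrite CY0.
have [r [cr rP]] := right_flat_factor Xfl cy.
pose d (p : approx_algebra X * (K^o * approx_algebra X)) (x : X) : X :=
  p.2.1 *: x + (p.2.2 : approx_op X) x.
have db p : bounded_operator (d p).
  have [[Tl _] _] := approx_funP p.2.2.
  have [M M0 MP] := bounded_operatorE (approx_funP p.2.2).1.
  apply: (bounded_operatorI (M := `|p.2.1| + M)) => [a u v||x].
  - by rewrite /d Tl !scalerDr !scalerA mulrC addrACA.
  - by rewrite addr_ge0.
  - by rewrite mulrDl (le_trans (ler_normD _ _))// lerD// normrZ.
have crx x : c x = \sum_(p <- r) (p.1 : approx_op X) (d p x).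
  rewrite cr; elim: (r) => [|p s IH]; first by rewrite !big_nil.
  rewrite !big_cons -IH /=; congr (_ + _).
  have [[Tl _] _] := approx_funP p.1.
  by rewrite (linD Tl) (linZ Tl).
have dy p x : p \in r -> d p (y x) = 0.
  by move=> /rP pr; have := congr1 (fun T : approx_op X => T x) pr; exact.
have [F [Ff Fy Fc]] : exists F : X -> X, [/\ finite_rank F, forall x, F (y x) = 0 &
    forall x, `|F x - \sum_(p <- r) (p.1 : approx_op X) (d p x)| <= e * `|x|].
  elim: (r) dy e e0 {cr rP crx} => [|p s IH] dy e e0.
    exists (fun=> 0); split=> //; first exact: finite_rank0.
    by move=> x; rewrite big_nil subrr normr0 mulr_ge0// ltW.
  have e2 : 0 < e / 2 by rewrite divr_gt0.
  have [|F [Ff Fy Fs]] := IH _ _ e2.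
    by move=> q x qs; apply: dy; rewrite inE qs orbT.
  have [M M0 MP] := bounded_operatorE (db p).
  have M1 : 0 < M + 1 by rewrite ltr_wpDl.
  have [_ /(_ _ (divr_gt0 e2 M1))[S [Sf SP]]] := (approximableP _).1 (approx_funP p.1).
  exists (fun x => 1 *: S (d p x) + F x); split.
  - by apply: finite_rank_lin => //; exact: finite_rank_compr Sf (db p).
  - by move=> x; rewrite Fy dy ?inE ?eqxx// (lin0 Sf.1.1) scaler0 addr0.
  - move=> x; rewrite big_cons scale1r opprD addrACA (le_trans (ler_normD _ _))//.
    rewrite [e in leRHS]splitr mulrDl lerD// distrC (le_trans (SP _))//.
    rewrite -[leLHS]mulrA ler_wpM2l ?(ltW e2)// ler_pdivrMl// (le_trans (MP x))//.
    by rewrite ler_wpM2r// lerDl.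
exists (fst \o (F \o (fun z => (0, z)))); split.
- exact: finite_rank_compl (fst_bounded _ _) (finite_rank_compr Ff (inr_bounded _ _)).
- by move=> z /=; have /= -> := Fy (0, z).
- move=> z; have := Fc (0, z); rewrite -crx prod_norm_le => /andP[/= /le_trans + _].
  apply; rewrite ler_wpM2l ?(ltW e0)// prod_norm_le /= normr0 lexx normr_ge0//.
Qed.

End ProductWithL1.

(** * A ladder of finite-dimensional subspaces *)

Section Ladder.
Context {R : realType} {k : scalar_kind}.
Local Notation K := (scalars R k).
Variable G : nat -> completeNormedModType K.
Hypothesis Gfd : forall n, finite_dimensional [set: G n].
Variable E : completeNormedModType K.
Variables (H : nat -> lsubspace E) (i : nat -> nat).
Variables (a : forall n, E -> G (i n)) (b : forall n, G (i n) -> E).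
Arguments a : clear implicits.
Arguments b : clear implicits.
Hypotheses (H_mono : forall n x, H n x -> H n.+1 x) (i_inj : injective i).
Hypothesis mod : forall n, model (H n) (a n) (b n).
Local Notation l1 := (l1_sum G).

Lemma series_limit_eq (V W : normedModType K) (T : V -> W) (w : nat -> V -> W)
    (M : K) x y m : 0 <= M ->
  (forall x n, `|T x - \sum_(j < n) w j x| <= M * `|x| * 2^-1 ^+ n) ->
  (forall n, (m <= n)%N -> \sum_(j < n) w j x = y) -> T x = y.
Proof.
move=> M0 TP wy; apply/eqP; rewrite -subr_eq0 -normr_le0.
apply: (@ler_half_exp _ _ _ _ (M * `|x|)) => // [|n]; first by rewrite mulr_ge0.
rewrite add0r -(wy (n + m)%N) ?leq_addl// (le_trans (TP _ _))//.
by rewrite ler_wpM2l ?mulr_ge0// half_exp_le// leq_addr.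
Qed.

Lemma ladder_sum (V : normedModType K) (f : forall n, G (i n) -> V) m (g : G (i m)) n :
  (forall n, f n 0 = 0) -> (m < n)%N ->
  \sum_(j < n) f j (l1_inj g (i j)) = f m g.
Proof.
move=> f0 mn; rewrite (bigD1 (Ordinal mn))//= l1_inj_in big1 ?addr0// => j jm.
rewrite l1_inj_out ?f0//; apply: contra jm => /eqP/i_inj jm.
by apply/eqP/val_inj.
Qed.

(** The range of [Y] spans the kernel of [C] densely, at least on the closed span
    of the copies of the [H n]: it identifies each [H n] with its image in the
    copy of [H n.+1]. Thus an operator vanishing on the range of [Y] is
    determined, on these copies, by a single linear map on the union of the
    [H n]. *)
Lemma ladder_operators : exists (C : l1 -> E) (Y : l1 -> l1),
  [/\ approximable_map C, approximable_map Y,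
    forall n g, C (l1_inj g) = 2^-1 ^+ n *: b n g,
    forall n g, Y (l1_inj g) = 2^-1 ^+ n *:
      (l1_inj g - 2 *: l1_inj (a n.+1 (b n g))) &
    forall z, C (Y z) = 0].
Proof.
have bb n : bounded_operator (b n).
  have [_ _ bl b1 _] := mod n; apply: (bounded_operatorI bl ler01) => g.
  by rewrite mul1r; have [] := b1 g.
(* The weights make both series converge absolutely. As [C] has the weight
   [2^-n] on the copy of [H n], the factor 2 in [Y] makes up for the change of
   weight from one copy to the next. *)
pose wC n (z : l1) := 2^-1 ^+ n *: b n (z (i n)).
have Cf n : finite_rank (wC n).
  have := fd_finite_rank (@Gfd _) (bounded_scale (2^-1 ^+ n) (bb n)).
  by move=> /finite_rank_compr /(_ (@l1_coord_bounded _ _ G (i n))).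
have [||C [Ca CP]] := @operator_series _ _ _ _ wC 2 (@complete_fast _ _ E) _ Cf.
- by [].
- move=> n y; have [_ _ _ b1 _] := mod n.
  rewrite /wC normrZ ger0_norm ?half_exp_ge0// exprS mulrA divff ?pnatr_eq0// mul1r.
  by rewrite ler_wpM2l ?half_exp_ge0// (le_trans (b1 _).2)// l1_coord_le.
pose y n (g : G (i n)) : l1 := 2^-1 ^+ n *: (l1_inj g - 2 *: l1_inj (a n.+1 (b n g))).
have yl n : linear (y n).
  have [al _ _ _ _] := mod n.+1; have [_ _ bl b1 _] := mod n.
  move=> c g h; rewrite /y l1_inj_linear bl al; last first.
  - by apply: H_mono; have [] := b1 h.
  - by apply: H_mono; have [] := b1 g.
  rewrite l1_inj_linear [2 *: (_ + _)]scalerDr opprD addrACA scalerDr.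
  congr (_ + _); rewrite [2 *: (c *: _)]scalerA [2 * c]mulrC -scalerA -scalerBr.
  by rewrite !scalerA mulrC.
have yM n g : `|y n g| <= 5 * 2^-1 ^+ n * `|g|.
  have [_ a2 _ _ _] := mod n.+1; have [_ _ _ b1 _] := mod n.
  rewrite /y normrZ ger0_norm ?half_exp_ge0// mulrAC [leRHS]mulrC.
  rewrite ler_wpM2l ?half_exp_ge0// (le_trans (ler_normB _ _))//.
  have -> : 5 * `|g| = `|g| + 2 * (2 * `|g|) :> K by ring.
  apply: lerD; first exact: l1_inj_norm.
  rewrite normrZ ger0_norm// ler_wpM2l// (le_trans (l1_inj_norm _))//.
  rewrite (le_trans (a2 _ (H_mono (b1 g).1)))// ler_wpM2l//.
  by have [] := b1 g.
have yb n : bounded_operator (y n).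
  by apply: (bounded_operatorI (yl n) _ (yM n)); rewrite mulr_ge0 ?half_exp_ge0.
pose wY n (z : l1) := y n (z (i n)).
have Yf n : finite_rank (wY n).
  have := fd_finite_rank (@Gfd _) (yb n).
  by move=> /finite_rank_compr /(_ (@l1_coord_bounded _ _ G (i n))).
have [||Y [Ya YP]] := @operator_series _ _ _ _ wY 10 (@l1_fast_complete _ _ G) _ Yf.
- by [].
- move=> n z; rewrite /wY (le_trans (yM _ _))//.
  have -> : 10 * 2^-1 ^+ n.+1 * `|z| = 5 * 2^-1 ^+ n * `|z| :> K by rewrite exprS; field.
  by rewrite ler_wpM2l ?l1_coord_le// mulr_ge0 ?half_exp_ge0.
have Ci n g : C (l1_inj g) = 2^-1 ^+ n *: b n g.
  apply: (series_limit_eq (m := n.+1) _ CP) => // m nm.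
  rewrite /wC (ladder_sum (f := fun j h => 2^-1 ^+ j *: b j h))// => j.
  by have [_ _ bl _ _] := mod j; rewrite (lin0 bl) scaler0.
have Yi n g : Y (l1_inj g) = y n g.
  apply: (series_limit_eq (m := n.+1) _ YP) => // m nm.
  by rewrite /wY ladder_sum// => j; exact: lin0 (yl j).
exists C, Y; split=> // z.
have Cy n g : C (y n g) = 0.
  rewrite /y (linZ Ca.1.1) (linB Ca.1.1) (linZ Ca.1.1) !Ci.
  have [_ _ _ b1 _] := mod n; have [_ _ _ _ ba] := mod n.+1.
  rewrite ba; last by apply: H_mono; have [] := b1 g.
  by rewrite scalerA exprS mulrA divff ?pnatr_eq0// mul1r subrr scaler0.
have [M M0 MP] := bounded_operatorE Ca.1.
apply/eqP; rewrite -normr_le0.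
apply: (@ler_half_exp _ _ _ _ (M * (10 * `|z|))) => // [|n].
  by rewrite !mulr_ge0.
rewrite add0r; have -> : C (Y z) = C (Y z - \sum_(j < n) wY j z).
  by rewrite (linB Ca.1.1) (lin_sum Ca.1.1) big1 ?subr0// => j _; rewrite Cy.
by rewrite (le_trans (MP _))// -mulrA ler_wpM2l.
Qed.

Section Extension.
Variable F : l1 -> E.
Hypothesis Ff : finite_rank F.

(** The map that [F] induces on [H n], normalised by the weight of [C]. *)
Definition ladder_map n (x : E) : E := (2^-1 ^+ n)^-1 *: F (l1_inj (a n x)).

Lemma ladder_mapS (Y : l1 -> l1) n x :
  (forall n g, Y (l1_inj g) = 2^-1 ^+ n *:
      (l1_inj g - 2 *: l1_inj (a n.+1 (b n g)))) ->
  (forall z, F (Y z) = 0) -> H n x -> ladder_map n.+1 x = ladder_map n x.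
Proof.
move=> Yi FY Hx; have := FY (l1_inj (a n x)); rewrite Yi (linZ Ff.1.1) => /eqP.
rewrite scaler_eq0 gt_eqF ?half_exp_gt0//= (linB Ff.1.1) (linZ Ff.1.1).
have [_ _ _ _ ba] := mod n; rewrite ba// subr_eq0 => /eqP FE.
by rewrite /ladder_map exprS invfM invrK -scalerA FE scalerA mulrC -scalerA.
Qed.

Lemma ladder_mapD n x y : H n x -> H n y ->
  ladder_map n (x + y) = ladder_map n x + ladder_map n y.
Proof.
move=> Hx Hy; have [al _ _ _ _] := mod n.
rewrite /ladder_map -scalerDr -(linD Ff.1.1) -(linD (@l1_inj_linear _ _ G _)).
by have := al 1 x y Hx Hy; rewrite !scale1r => ->.
Qed.

(** The coordinates of [F] are extended one by one with the Hahn-Banach theorem.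
    The point is the norm of the extension, at most [2^m] times a constant. *)
Lemma ladder_map_extends : exists2 M : K, 0 <= M & forall m,
  exists T : E -> E, [/\ finite_rank T, forall x, H m x -> T x = ladder_map m x &
    forall x, `|T x| <= (2^-1 ^+ m)^-1 * M * `|x|].
Proof.
have [n [z [phi [Cp [[Cp0 phil phiC FE] _]]]]] := finite_rank_functionals Ff.
exists (Cp * 2 * \sum_(j < n) `|z j|); first by rewrite !mulr_ge0// sumr_ge0.
move=> m; have [al a2 _ _ _] := mod m.
pose Cpsi : K := (2^-1 ^+ m)^-1 * (Cp * 2).
have /choice[psi psiP] j : exists psi : E -> K, [/\ linear (psi : E -> K^o),
    forall x, `|psi x| <= Cpsi * `|x| &
    forall x, H m x -> psi x = (2^-1 ^+ m)^-1 * phi j (l1_inj (a m x))].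
  apply: (@hahn_banach R k E (H m) (fun x => (2^-1 ^+ m)^-1 * phi j (l1_inj (a m x)))).
  - by rewrite !mulr_ge0// invr_ge0 half_exp_ge0.
  - move=> c x y Hx Hy; rewrite al// l1_inj_linear.
    by rewrite [phi j _]phil mulrDr mulrCA.
  - move=> x Hx; rewrite normrM normfV (ger0_norm (half_exp_ge0 m)) /Cpsi -[leRHS]mulrA.
    rewrite ler_wpM2l ?invr_ge0 ?half_exp_ge0// (le_trans (phiC _ _))// -mulrA.
    by rewrite ler_wpM2l// (le_trans (l1_inj_norm _))// a2.
have Cpsi0 : 0 <= Cpsi by rewrite !mulr_ge0// invr_ge0 half_exp_ge0.
exists (fun x => comb n z (psi^~ x)); split.
- apply: (comb_finite_rank n z Cpsi0) => j; first by have [] := psiP j.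
  by have [_ h _] := psiP j.
- move=> x Hx; rewrite /ladder_map FE -combZ; apply: eq_comb => // j _.
  by have [_ _ ->] := psiP j.
- move=> x; rewrite mulrA mulrAC; apply: norm_comb_le => j _.
  by have [_ h _] := psiP j.
Qed.

End Extension.

End Ladder.

(** * Flatness implies the approximation property *)

Section Nets.
Context {R : realType} {k : scalar_kind}.
Local Notation K := (scalars R k).
Variable V : normedModType K.

Lemma compact_totally_bounded (A : set V) : compact A -> totally_bounded A.
Proof.
rewrite compact_cover => Ac e e0.
have [|x Ax|D _ AD] := Ac V A (fun y => ball y e).
- by move=> y _; exact: ball_open.
- by exists x => //; exact: ballxx.
exists (finmap.enum_fset D) => x /AD[y /= yD]; rewrite -ball_normE /= => yx.
by exists y => //; rewrite distrC ltW.
Qed.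

Fixpoint seq_span (s : seq V) (x : V) : Prop :=
  if s is y :: s' then exists c z, seq_span s' z /\ x = c *: y + z else x = 0.

Lemma seq_span0 s : seq_span s 0.
Proof.
by elim: s => // y s IH; exists 0, 0; rewrite scale0r addr0.
Qed.

Lemma seq_span_linear s (c : K) x y :
  seq_span s x -> seq_span s y -> seq_span s (c *: x + y).
Proof.
elim: s x y => [|z s IH] x y /=; first by move=> -> ->; rewrite scaler0 addr0.
move=> [a [x' [sx ->]]] [b [y' [sy ->]]]; exists (c * a + b), (c *: x' + y').
by split; [exact: IH|rewrite scalerDr scalerDl scalerA addrACA].
Qed.

Definition span_of s : lsubspace V := Subspace (seq_span0 s) (@seq_span_linear s).

Lemma mem_span_of s x : x \in s -> span_of s x.
Proof.
elim: s => // y s IH; rewrite inE => /predU1P[->|/IH xs].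
  by exists 1, 0; split; [exact: seq_span0|rewrite scale1r addr0].
by exists 0, x; split=> //; rewrite scale0r add0r.
Qed.

Lemma span_of_catr s t x : span_of t x -> span_of (s ++ t) x.
Proof.
by elim: s => // y s IH /IH xs; exists 0, x; split=> //; rewrite scale0r add0r.
Qed.

Lemma span_of_catl s t x : span_of s x -> span_of (s ++ t) x.
Proof.
elim: s x => [x ->|y s IH x [c [z [sz ->]]]]; first exact: seq_span0.
by exists c, z; split=> //; exact: IH.
Qed.

Lemma span_of_fd s : finite_dimensional (lsub_set (span_of s)).
Proof.
exists (size s), (fun i => s`_i) => x; elim: s x => [x ->|y s IH x [c [z [/IH[d ->] ->]]]].
  by exists (fun=> 0); rewrite big_ord0.
exists (fun i => if unlift ord0 i is Some j then d j else c).
rewrite big_ord_recl unlift_none /=; congr (_ + _).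
by apply: eq_bigr => i _; rewrite liftK.
Qed.

End Nets.

Section FlatImpliesAP.
Context {R : realType} {k : scalar_kind}.
Local Notation K := (scalars R k).
Variable G : nat -> completeNormedModType K.
Hypothesis hG : C1_sequence G.
Variable E : completeNormedModType K.
Local Notation l1 := (l1_sum G).

(** Let [H n] be the span of finite nets of the compact set [A] for the radii
    [4^-j], [j <= n]. A finite rank operator [F] that is close to [C] and
    vanishes on the range of [Y] induces maps on the [H n] that extend each
    other; let [T] be an extension of the one on [H m]. A point [p] of the
    [m]-th net is [C v] for some [v] of norm at most [D], and then [T p = F v] is
    close to [C v = p]. The points of [A] are at a distance [4^-m] from such
    points, whereas the norm of [T] is only of order [2^m], so [T] is close to
    the identity on [A]. *)
Lemma flat_AP : right_flat (approx_algebra (E * l1)%type) -> approximation_property E.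
Proof.
move=> Xfl A Acpt e e0.
have Atb := compact_totally_bounded Acpt.
have /choice[net netP] n := Atb _ (half_exp_gt0 (n + n)).
pose fix L n := if n is n'.+1 then net n ++ L n' else net 0%N.
pose H n := span_of (L n).
have H_mono n x : H n x -> H n.+1 x by exact: span_of_catr.
have netH n x : x \in net n -> H n x.
  by move=> xn; case: n xn => [|n] xn; [|apply: span_of_catl]; exact: mem_span_of.
have [i i_inj mods] := fd_models hG (fun n => span_of_fd (L n)).
have /all_sig[ab abP] n : {ab : (E -> G (i n)) * (G (i n) -> E) |
    model (W := G (i n)) (H n) ab.1 ab.2}.
  by apply: cid; have [a [b]] := mods n; exists (a, b).
pose a n := (ab n).1; pose b n := (ab n).2.
have mod n : model (W := G (i n)) (H n) (a n) (b n) by exact: abP.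
have Gfd n : finite_dimensional [set: G n] by have [+ _ _] := hG; apply.
have [C [Y [Ca Ya Ci Yi CY]]] := ladder_operators Gfd H_mono i_inj mod.
pose B0 : K := \sum_(x <- net 0%N) `|x|.
have B00 : 0 <= B0 by apply: sumr_ge0.
(* A bound for the norms of the vectors [v] constructed below: 2 for the first
   term and 10 for the sum of the [10 * 2^-j]. *)
pose D : K := 2 * B0 + 10.
have D0 : 0 < D by rewrite ltr_wpDl// mulr_ge0.
have e2 : 0 < e / 2 by rewrite divr_gt0.
have [F [Ff FY FC]] := flat_annihilator Xfl Ca Ya CY (divr_gt0 e2 D0).
pose Lam := ladder_map a F.
have LamS m x : H m x -> Lam m.+1 x = Lam m x by exact: ladder_mapS Yi FY.
have [CT CT0 ext] := ladder_map_extends mod Ff.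
have [m me] := ltr_mul_half_exp (addr_ge0 CT0 ler01) e2.
have [T [Tf TL TM]] := ext m.
exists T; split=> // x Ax.
have /choice[p pP] j : exists y, y \in net j /\ `|x - y| <= 2^-1 ^+ (j + j).
  by have [y] := netP j x Ax; exists y.
have pH j : H j (p j) by apply: netH; have [] := pP j.
have pd j : `|p j.+1 - p j| <= 5 * 2^-1 ^+ j.+1 * 2^-1 ^+ j.+1.
  rewrite -(subrKA x) (le_trans (ler_normD _ _))// distrC.
  rewrite (le_trans (lerD (pP _).2 (pP _).2))//.
  rewrite addSn addnS !exprS exprD.
  by rewrite le_eqVlt; apply/orP; left; apply/eqP; field.
(* [v] consists of the copies of the increments of [p], which decrease fast
   enough for the weights [2^j] needed to undo those of [C]. *)
have [v [Cv Fv vD]] : exists v : l1, [/\ C v = p m, F v = Lam m (p m) & `|v| <= D].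
  suff [v [Cv Fv vD]] : exists v : l1, [/\ C v = p m, F v = Lam m (p m) &
      `|v| <= 2 * B0 + 10 * (1 - 2^-1 ^+ m)].
    by exists v; split=> //; rewrite (le_trans vD)// lerD2l ler_piMr//.
  elim: m {me T Tf TL TM} => [|m [v [Cv Fv vD]]].
    exists (l1_inj (a 0%N (p 0%N))); have [_ a2 _ _ ba] := mod 0%N; split.
    - by rewrite Ci expr0 scale1r ba.
    - by rewrite /Lam /ladder_map expr0 invr1 scale1r.
    - rewrite expr0 subrr mulr0 addr0 (le_trans (l1_inj_norm _))//.
      rewrite (le_trans (a2 _ (pH _)))// ler_wpM2l//.
      have [p0 _] := pP 0%N; rewrite /B0 (big_rem _ p0)/= lerDl.
      exact: sumr_ge0.
  have [al a2 _ _ ba] := mod m.+1; pose d := p m.+1 - p m.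
  have Hd : H m.+1 d.
    rewrite /d addrC -scaleN1r; apply: lsub_linear; last exact: pH.
    exact/H_mono/pH.
  have -> : p m.+1 = p m + d by rewrite addrC subrK.
  exists (v + (2^-1 ^+ m.+1)^-1 *: l1_inj (a m.+1 d)); split.
  - by rewrite (linD Ca.1.1) Cv (linZ Ca.1.1) Ci ba// scalerA mulVf ?scale1r//.
  - rewrite (linD Ff.1.1) Fv (linZ Ff.1.1) [RHS](ladder_mapD mod)//; last exact/H_mono/pH.
    by rewrite -[ladder_map _ _ _ (p m)]/(Lam m.+1 (p m)) LamS.
  - rewrite (le_trans (ler_normD _ _))//.
    have -> : 2 * B0 + 10 * (1 - 2^-1 ^+ m.+1) =
        (2 * B0 + 10 * (1 - 2^-1 ^+ m)) + 10 * 2^-1 ^+ m.+1 :> K.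
      by rewrite exprS; field.
    rewrite lerD// normrZ normfV ger0_norm ?half_exp_ge0// ler_pdivrMl ?half_exp_gt0//.
    rewrite (le_trans (l1_inj_norm _))// (le_trans (a2 _ Hd))//.
    have -> : 2^-1 ^+ m.+1 * (10 * 2^-1 ^+ m.+1) =
      2 * (5 * 2^-1 ^+ m.+1 * 2^-1 ^+ m.+1) :> K by ring.
    by rewrite ler_wpM2l// pd.
have Tp : `|T (p m) - p m| <= e / 2.
  rewrite TL// -[ladder_map _ _ _ _]/(Lam m (p m)) -Fv -Cv (le_trans (FC v))//.
  by rewrite -[leRHS](divfK (lt0r_neq0 D0)) ler_wpM2l// divr_ge0// ltW.
have -> : T x - x = (T (x - p m) - (x - p m)) + (T (p m) - p m).
  by rewrite (linB Tf.1.1) opprB -addrA (addrC (p m - x)) !subrKA.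
rewrite (le_lt_trans (ler_normD _ _))// [e]splitr ltr_leD//.
rewrite (le_lt_trans (ler_normB _ _))// (le_lt_trans _ me)// mulrDl mul1r lerD//.
  rewrite (le_trans (TM _))//.
  rewrite (le_trans (ler_wpM2l _ (pP m).2))//.
    by rewrite mulr_ge0// invr_ge0 half_exp_ge0.
  rewrite exprD le_eqVlt; apply/orP; left; apply/eqP.
  by rewrite [_^-1 * CT]mulrC -mulrA mulKf// lt0r_neq0// half_exp_gt0.
by rewrite (le_trans (pP m).2)// half_exp_le// leq_addr.
Qed.

End FlatImpliesAP.

Theorem theorem1 (R : realType) (k : scalar_kind)
    (E : completeNormedModType (scalars R k))
    (G : nat -> completeNormedModType (scalars R k)) (hG : C1_sequence G) :
  (approximation_property E <->
     right_flat (approx_algebra (E * l1_sum G)%type)) /\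
  (right_flat (approx_algebra (E * l1_sum G)%type) <->
     right_universally_flat (approx_algebra (E * l1_sum G)%type)).
Proof.
have AP_uflat := @AP_universally_flat R k G hG E.
have flat_AP := @flat_AP R k G hG E.
have uflat_flat := @right_universally_flat_flat _ (approx_algebra (E * l1_sum G)%type).
split; split.
- by move=> /AP_uflat/uflat_flat.
- exact: flat_AP.
- by move=> /flat_AP/AP_uflat.
- exact: uflat_flat.
Qed.
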